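(* Let $A$ be a separable $C^*$-algebra and $B \subset A$ a hereditary $C^*$-subalgebra. Then $\mathrm{dr}\, B \le \mathrm{dr}\, A$.
   Context: Abbreviations: c.p. = completely positive; c.p.c. = completely positive contractive. Order zero: a c.p. map $\varphi : F \to A$ from a finite-dimensional $C^*$-algebra $F$ to a $C^*$-algebra $A$ has strict order zero if $\varphi(e)\varphi(e')=0$ for any two orthogonal minimal projections $e, e' \in F$. $n$-decomposable: a c.p. map $\varphi : \bigoplus_{i=1}^s M_{r_i} \to A$ is $n$-decomposable if there is a decomposition $\{1,\ldots,s\} = \coprod_{j=0}^n I_j$ such that the restriction of $\varphi$ to $\bigoplus_{i \in I_j} M_{r_i}$ has strict order zero for each $j \in \{0,\ldots,n\}$. A c.p. approximation $(F,\psi,\varphi)$ (of $A$) for $b_1,\ldots,b_m \in A$ within $\varepsilon$ consists of a finite-dimensional $C^*$-algebra $F$ and c.p.c. maps $\psi : A \to F$, $\varphi : F \to A$ with $\|\varphi\psi(b_i) - b_i\| < \varepsilon$ for all $i$. Decomposition rank: for a separable $C^*$-algebra $A$, $\mathrm{dr}\,A$ is the least integer $n \geq 0$ such that for every finite set $\{b_1,\ldots,b_m\} \subset A$ and every $\varepsilon > 0$ there is a c.p. approximation $(F,\psi,\varphi)$ of $A$ for $b_1,\ldots,b_m$ within $\varepsilon$ with $\varphi$ $n$-decomposable; $\mathrm{dr}\,A = \infty$ if no such $n$ exists. *)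

(* Defs.v *)
From HB Require Import structures.
From mathcomp Require Import all_boot all_order all_algebra.
From mathcomp Require Import all_classical all_reals all_analysis.
From mathcomp Require Import complex.

Set Implicit Arguments.
Unset Strict Implicit.
Unset Printing Implicit Defensive.

Import Order.TTheory GRing.Theory Num.Theory.
Import numFieldNormedType.Exports.

Local Open Scope classical_set_scope.
Local Open Scope ring_scope.

(* C*-algebras over the complex numbers R[i], not assumed unital: the ring
   structures of the library have a unit, so the product is a new operation.
   The norm takes its values in the nonnegative reals inside R[i]. *)
HB.mixin Record CompleteNormedModule_isCStarAlgebra (R : realType) A
    & CompleteNormedModule R[i] A := {
  cmul : A -> A -> A;
  cstar : A -> A;
  cmulA : associative cmul;
  cmulDl : left_distributive cmul +%R;
  cmulDr : right_distributive cmul +%R;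
  cmulZl : forall (c : R[i]) x y, cmul (c *: x) y = c *: cmul x y;
  cmulZr : forall (c : R[i]) x y, cmul x (c *: y) = c *: cmul x y;
  cstarK : involutive cstar;
  cstarD : {morph cstar : x y / x + y};
  cstarZ : forall (c : R[i]) x, cstar (c *: x) = c^* *: cstar x;
  cstarM : forall x y, cstar (cmul x y) = cmul (cstar y) (cstar x);
  cnormM : forall x y, `|cmul x y| <= `|x| * `|y|;
  cnorm_cstar : forall x, `|cmul (cstar x) x| = `|x| ^+ 2
}.

#[short(type="cstarAlgType")]
HB.structure Definition CStarAlgebra (R : realType) :=
  {A of CompleteNormedModule R[i] A
      & CompleteNormedModule_isCStarAlgebra R A}.

Definition separable (T : topologicalType) : Prop :=
  exists2 D : set T, countable D & dense D.

Section Positivity.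
Context {R : realType}.

Definition positive (A : cstarAlgType R) (a : A) : Prop :=
  exists x : A, a = cmul (cstar x) x.

(* Positivity in the C*-algebra M_k(A): M is of the form X^* X. *)
Definition positive_mx (A : cstarAlgType R) (k : nat) (M : 'M[A]_k) : Prop :=
  exists X : 'M[A]_k, M = \matrix_(i, j) \sum_l cmul (cstar (X l i)) (X l j).

Definition completely_positive (A B : cstarAlgType R) (phi : {linear A -> B})
    : Prop :=
  forall (k : nat) (M : 'M[A]_k), positive_mx M -> positive_mx (map_mx phi M).

Definition contractive (A B : cstarAlgType R) (phi : A -> B) : Prop :=
  forall x : A, `|phi x| <= `|x|.

Definition cpc (A B : cstarAlgType R) (phi : {linear A -> B}) : Prop :=
  completely_positive phi /\ contractive phi.

End Positivity.

Record cstarSubalg (R : realType) (A : cstarAlgType R) := CStarSubalg {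
  subalg_set : set A;
  subalg_closed : closed subalg_set;
  subalg0 : subalg_set 0;
  subalgD : forall x y, subalg_set x -> subalg_set y -> subalg_set (x + y);
  subalgZ : forall (c : R[i]) x, subalg_set x -> subalg_set (c *: x);
  subalgM : forall x y, subalg_set x -> subalg_set y -> subalg_set (cmul x y);
  subalg_star : forall x, subalg_set x -> subalg_set (cstar x)
}.

Definition hereditary (R : realType) (A : cstarAlgType R) (B : cstarSubalg A)
    : Prop :=
  forall a b : A, subalg_set B b -> positive a -> positive b ->
    positive (b - a) -> subalg_set B a.

(* A C*-subalgebra is a C*-algebra in its own right, with the operations and
   the norm of the ambient algebra. *)
Section SubalgType.
Context {R : realType} {A : cstarAlgType R} (B : cstarSubalg A).

Definition subalg_pred : {pred A} := mem (subalg_set B).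

Lemma subalg_predP x : reflect (subalg_set B x) (x \in subalg_pred).
Proof. by apply: (iffP idP); rewrite /subalg_pred !inE. Qed.

Lemma subalg_submod_closed : submod_closed subalg_pred.
Proof.
split=> [|c x y /subalg_predP Bx /subalg_predP By]; apply/subalg_predP.
  exact: subalg0.
by apply: subalgD => //; apply: subalgZ.
Qed.

HB.instance Definition _ :=
  GRing.isSubmodClosed.Build R[i] A subalg_pred subalg_submod_closed.

Record subalg_type := SubalgType {
  subalg_val : A;
  subalg_valP : subalg_val \in subalg_pred
}.

HB.instance Definition _ := [isSub for subalg_val].
HB.instance Definition _ := [Choice of subalg_type by <:].
HB.instance Definition _ := [SubChoice_isSubLmodule of subalg_type by <:].

Implicit Types x y : subalg_type.

Lemma subalgP x : subalg_set B (val x).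
Proof. exact/subalg_predP/valP. Qed.

Let sub_norm x : R[i] := `|val x|.

Let sub_ler_normD x y : sub_norm (x + y) <= sub_norm x + sub_norm y.
Proof. exact: ler_normD. Qed.

Let sub_normrZ (c : R[i]) x : sub_norm (c *: x) = `|c| * sub_norm x.
Proof. exact: normrZ. Qed.

Let sub_normr0_eq0 x : sub_norm x = 0 -> x = 0.
Proof. by move=> /normr0_eq0 x0; apply: val_inj. Qed.

HB.instance Definition _ := Lmodule_isNormed.Build R[i] subalg_type
  sub_ler_normD sub_normrZ sub_normr0_eq0.

Lemma subalg_normE x : `|x| = `|val x|.
Proof. by []. Qed.

Let sub_cauchy_cvg (F : set_system subalg_type) :
  ProperFilter F -> cauchy F -> cvg F.
Proof.
move=> FF /cauchy_ballP Fc.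
have /cauchy_cvg : cauchy (val @ F).
  apply/cauchy_ballP => e e0; rewrite near_simpl.
  have := Fc _ e0; rewrite !near_simpl.
  by rewrite -!ball_normE.
move=> /cvg_ex[/= a Fa].
have Ba : subalg_set B a.
  apply: (@closed_cvg _ _ F FF val (subalg_set B)) => //; first exact: subalg_closed.
  by apply: nearW => x; exact: subalgP.
have Ba' : a \in subalg_pred by apply/subalg_predP.
apply/cvg_ex; exists (SubalgType Ba').
apply/cvgrPdist_lt => e e0.
by move/cvgrPdist_lt: Fa => /(_ _ e0).
Qed.

HB.instance Definition _ :=
  Uniform_isComplete.Build subalg_type sub_cauchy_cvg.

Let sub_mul x y : subalg_type :=
  SubalgType (introT (subalg_predP _) (subalgM (subalgP x) (subalgP y))).
Let sub_star x : subalg_type :=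
  SubalgType (introT (subalg_predP _) (subalg_star (subalgP x))).

Let sub_mulA : associative sub_mul.
Proof. by move=> x y z; apply: val_inj; exact: cmulA. Qed.
Let sub_mulDl : left_distributive sub_mul +%R.
Proof. by move=> x y z; apply: val_inj; exact: cmulDl. Qed.
Let sub_mulDr : right_distributive sub_mul +%R.
Proof. by move=> x y z; apply: val_inj; exact: cmulDr. Qed.
Let sub_mulZl (c : R[i]) x y : sub_mul (c *: x) y = c *: sub_mul x y.
Proof. by apply: val_inj; exact: cmulZl. Qed.
Let sub_mulZr (c : R[i]) x y : sub_mul x (c *: y) = c *: sub_mul x y.
Proof. by apply: val_inj; exact: cmulZr. Qed.
Let sub_starK : involutive sub_star.
Proof. by move=> x; apply: val_inj; exact: cstarK. Qed.
Let sub_starD : {morph sub_star : x y / x + y}.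
Proof. by move=> x y; apply: val_inj; exact: cstarD. Qed.
Let sub_starZ (c : R[i]) x : sub_star (c *: x) = c^* *: sub_star x.
Proof. by apply: val_inj; exact: cstarZ. Qed.
Let sub_starM x y : sub_star (sub_mul x y) = sub_mul (sub_star y) (sub_star x).
Proof. by apply: val_inj; exact: cstarM. Qed.
Let sub_normM x y : `|sub_mul x y| <= `|x| * `|y|.
Proof. exact: cnormM. Qed.
Let sub_norm_star x : `|sub_mul (sub_star x) x| = `|x| ^+ 2.
Proof. exact: cnorm_cstar. Qed.

HB.instance Definition _ :=
  CompleteNormedModule_isCStarAlgebra.Build R subalg_type
    sub_mulA sub_mulDl sub_mulDr sub_mulZl sub_mulZr
    sub_starK sub_starD sub_starZ sub_starM sub_normM sub_norm_star.

Lemma val_cmul x y : val (cmul x y) = cmul (val x) (val y).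
Proof. by []. Qed.

Lemma val_cstar x : val (cstar x) = cstar (val x).
Proof. by []. Qed.

End SubalgType.

Section FiniteDimensional.
Context {R : realType}.

Definition finite_dimensional (F : cstarAlgType R) : Prop :=
  exists (d : nat) (v : 'I_d -> F),
    forall x : F, exists c : 'I_d -> R[i], x = \sum_i c i *: v i.

(* An isomorphism of *-algebras from F onto the direct sum of the M_(r i). No
   norm on the right-hand side is needed: the C*-norm of F is determined by its
   *-algebra structure. *)
Record matrix_decomposition (F : cstarAlgType R) (s : nat) (r : 'I_s -> nat)
    (pi : F -> forall i : 'I_s, 'M[R[i]]_(r i)) : Prop := {
  mxdec_pos : forall i, (0 < r i)%N;
  mxdec_bij : bijective pi;
  mxdecD : forall x y i, pi (x + y) i = pi x i + pi y i;
  mxdecZ : forall (c : R[i]) x i, pi (c *: x) i = c *: pi x i;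
  mxdecM : forall x y i, pi (cmul x y) i = pi x i *m pi y i;
  mxdec_star : forall x i, pi (cstar x) i = map_mx Num.conj (pi x i)^T
}.

Definition projection (A : cstarAlgType R) (e : A) : Prop :=
  cstar e = e /\ cmul e e = e.

(* e is a minimal projection of the subalgebra S of A: a nonzero projection
   without proper nonzero subprojections in S. *)
Definition minimal_projection (A : cstarAlgType R) (S : set A) (e : A) : Prop :=
  [/\ S e, projection e, e != 0 &
      forall q, S q -> projection q -> cmul e q = q -> q = 0 \/ q = e].

(* The restriction of phi to the subalgebra S has strict order zero. *)
Definition strict_order_zero_on (F A : cstarAlgType R) (S : set F)
    (phi : F -> A) : Prop :=
  forall e e', minimal_projection S e -> minimal_projection S e' ->
    cmul e e' = 0 -> cmul (phi e) (phi e') = 0.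

(* The decomposition {1,...,s} = I_0 + ... + I_n is given by the map c sending
   an index to the label of its part; parts may be empty. *)
Definition n_decomposable (n : nat) (F A : cstarAlgType R)
    (phi : {linear F -> A}) : Prop :=
  completely_positive phi /\
  exists (s : nat) (r : 'I_s -> nat) (pi : F -> forall i : 'I_s, 'M[R[i]]_(r i))
         (c : 'I_s -> 'I_n.+1),
    matrix_decomposition pi /\
    forall j : 'I_n.+1,
      strict_order_zero_on [set x | forall i, c i != j -> pi x i = 0] phi.

Definition cp_approximation (A F : cstarAlgType R)
    (psi : {linear A -> F}) (phi : {linear F -> A})
    (m : nat) (b : 'I_m -> A) (eps : R) : Prop :=
  [/\ finite_dimensional F, cpc psi, cpc phi &
      forall i, `|phi (psi (b i)) - b i| < eps%:C%C].

Definition dr_property (A : cstarAlgType R) (n : nat) : Prop :=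
  forall (m : nat) (b : 'I_m -> A) (eps : R), 0 < eps ->
    exists (F : cstarAlgType R) (psi : {linear A -> F}) (phi : {linear F -> A}),
      cp_approximation psi phi b eps /\ n_decomposable n phi.

End FiniteDimensional.

(* The decomposition rank, as an extended real: the least n with dr_property,
   or +oo if there is none. *)
Definition dr (R : realType) (A : cstarAlgType R) : \bar R :=
  match pselect (exists n, `[< dr_property A n >]) with
  | left ex_n => (ex_minn ex_n)%:R%:E
  | right _ => +oo%E
  end.

(* Main.v *)
(** An approximation (F, psi, phi) of A is compressed to B. Choose a positive h in B
    dominating the positive elements to be approximated, let p be a spectral
    projection of psi(h) at a small eta and pass to the corner p F p. Since
    phi(p) <= phi(psi(h)) / eta is close to h / eta, phi maps p F p almost into B.
    On each of the n + 1 parts, strict order zero gives phi(x) phi(y) = phi(1) phi(x y),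
    because a matrix algebra is spanned by minimal projections. Therefore, if
    a = phi(p_j) and w = f w' with f in B, w close to 1 on a and w* w in the bicommutant
    of a, then w phi(.) w* still has strict order zero, and it takes values in B as B is
    hereditary. Such a w is the polar part of f q, multiplied by q, where q is a
    continuous function of a cut off near 0. All functional calculus is reduced to square
    roots, which come from a fixed point iteration in the unitization of A and in the
    matrix algebras over it. *)

Require Import Defs.
From HB Require Import structures.
From mathcomp Require Import all_boot all_order all_algebra.
From mathcomp Require Import all_classical all_reals all_analysis.
From mathcomp Require Import complex ring lra.

Set Implicit Arguments.
Unset Strict Implicit.
Unset Printing Implicit Defensive.

Import Order.TTheory GRing.Theory Num.Theory.
Import numFieldNormedType.Exports.

Local Open Scope ring_scope.

(** * Normalisation in noncommutative algebras *)

(** Strict order zero is an exact condition, so a map that has it up to a small error would be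
    useless; conjugation keeps it exact. If w* w commutes with phi(x), then w phi(x) w* w phi(y) w*
    = w w* w phi(x) phi(y) w*, which is 0 as soon as phi(x) phi(y) is. Commutation with a = phi(p_j)
    is all that can be read off from order zero, hence the demand that w* w lie in the bicommutant
    of a; and each part needs its own w, since nothing relates the images of different parts. The
    corner is unavoidable: an element of F far from psi(h) may be sent anywhere in A. All tolerances
    must be fixed before F and phi are known. So the estimates on q and w may depend on the wanted
    precision only, not on a or f, and the square root must be uniformly continuous on bounded
    positive elements. Several tolerances occur squared because an estimate on x a x* bounds x a
    only up to a square root. *)

Inductive scal_expr :=
| SVar of nat | SZero | SOne | SAdd of scal_expr & scal_expr | SOpp of scal_expr
| SMul of scal_expr & scal_expr | SMuln of scal_expr & nat.

Inductive alg_expr :=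
| AVar of nat | AZero | AOne | AAdd of alg_expr & alg_expr | AOpp of alg_expr
| AMul of alg_expr & alg_expr | AScale of scal_expr & alg_expr
| AMuln of alg_expr & nat.

(* A polynomial is a list of monomials: an integer coefficient, a sorted list
   of scalar variables and a word in the algebra variables. *)
Definition alg_poly := seq (int * (seq nat * seq nat)).

Definition poly_opp (p : alg_poly) : alg_poly := [seq (- m.1, m.2) | m <- p].
Definition poly_muln (p : alg_poly) (n : nat) : alg_poly :=
  [seq (m.1 *+ n, m.2) | m <- p].
Definition mono_mul (m n : int * (seq nat * seq nat)) :=
  (m.1 * n.1, (sort leq (m.2.1 ++ n.2.1), m.2.2 ++ n.2.2)).
Definition poly_mul (p q : alg_poly) : alg_poly :=
  [seq mono_mul m n | m <- p, n <- q].

Fixpoint scal_norm (e : scal_expr) : alg_poly :=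
  match e with
  | SVar i => [:: (1, ([:: i], [::]))]
  | SZero => [::]
  | SOne => [:: (1, ([::], [::]))]
  | SAdd a b => scal_norm a ++ scal_norm b
  | SOpp a => poly_opp (scal_norm a)
  | SMul a b => poly_mul (scal_norm a) (scal_norm b)
  | SMuln a n => poly_muln (scal_norm a) n
  end.

Fixpoint alg_norm (e : alg_expr) : alg_poly :=
  match e with
  | AVar i => [:: (1, ([::], [:: i]))]
  | AZero => [::]
  | AOne => [:: (1, ([::], [::]))]
  | AAdd a b => alg_norm a ++ alg_norm b
  | AOpp a => poly_opp (alg_norm a)
  | AMul a b => poly_mul (alg_norm a) (alg_norm b)
  | AScale s a => poly_mul (scal_norm s) (alg_norm a)
  | AMuln a n => poly_muln (alg_norm a) n
  end.

(** Each round adds up the coefficients of all monomials sharing the word of the head and discards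
    these monomials, so [fuel] need only reach the number of distinct words. *)
Fixpoint poly_is0 (fuel : nat) (p : alg_poly) : bool :=
  match fuel, p with
  | _, [::] => true
  | k.+1, m :: p' =>
    (m.1 + foldr (fun n z => if n.2 == m.2 then n.1 + z else z) 0 p' == 0)
    && poly_is0 k [seq n <- p' | n.2 != m.2]
  | _, _ => false
  end.

Section AlgEval.
Variables (R : comNzRingType) (T : algType R) (vs : seq R) (vt : seq T).

Fixpoint scal_eval (e : scal_expr) : R :=
  match e with
  | SVar i => nth 0 vs i
  | SZero => 0
  | SOne => 1
  | SAdd a b => scal_eval a + scal_eval b
  | SOpp a => - scal_eval a
  | SMul a b => scal_eval a * scal_eval b
  | SMuln a n => scal_eval a *+ n
  end.

Fixpoint alg_eval (e : alg_expr) : T :=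
  match e with
  | AVar i => nth 0 vt i
  | AZero => 0
  | AOne => 1
  | AAdd a b => alg_eval a + alg_eval b
  | AOpp a => - alg_eval a
  | AMul a b => alg_eval a * alg_eval b
  | AScale s a => scal_eval s *: alg_eval a
  | AMuln a n => alg_eval a *+ n
  end.

Definition word_eval (w : seq nat * seq nat) : T :=
  (\prod_(i <- w.1) nth 0 vs i) *: \prod_(i <- w.2) nth 0 vt i.

Definition poly_eval (p : alg_poly) : T := \sum_(m <- p) word_eval m.2 *~ m.1.

Lemma poly_eval_cat p q : poly_eval (p ++ q) = poly_eval p + poly_eval q.
Proof. by rewrite /poly_eval big_cat. Qed.

Lemma poly_eval_opp p : poly_eval (poly_opp p) = - poly_eval p.
Proof.
rewrite /poly_eval /poly_opp big_map -sumrN.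
by apply: eq_bigr => m _; rewrite mulrNz.
Qed.

Lemma poly_eval_muln p n : poly_eval (poly_muln p n) = poly_eval p *+ n.
Proof.
rewrite /poly_eval /poly_muln big_map -sumrMnl.
by apply: eq_bigr => m _; rewrite -mulr_natr natz mulrzA -pmulrn.
Qed.

Lemma poly_eval_mul p q : poly_eval (poly_mul p q) = poly_eval p * poly_eval q.
Proof.
rewrite /poly_eval /poly_mul big_allpairs_dep mulr_suml; apply: eq_bigr => m _.
rewrite mulr_sumr; apply: eq_bigr => n _ /=.
rewrite mulrzAl mulrzAr -mulrzA [n.1 * m.1]mulrC; congr (_ *~ _).
rewrite /word_eval /= (perm_big _ (permEl (perm_sort _ _))) /= !big_cat /=.
by rewrite -scalerAl -scalerAr scalerA.
Qed.

Lemma scal_normP e : poly_eval (scal_norm e) = scal_eval e *: 1.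
Proof.
elim: e => [i|||a IHa b IHb|a IHa|a IHa b IHb|a IHa n] /=.
- by rewrite /poly_eval big_seq1 /word_eval /= big_seq1 big_nil.
- by rewrite /poly_eval big_nil scale0r.
- by rewrite /poly_eval big_seq1 /word_eval /= !big_nil.
- by rewrite poly_eval_cat IHa IHb scalerDl.
- by rewrite poly_eval_opp IHa scaleNr.
- by rewrite poly_eval_mul IHa IHb -scalerAl mul1r scalerA.
- by rewrite poly_eval_muln IHa scalerMnl.
Qed.

Lemma alg_normP e : poly_eval (alg_norm e) = alg_eval e.
Proof.
elim: e => [i|||a IHa b IHb|a IHa|a IHa b IHb|s a IHa|a IHa n] /=.
- by rewrite /poly_eval big_seq1 /word_eval /= big_seq1 big_nil scale1r.
- by rewrite /poly_eval big_nil.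
- by rewrite /poly_eval big_seq1 /word_eval /= !big_nil scale1r.
- by rewrite poly_eval_cat IHa IHb.
- by rewrite poly_eval_opp IHa.
- by rewrite poly_eval_mul IHa IHb.
- by rewrite poly_eval_mul IHa scal_normP -scalerAl mul1r.
- by rewrite poly_eval_muln IHa.
Qed.

Lemma poly_is0P k p : poly_is0 k p -> poly_eval p = 0.
Proof.
have split_word w (q : alg_poly) : poly_eval q =
    word_eval w *~ foldr (fun n z => if n.2 == w then n.1 + z else z) 0 q
    + poly_eval [seq n <- q | n.2 != w].
  elim: q => [|m q IH] /=; first by rewrite /poly_eval big_nil mulr0z addr0.
  have -> : poly_eval (m :: q) = word_eval m.2 *~ m.1 + poly_eval q.
    by rewrite /poly_eval big_cons.
  rewrite IH; case: eqP => [->|_] /=; first by rewrite mulrzDr addrA.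
  rewrite addrCA; congr (_ + _).
  by rewrite /poly_eval big_cons.
elim: k p => [|k IH] [|m p] //=; try by rewrite /poly_eval big_nil.
move=> /andP[/eqP m0 /IH p0].
have -> : poly_eval (m :: p) = word_eval m.2 *~ m.1 + poly_eval p.
  by rewrite /poly_eval big_cons.
by rewrite (split_word m.2 p) p0 addr0 -mulrzDr m0.
Qed.

Lemma alg_eqP k a b :
  poly_is0 k (alg_norm a ++ poly_opp (alg_norm b)) -> alg_eval a = alg_eval b.
Proof.
move=> /poly_is0P; rewrite poly_eval_cat poly_eval_opp !alg_normP.
by move=> /eqP; rewrite subr_eq0 => /eqP.
Qed.

End AlgEval.

Ltac nc_add x l :=
  lazymatch l with
  | nil => constr:(cons x nil)
  | cons x _ => l
  | cons ?y ?l' => let l2 := nc_add x l' in constr:(cons y l2)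
  end.
Ltac nc_index x l :=
  lazymatch l with
  | cons x _ => constr:(0%N)
  | cons _ ?l' => let i := nc_index x l' in constr:(S i)
  end.

Ltac nc_svars e l :=
  lazymatch e with
  | (?a + ?b)%R => let l1 := nc_svars a l in nc_svars b l1
  | (?a * ?b)%R => let l1 := nc_svars a l in nc_svars b l1
  | (- ?a)%R => nc_svars a l
  | (?a ^+ 2)%R => nc_svars a l
  | (?a *+ ?n)%R => nc_svars a l
  | 0%R => l
  | 1%R => l
  | _ => nc_add e l
  end.
Ltac nc_sreify e l :=
  lazymatch e with
  | (?a + ?b)%R =>
    let x := nc_sreify a l in let y := nc_sreify b l in constr:(SAdd x y)
  | (?a * ?b)%R =>
    let x := nc_sreify a l in let y := nc_sreify b l in constr:(SMul x y)
  | (?a ^+ 2)%R => let x := nc_sreify a l in constr:(SMul x x)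
  | (- ?a)%R => let x := nc_sreify a l in constr:(SOpp x)
  | (?a *+ ?n)%R => let x := nc_sreify a l in constr:(SMuln x n)
  | 0%R => constr:(SZero)
  | 1%R => constr:(SOne)
  | _ => let i := nc_index e l in constr:(SVar i)
  end.
Ltac nc_vars e st :=
  lazymatch e with
  | (?a + ?b)%R => let s1 := nc_vars a st in nc_vars b s1
  | (?a * ?b)%R => let s1 := nc_vars a st in nc_vars b s1
  | (- ?a)%R => nc_vars a st
  | (?a ^+ 2)%R => nc_vars a st
  | (?c *: ?a)%R =>
    lazymatch st with
    | (?ls, ?lt) => let ls' := nc_svars c ls in nc_vars a constr:((ls', lt))
    end
  | (?a *+ ?n)%R => nc_vars a st
  | 0%R => st
  | 1%R => st
  | _ => lazymatch st with
         | (?ls, ?lt) => let lt' := nc_add e lt in constr:((ls, lt'))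
         end
  end.
Ltac nc_reify e ls lt :=
  lazymatch e with
  | (?a + ?b)%R =>
    let x := nc_reify a ls lt in let y := nc_reify b ls lt in constr:(AAdd x y)
  | (?a * ?b)%R =>
    let x := nc_reify a ls lt in let y := nc_reify b ls lt in constr:(AMul x y)
  | (?a ^+ 2)%R => let x := nc_reify a ls lt in constr:(AMul x x)
  | (- ?a)%R => let x := nc_reify a ls lt in constr:(AOpp x)
  | (?c *: ?a)%R =>
    let s := nc_sreify c ls in let x := nc_reify a ls lt in constr:(AScale s x)
  | (?a *+ ?n)%R => let x := nc_reify a ls lt in constr:(AMuln x n)
  | 0%R => constr:(AZero)
  | 1%R => constr:(AOne)
  | _ => let i := nc_index e lt in constr:(AVar i)
  end.

(** Stars, inverses and all other foreign subterms become atoms. Thus [2^-1] and 2 do not cancel,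
    and such cancellations are done by hand around the calls. *)
Ltac ncring_over R T :=
  lazymatch goal with
  | |- ?a = ?b =>
    let st0 := constr:((@nil R, @nil T)) in
    let st1 := nc_vars a st0 in
    let st := nc_vars b st1 in
    lazymatch st with
    | (?ls, ?lt) =>
      let x := nc_reify a ls lt in
      let y := nc_reify b ls lt in
      apply: (@alg_eqP _ _ ls lt 1000 x y);
      vm_compute; reflexivity
    end
  end.

(** * Unital C*-algebras *)

(** Scalars and norm are real and the complex structure is reduced to a central skew-adjoint [ii] of
    square -1, so that norm estimates are inequalities in [R]. Completeness is sequential, which
    lets unitizations and matrix algebras be instances without carrying a topology. *)
HB.mixin Record Algebra_isUCStar (R : realType) T & GRing.Algebra R T := {
  ii : T;
  star : T -> T;
  nrm : T -> R;
  iiC_subproof : forall x, ii * x = x * ii;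
  ii2_subproof : ii * ii = -1;
  star_ii_subproof : star ii = - ii;
  starK_subproof : involutive star;
  starD_subproof : {morph star : x y / x + y};
  starZ_subproof : forall (c : R) x, star (c *: x) = c *: star x;
  starM_subproof : forall x y, star (x * y) = star y * star x;
  nrmD_subproof : forall x y, nrm (x + y) <= nrm x + nrm y;
  nrmZ_subproof : forall (c : R) x, nrm (c *: x) = `|c| * nrm x;
  nrmM_subproof : forall x y, nrm (x * y) <= nrm x * nrm y;
  nrm_starM_subproof : forall x, nrm (star x * x) = nrm x ^+ 2;
  nrm0_eq0_subproof : forall x, nrm x = 0 -> x = 0;
  nrm_complete_subproof : forall u : nat -> T,
    (forall e, 0 < e -> exists N, forall m n, (N <= m)%N -> (N <= n)%N ->
      nrm (u m - u n) <= e) ->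
    exists l, forall e, 0 < e -> exists N, forall n, (N <= n)%N ->
      nrm (u n - l) <= e
}.

#[short(type="ucstarType")]
HB.structure Definition UCStar (R : realType) :=
  {T of GRing.Algebra R T & Algebra_isUCStar R T}.

Ltac ncring :=
  refine (_ : @eq (UCStar.sort _) _ _);
  lazymatch goal with
  | |- @eq (@UCStar.sort ?R ?T) _ _ => ncring_over R T
  end.

Section UCStarTheory.
Context {R : realType} {T : ucstarType R}.
Implicit Types (x y z a b s : T) (c e t : R) (u v : nat -> T).

(* The axioms of the mixin are restated because HB leaves the algebra operations
   in them in unfolded form, on which canonical structure inference fails. *)
Lemma iiC x : ii * x = x * ii. Proof. exact: iiC_subproof. Qed.
Lemma ii2 : ii * ii = -1 :> T. Proof. exact: ii2_subproof. Qed.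
Lemma star_ii : star ii = - ii :> T. Proof. exact: star_ii_subproof. Qed.
Lemma starK : involutive (star : T -> T). Proof. exact: starK_subproof. Qed.
Lemma starD : {morph (star : T -> T) : x y / x + y}.
Proof. exact: starD_subproof. Qed.
Lemma starZ c x : star (c *: x) = c *: star x. Proof. exact: starZ_subproof. Qed.
Lemma starM x y : star (x * y) = star y * star x.
Proof. exact: starM_subproof. Qed.
Lemma nrmD x y : nrm (x + y) <= nrm x + nrm y. Proof. exact: nrmD_subproof. Qed.
Lemma nrmZ c x : nrm (c *: x) = `|c| * nrm x. Proof. exact: nrmZ_subproof. Qed.
Lemma nrmM x y : nrm (x * y) <= nrm x * nrm y. Proof. exact: nrmM_subproof. Qed.
Lemma nrm_starM x : nrm (star x * x) = nrm x ^+ 2.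
Proof. exact: nrm_starM_subproof. Qed.
Lemma nrm0_eq0 x : nrm x = 0 -> x = 0. Proof. exact: nrm0_eq0_subproof. Qed.
Lemma nrm_complete u :
  (forall e, 0 < e -> exists N, forall m n, (N <= m)%N -> (N <= n)%N ->
      nrm (u m - u n) <= e) ->
  exists x, forall e, 0 < e -> exists N, forall n, (N <= n)%N -> nrm (u n - x) <= e.
Proof. exact: nrm_complete_subproof. Qed.

Lemma nrm0 : nrm (0 : T) = 0.
Proof. by rewrite -(scale0r (0 : T)) nrmZ normr0 mul0r. Qed.

Lemma nrmN x : nrm (- x) = nrm x.
Proof. by rewrite -scaleN1r nrmZ normrN1 mul1r. Qed.

Lemma nrm_ge0 x : 0 <= nrm x.
Proof. by have := nrmD x (- x); rewrite subrr nrm0 nrmN; lra. Qed.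

Lemma nrmB x y : nrm (x - y) <= nrm x + nrm y.
Proof. by rewrite (le_trans (nrmD _ _)) ?nrmN. Qed.

Lemma nrmBC x y : nrm (x - y) = nrm (y - x).
Proof. by rewrite -nrmN opprB. Qed.

Lemma nrm_tri x y z : nrm (x - z) <= nrm (x - y) + nrm (y - z).
Proof. by apply: le_trans (nrmD _ _); rewrite addrA subrK. Qed.

Lemma nrm_sum (I : Type) (r : seq I) (P : pred I) (F : I -> T) :
  nrm (\sum_(i <- r | P i) F i) <= \sum_(i <- r | P i) nrm (F i).
Proof.
elim/big_ind2: _ => [|x1 t1 x2 t2 h1 h2|//]; first by rewrite nrm0.
by apply: le_trans (nrmD _ _) _; apply: lerD.
Qed.

Lemma nrmM_le x y c e : nrm x <= c -> nrm y <= e -> nrm (x * y) <= c * e.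
Proof.
move=> xc ye; apply: le_trans (nrmM _ _) _.
by apply: ler_pM => //; exact: nrm_ge0.
Qed.

Lemma star0 : star (0 : T) = 0.
Proof. by rewrite -(scale0r (0 : T)) starZ !scale0r. Qed.

Lemma starN x : star (- x) = - star x.
Proof. by rewrite -scaleN1r starZ scaleN1r. Qed.

Lemma starB x y : star (x - y) = star x - star y.
Proof. by rewrite starD starN. Qed.

Lemma star1 : star (1 : T) = 1.
Proof. by have := starM 1 (star 1); rewrite mul1r starK mul1r. Qed.

Lemma starX x n : star (x ^+ n) = star x ^+ n.
Proof. by elim: n => [|n IH]; rewrite ?star1 // exprS starM IH exprSr. Qed.

Lemma star_sum (I : Type) (r : seq I) (P : pred I) (F : I -> T) :
  star (\sum_(i <- r | P i) F i) = \sum_(i <- r | P i) star (F i).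
Proof. exact: (big_morph _ starD star0). Qed.

Lemma nrm_star x : nrm (star x) = nrm x.
Proof.
suff le_star y : nrm y <= nrm (star y).
  by apply/le_anti; rewrite -{2}(starK x) !le_star.
have [->|y0] := eqVneq (nrm y) 0; first exact: nrm_ge0.
have ypos : 0 < nrm y by rewrite lt_def y0 nrm_ge0.
rewrite -(ler_pM2r ypos) -expr2 -nrm_starM; exact: nrmM.
Qed.

Lemma starM_eq0 x : star x * x = 0 -> x = 0.
Proof.
move=> h; apply/nrm0_eq0/eqP; rewrite -[_ == 0](expf_eq0 (nrm x) 2).
by rewrite -nrm_starM h nrm0.
Qed.

Lemma nrm_Mstar x : nrm (x * star x) = nrm x ^+ 2.
Proof. by rewrite -{1}(starK x) nrm_starM nrm_star. Qed.

Lemma nrm1_le : nrm (1 : T) <= 1.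
Proof.
have := nrm_starM 1; rewrite star1 mulr1 => h.
have := nrm_ge0 1; nra.
Qed.

Lemma nrm_iiM x : nrm (ii * x) = nrm x.
Proof.
have h : nrm (ii * x) ^+ 2 = nrm x ^+ 2.
  rewrite -!nrm_starM starM star_ii; congr nrm.
  rewrite mulrN mulNr -mulrA [ii * (ii * x)]mulrA ii2 mulN1r mulrN.
  by rewrite opprK.
by apply/eqP; rewrite -(eqrXn2 (n := 2)) ?nrm_ge0 ?h.
Qed.

Lemma nrm_scal_le c : nrm (c%:A : T) <= `|c|.
Proof. by rewrite nrmZ ler_piMr // nrm1_le. Qed.

Lemma nrmX_le x n : nrm x <= 1 -> nrm (x ^+ n) <= 1.
Proof.
move=> x1; elim: n => [|n IH]; first exact: nrm1_le.
by rewrite exprS -[1]mul1r nrmM_le.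
Qed.

(** ** Limits *)

Definition tends u x := forall e, 0 < e -> exists N, forall n, (N <= n)%N ->
  nrm (u n - x) <= e.

Lemma tends_cst x : tends (fun=> x) x.
Proof. by move=> e e0; exists 0 => n _; rewrite subrr nrm0 ltW. Qed.

Lemma tends_uniq u x y : tends u x -> tends u y -> x = y.
Proof.
move=> ux uy; apply/eqP; rewrite -subr_eq0; apply/eqP/nrm0_eq0/eqP.
rewrite eq_le nrm_ge0 andbT; apply/ler_addgt0Pl => e e0; rewrite addr0.
have [|N hN] := ux (e / 2); first by rewrite divr_gt0.
have [|M hM] := uy (e / 2); first by rewrite divr_gt0.
have := hN _ (leq_maxl N M); have := hM _ (leq_maxr N M).
have := nrm_tri x (u (maxn N M)) y; rewrite [nrm (x - u _)]nrmBC.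
lra.
Qed.

Lemma tends_ext u v x : u =1 v -> tends u x -> tends v x.
Proof. by move=> /funext ->. Qed.

Lemma tendsD u v x y : tends u x -> tends v y -> tends (fun n => u n + v n) (x + y).
Proof.
move=> ux vy e e0.
have [|N hN] := ux (e / 2); first by rewrite divr_gt0.
have [|M hM] := vy (e / 2); first by rewrite divr_gt0.
exists (maxn N M) => n; rewrite geq_max => /andP[Nn Mn].
have -> : u n + v n - (x + y) = (u n - x) + (v n - y) by ncring.
have := nrmD (u n - x) (v n - y); have := hN n Nn; have := hM n Mn; lra.
Qed.

Lemma tendsMlr u x y z : tends u x -> tends (fun n => y * u n * z) (y * x * z).
Proof.
move=> ux e e0.
have c0 : 0 < nrm y * nrm z + 1.
  by rewrite ltr_wpDl // mulr_ge0 ?nrm_ge0.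
have [|N hN] := ux (e / (nrm y * nrm z + 1)); first by rewrite divr_gt0.
exists N => n /hN; rewrite ler_pdivlMr // => h.
have -> : y * u n * z - y * x * z = y * (u n - x) * z by ncring.
apply: le_trans h; apply: le_trans (nrmM _ _) _.
apply: le_trans (ler_wpM2r (nrm_ge0 _) (nrmM _ _)) _.
have := nrm_ge0 (u n - x); nra.
Qed.

Lemma tendsMl y u x : tends u x -> tends (fun n => y * u n) (y * x).
Proof.
by move=> /(@tendsMlr _ _ y 1); rewrite mulr1; apply: tends_ext => n; rewrite mulr1.
Qed.

Lemma tendsMr y u x : tends u x -> tends (fun n => u n * y) (x * y).
Proof.
by move=> /(@tendsMlr _ _ 1 y); rewrite mul1r; apply: tends_ext => n; rewrite mul1r.
Qed.

Lemma tendsN u x : tends u x -> tends (fun n => - u n) (- x).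
Proof. by move=> ux e /ux[N hN]; exists N => n /hN; rewrite -opprD nrmN. Qed.

Lemma tendsB u v x y : tends u x -> tends v y -> tends (fun n => u n - v n) (x - y).
Proof. by move=> ux vy; apply: tendsD => //; apply: tendsN. Qed.

Lemma tendsZ c u x : tends u x -> tends (fun n => c *: u n) (c *: x).
Proof.
move=> /(@tendsMl (c%:A)); rewrite mulr_algl; apply: tends_ext => n.
by rewrite mulr_algl.
Qed.

Lemma tends_star u x : tends u x -> tends (fun n => star (u n)) (star x).
Proof. by move=> ux e /ux[N hN]; exists N => n /hN; rewrite -starB nrm_star. Qed.

Lemma tendsS u x : tends u x -> tends (fun n => u n.+1) x.
Proof. by move=> ux e /ux[N hN]; exists N => n Nn; apply/hN/leqW. Qed.

Lemma tends_nrm_le u x c : tends u x -> (forall n, nrm (u n) <= c) -> nrm x <= c.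
Proof.
move=> ux uc; apply/ler_addgt0Pl => e e0.
have [N /(_ N (leqnn N)) hN] := ux e e0.
by have := nrmB (u N) (u N - x); rewrite subKr; have := uc N; lra.
Qed.

Lemma tends_bounded u x : tends u x -> exists c, forall n, nrm (u n) <= c.
Proof.
move=> /(_ 1 ltr01)[N hN].
exists (\sum_(i < N) nrm (u i) + (nrm x + 1)) => n.
have S0 : 0 <= \sum_(i < N) nrm (u i) by apply: sumr_ge0 => i _; exact: nrm_ge0.
have [nN|Nn] := ltnP n N.
  rewrite (bigD1 (Ordinal nN)) //= -!addrA lerDl addr_ge0 //.
    by apply: sumr_ge0 => i _; exact: nrm_ge0.
  by rewrite addr_ge0 // nrm_ge0.
have := nrmD (u n - x) x; rewrite subrK; have := hN n Nn; lra.
Qed.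

Lemma tends_null u (t : nat -> R) x : (forall n, nrm (u n - x) <= t n) ->
  (forall e, 0 < e -> exists N, forall n, (N <= n)%N -> t n <= e) -> tends u x.
Proof.
move=> ut t0 e /t0[N hN]; exists N => n /hN; exact: le_trans.
Qed.

Lemma tendsM u v x y : tends u x -> tends v y -> tends (fun n => u n * v n) (x * y).
Proof.
move=> ux vy; have [c uc] := tends_bounded ux.
have c0 : 0 <= c by apply: le_trans (nrm_ge0 _) (uc 0).
have : tends (fun n => u n * (v n - y) + u n * y) (0 + x * y).
  apply: tendsD; last exact: tendsMr.
  move=> e e0; have [|N hN] := vy (e / (c + 1)); first by rewrite divr_gt0 // ltr_wpDl.
  exists N => n /hN; rewrite subr0 ler_pdivlMr ?ltr_wpDl // => h.
  apply: le_trans (nrmM _ _) _.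
  have := uc n; have := nrm_ge0 (v n - y); have := nrm_ge0 (u n); nra.
by rewrite add0r; apply: tends_ext => n; rewrite mulrBr subrK.
Qed.

Lemma inv_small e C : 0 < e -> exists N, forall n : nat, (N <= n)%N -> C / n.+1%:R <= e.
Proof.
move=> e0; exists (Num.trunc (C / e)).+1 => n Nn.
rewrite ler_pdivrMr // mulrC -ler_pdivrMr //.
apply/ltW/(lt_le_trans (truncnS_gt _)).
by rewrite ler_nat (leq_trans Nn).
Qed.

(** The unit is left out so that the copies of B and of its matrices inside unital algebras qualify.
    The other instances are commutants: membership of a root in every commutant containing [a] puts
    it in the bicommutant of [a]. *)
Record closed_subalg (J : T -> Prop) : Prop := {
  csubD : forall x y, J x -> J y -> J (x + y);
  csubZ : forall c x, J x -> J (c *: x);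
  csubM : forall x y, J x -> J y -> J (x * y);
  csub_lim : forall u x, (forall n, J (u n)) -> tends u x -> J x
}.

Lemma csubB J x y : closed_subalg J -> J x -> J y -> J (x - y).
Proof. by move=> cJ Jx Jy; apply: csubD => //; rewrite -scaleN1r; apply: csubZ. Qed.

Lemma commutant_closed z : closed_subalg (fun x => x * z = z * x).
Proof.
split=> [x y hx hy|c x hx|x y hx hy|u x hu ux].
- by rewrite mulrDl mulrDr hx hy.
- by rewrite -scalerAl hx scalerAr.
- by rewrite -mulrA hy mulrA hx mulrA.
- apply: (tends_uniq (tendsMr z ux)).
  by apply: tends_ext (tendsMl z ux) => n; rewrite hu.
Qed.

End UCStarTheory.

(** * Square roots and positivity *)

Section Root.
Context {R : realType} {T : ucstarType R}.
Implicit Types (x y z a b s : T) (c e t : R).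

(* Fixed point iteration for y = (x + y^2) / 2, that is (1 - y)^2 = 1 - x; it is
   majorised by the same iteration at x = 1 in the real numbers. *)
Fixpoint root_iter x n : T :=
  if n is m.+1 then 2^-1 *: (x + root_iter x m * root_iter x m) else 0.

Fixpoint root_maj n : R :=
  if n is m.+1 then 2^-1 * (1 + root_maj m ^+ 2) else 0.

Lemma root_maj_bounds n : 0 <= root_maj n <= 1.
Proof. by elim: n => [|n /andP[h0 h1]] /=; [rewrite lexx ler01 | apply/andP; split; nra]. Qed.

(** The explicit rate does not depend on the element whose root is taken; the uniform continuity of
    the root rests on this. *)
Lemma root_maj_dist n : 1 - root_maj n <= 2 / n.+1%:R.
Proof.
elim: n => [|n IH]; first by rewrite /= divr1; lra.
have /andP[h0 h1] := root_maj_bounds n.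
have n0 : (0 : R) <= n%:R by [].
set d := 1 - root_maj n in IH *.
have -> : 1 - root_maj n.+1 = d - d ^+ 2 / 2 by rewrite /d /=; field.
move: IH; rewrite !ler_pdivlMr ?ltr0n // => IH.
rewrite -[n.+2]addn2 -[n.+1]addn1 !natrD in IH *.
have d0 : 0 <= d by rewrite subr_ge0.
have d1 : d <= 1 by rewrite /d; lra.
move: (n%:R : R) n0 IH => k k0 IH.
rewrite (_ : d - _ = d * (1 - d / 2)); last by field.
(* If d <= 2 / (k + 2), it suffices that d decreases. Otherwise 1 - d / 2 < (k + 1) / (k + 2), and d
   (k + 1) <= 2 concludes. *)
have [dk|kd] := leP (d * (k + 2)) 2.
  have : 0 <= d ^+ 2 / 2 by nra.
  nra.
nra.
Qed.

Lemma root_iter_nrm x n : nrm x <= 1 -> nrm (root_iter x n) <= root_maj n.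
Proof.
move=> x1; elim: n => [|n IH] /=; first by rewrite nrm0.
rewrite nrmZ ger0_norm ?invr_ge0 // ler_pM2l ?invr_gt0 //.
apply: le_trans (nrmD _ _) _; apply: lerD => //.
by rewrite expr2; apply: nrmM_le.
Qed.

(** For x = y this is commutation with z. The form with two elements survives up to
    [pos_intertwine], where Kaplansky's argument needs it. *)
Lemma root_iter_intertwine x y z n :
  x * z = z * y -> root_iter x n * z = z * root_iter y n.
Proof.
move=> h; elim: n => [|n IH] /=; first by rewrite mul0r mulr0.
rewrite -scalerAl -scalerAr; congr (_ *: _).
by rewrite mulrDl mulrDr h -mulrA IH mulrA IH mulrA.
Qed.

Lemma root_iter_comm x m n :
  root_iter x m * root_iter x n = root_iter x n * root_iter x m.
Proof. by apply: root_iter_intertwine; symmetry; apply: root_iter_intertwine. Qed.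

Lemma root_iter_star x n : star x = x -> star (root_iter x n) = root_iter x n.
Proof.
move=> h; elim: n => [|n IH] /=; first exact: star0.
by rewrite starZ starD starM IH h.
Qed.

(** The difference of two successive values is half of (y' - y)(y' + y), the iterates commuting. The
    scalar iteration obeys the same identity, so the majorant propagates. *)
Lemma root_iter_step x n : nrm x <= 1 ->
  nrm (root_iter x n.+1 - root_iter x n) <= root_maj n.+1 - root_maj n.
Proof.
move=> x1; elim: n => [|n IH].
  rewrite /= mulr0 addr0 !subr0 expr0n /= addr0 mulr1 nrmZ ger0_norm ?invr_ge0 //.
  by rewrite ler_piMr ?invr_ge0.
set y := root_iter x n in IH *; set y' := root_iter x n.+1 in IH *.
have -> : root_iter x n.+2 - y' = 2^-1 *: ((y' - y) * (y' + y)).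
  have c : y * y' = y' * y := root_iter_comm x n n.+1.
  have -> : (y' - y) * (y' + y) = y' * y' - y * y.
    by rewrite mulrDr !mulrBl c; ncring.
  have -> : root_iter x n.+2 - y' =
    2^-1 *: (x + y' * y') - 2^-1 *: (x + y * y) by [].
  ncring.
rewrite nrmZ ger0_norm ?invr_ge0 //.
have -> : root_maj n.+2 - root_maj n.+1 =
   2^-1 * ((root_maj n.+1 - root_maj n) * (root_maj n.+1 + root_maj n)).
  have -> : root_maj n.+2 - root_maj n.+1 =
    2^-1 * (1 + root_maj n.+1 ^+ 2) - 2^-1 * (1 + root_maj n ^+ 2) by [].
  by move: (root_maj n.+1) => t; ring.
rewrite ler_pM2l ?invr_gt0 //; apply: nrmM_le => //.
by apply: le_trans (nrmD _ _) _; apply: lerD; exact: root_iter_nrm.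
Qed.

Lemma root_iter_dist x m n : nrm x <= 1 -> (m <= n)%N ->
  nrm (root_iter x n - root_iter x m) <= root_maj n - root_maj m.
Proof.
move=> x1 mn; rewrite -(subnK mn); elim: (n - m)%N => [|k IH].
  by rewrite add0n !subrr nrm0.
rewrite addSn; apply: le_trans (nrm_tri _ (root_iter x (k + m)) _) _.
have := root_iter_step (k + m) x1; lra.
Qed.

Lemma root_iter_cvg x : nrm x <= 1 -> exists y, tends (root_iter x) y.
Proof.
move=> x1; apply: nrm_complete => e e0.
have [N hN] := inv_small 2 e0; exists N.
suff sub m n : (N <= m)%N -> (m <= n)%N -> nrm (root_iter x n - root_iter x m) <= e.
  move=> m n Nm Nn; have [mn|/ltnW nm] := leqP m n.
    by rewrite nrmBC; exact: sub.
  exact: sub.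
move=> Nm mn; apply: le_trans (root_iter_dist x1 mn) _.
apply: le_trans (hN m Nm); apply: le_trans (root_maj_dist m).
by have := root_maj_bounds n; lra.
Qed.

(** The value 0 in case of divergence never matters: the lemmas assume [nrm x <= 1]. *)
Definition root_lim x : T := xget 0 [set y | tends (root_iter x) y]%classic.

Lemma root_limP x : nrm x <= 1 -> tends (root_iter x) (root_lim x).
Proof. by move=> /root_iter_cvg[y hy]; rewrite /root_lim; case: xgetP => [z _ //|/(_ y)]. Qed.

Lemma root_lim_nrm x : nrm x <= 1 -> nrm (root_lim x) <= 1.
Proof.
move=> x1; apply: (tends_nrm_le (root_limP x1)) => n.
by apply: le_trans (root_iter_nrm n x1) _; have /andP[] := root_maj_bounds n.
Qed.

Lemma root_lim_sqr x : nrm x <= 1 -> (1 - root_lim x) * (1 - root_lim x) = 1 - x.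
Proof.
move=> x1; have hy := root_limP x1; set y := root_lim x in hy *.
have h : y = 2^-1 *: (x + y * y).
  apply: (tends_uniq (tendsS hy)) => /=.
  by apply: tendsZ; apply: tendsD (tends_cst x) _; apply: tendsM.
have -> : (1 - y) * (1 - y) = 1 - y - y + y * y by ncring.
have -> : y * y = y + y - x.
  by rewrite -[y + y]mulr2n -scaler_nat {3}h scalerA divff ?pnatr_eq0 // scale1r addrC addKr.
ncring.
Qed.

Lemma root_lim_intertwine x y z : nrm x <= 1 -> nrm y <= 1 ->
  x * z = z * y -> root_lim x * z = z * root_lim y.
Proof.
move=> x1 y1 h; apply: (tends_uniq (tendsMr z (root_limP x1))).
apply: tends_ext (tendsMl z (root_limP y1)) => n.
by rewrite (root_iter_intertwine n h).
Qed.

Lemma root_lim_star x : nrm x <= 1 -> star x = x -> star (root_lim x) = root_lim x.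
Proof.
move=> x1 h; apply: (tends_uniq (tends_star (root_limP x1))).
by apply: tends_ext (root_limP x1) => n; rewrite root_iter_star.
Qed.

(* Subtracting the scalar iteration keeps the iterates in a non-unital J. *)
Lemma root_lim_closed (J : T -> Prop) x : closed_subalg J -> nrm x <= 1 ->
  J (1 - x) -> J (1 - root_lim x).
Proof.
move=> cJ x1 Jx; have J0 : J 0 by rewrite -(scale0r (1 - x)); apply: csubZ.
have Jn n : J ((root_maj n)%:A - root_iter x n).
  elim: n => [|n IH] /=; first by rewrite scale0r subrr.
  set r := root_maj n in IH *; set y := root_iter x n in IH *.
  set d := r%:A - y in IH; have yE : y = r%:A - d by rewrite /d subKr.
  rewrite yE.
  have -> : (2^-1 * (1 + r ^+ 2))%:A - 2^-1 *: (x + (r%:A - d) * (r%:A - d))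
    = 2^-1 *: ((1 - x) + (2 * r) *: d - d * d) by ncring.
  by apply: csubZ => //; apply: csubB => //; [apply: csubD => //; apply: csubZ | apply: csubM].
apply: (csub_lim cJ Jn); apply: tendsB (root_limP x1).
apply: (@tends_null _ _ _ (fun n => 2 / n.+1%:R)) => [n|e e0]; last exact: inv_small.
rewrite -{2}(scale1r 1) -scalerBl; apply: le_trans (nrm_scal_le _) _.
have /andP[_ h] := root_maj_bounds n.
by rewrite distrC ger0_norm ?subr_ge0 //; exact: root_maj_dist.
Qed.

(** ** Positive elements *)

(** Squares of self-adjoint elements, rather than elements x* x, because the roots constructed above
    are self-adjoint. That both notions agree is Kaplansky's theorem [pos_starM], which depends on
    most of this section. *)
Definition pos a := exists s, star s = s /\ a = s * s.

Lemma pos_sa a : pos a -> star a = a.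
Proof. by case=> s [hs ->]; rewrite starM hs. Qed.

Lemma pos0 : pos 0.
Proof. by exists 0; rewrite star0 mulr0. Qed.

Lemma pos_sqr s : star s = s -> pos (s * s).
Proof. by exists s. Qed.

Lemma posZ c a : 0 <= c -> pos a -> pos (c *: a).
Proof.
move=> c0 [s [hs ->]]; exists (Num.sqrt c *: s); rewrite starZ hs; split=> //.
by rewrite -{1}(sqr_sqrtr c0); ncring.
Qed.

Lemma pos1 : pos 1.
Proof. by exists 1; rewrite star1 mulr1. Qed.

Lemma pos_scal c : 0 <= c -> pos c%:A.
Proof. by move=> c0; apply: posZ => //; exact: pos1. Qed.

(* With r^2 = 1 - s^2 the element s + i r is a unitary. *)
Lemma nrm_1Bsqr s : star s = s -> nrm s <= 1 -> nrm (1 - s * s) <= 1.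
Proof.
move=> hs s1; have x1 : nrm (s * s) <= 1 by rewrite -[1]mulr1 nrmM_le.
set r := 1 - root_lim (s * s).
have rr : r * r = 1 - s * s by exact: root_lim_sqr.
have hr : star r = r by rewrite /r starB star1 root_lim_star // starM hs.
have rs : r * s = s * r.
  by rewrite /r mulrBl mulrBr mul1r mulr1 (@root_lim_intertwine _ (s * s)) // mulrA.
set u := s + ii * r.
have hu : star u = s - ii * r by rewrite /u starD starM hs hr star_ii mulrN -iiC.
have uu : star u * u = 1.
  rewrite hu; have -> : (s - ii * r) * (s + ii * r)
    = s * s + (s * ii * r - ii * (r * s)) - ii * (r * ii) * r by ncring.
  rewrite rs -iiC -iiC !mulrA ii2 subrr addr0 mulN1r mulNr opprK rr; ncring.
have u1 : nrm u <= 1.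
  have : nrm u ^+ 2 <= 1 by rewrite -nrm_starM uu; exact: nrm1_le.
  by rewrite expr_le1 // nrm_ge0.
have r1 : nrm r <= 1.
  have : nrm ((2 : R) *: (ii * r)) <= 2.
    have -> : (2 : R) *: (ii * r) = u - star u by rewrite hu /u; ncring.
    by apply: le_trans (nrmB _ _) _; rewrite nrm_star; lra.
  by rewrite nrmZ nrm_iiM normr_nat; lra.
by rewrite -rr -[1]mulr1; apply: nrmM_le.
Qed.

(** The parameter t rescales [a] into the domain of the iteration. It is kept free so that two
    elements can be treated with the same t, as intertwining requires. *)
Definition root_of t a := Num.sqrt t *: (1 - root_lim (1 - t^-1 *: a)).

Lemma root_arg_nrm t a : 0 < t -> nrm (t%:A - a) <= t -> nrm (1 - t^-1 *: a) <= 1.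
Proof.
move=> t0 h; have -> : 1 - t^-1 *: a = t^-1 *: (t%:A - a).
  by rewrite scalerBr scalerA mulVf ?gt_eqF // scale1r.
by rewrite nrmZ gtr0_norm ?invr_gt0 // ler_pdivrMl // mulr1.
Qed.

Lemma root_of_sqr t a : 0 < t -> nrm (t%:A - a) <= t ->
  root_of t a * root_of t a = a.
Proof.
move=> t0 h; rewrite /root_of -scalerAl -scalerAr scalerA -expr2 sqr_sqrtr ?ltW //.
rewrite root_lim_sqr ?root_arg_nrm // subKr scalerA mulfV ?gt_eqF //.
by rewrite scale1r.
Qed.

Lemma root_of_star t a : 0 < t -> nrm (t%:A - a) <= t -> star a = a ->
  star (root_of t a) = root_of t a.
Proof.
move=> t0 h ha; rewrite /root_of starZ starB star1 root_lim_star ?root_arg_nrm //.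
by rewrite starB star1 starZ ha.
Qed.

Lemma root_of_intertwine t a b z : 0 < t ->
  nrm (t%:A - a) <= t -> nrm (t%:A - b) <= t ->
  a * z = z * b -> root_of t a * z = z * root_of t b.
Proof.
move=> t0 ha hb h; rewrite /root_of -scalerAl -scalerAr; congr (_ *: _).
rewrite mulrBl mulrBr mul1r mulr1; congr (_ - _).
apply: root_lim_intertwine; rewrite ?root_arg_nrm //.
by rewrite mulrBl mulrBr mul1r mulr1 -scalerAl -scalerAr h.
Qed.

Lemma root_of_closed (J : T -> Prop) t a : closed_subalg J -> 0 < t ->
  nrm (t%:A - a) <= t -> J a -> J (root_of t a).
Proof.
move=> cJ t0 h Ja; apply: csubZ => //; apply: root_lim_closed => //.
  exact: root_arg_nrm.
by rewrite subKr; apply: csubZ.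
Qed.

Lemma pos_dist a t : pos a -> nrm a <= t -> nrm (t%:A - a) <= t.
Proof.
move=> [s [hs ->]]; have -> : s * s = star s * s by rewrite hs.
rewrite nrm_starM hs => st.
have t0 : 0 <= t by apply: le_trans st; rewrite sqr_ge0.
have [t00|tn] := eqVneq t 0.
  move: st; rewrite t00 => st.
  have s0 : nrm s = 0 by have := nrm_ge0 s; nra.
  by rewrite (nrm0_eq0 s0) mulr0 scale0r subrr nrm0.
have tp : 0 < t by rewrite lt_def tn.
have sq : Num.sqrt t * Num.sqrt t = t by rewrite -expr2 sqr_sqrtr.
set w := (Num.sqrt t)^-1 *: s.
have w0 : Num.sqrt t != 0 by rewrite gt_eqF ?sqrtr_gt0.
have hw : s = Num.sqrt t *: w by rewrite /w scalerA divff // scale1r.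
have w1 : nrm w <= 1.
  rewrite /w nrmZ ger0_norm ?invr_ge0 ?sqrtr_ge0 // ler_pdivrMl ?sqrtr_gt0 //.
  by rewrite mulr1 -(ler_pXn2r (n := 2)) ?nnegrE ?nrm_ge0 ?sqrtr_ge0 // sqr_sqrtr.
have -> : t%:A - s * s = t *: (1 - w * w).
  transitivity (t%:A - (Num.sqrt t * Num.sqrt t) *: (w * w)); last by rewrite sq; ncring.
  by rewrite hw; ncring.
rewrite nrmZ ger0_norm // ler_piMr // nrm_1Bsqr //.
by rewrite /w starZ hs.
Qed.

Lemma pos_root a t : star a = a -> 0 < t -> nrm (t%:A - a) <= t -> pos (root_of t a).
Proof.
move=> ha t0 h; set x := 1 - root_lim (1 - t^-1 *: a).
have x1 : nrm (1 - x) <= 1 by rewrite /x subKr root_lim_nrm // root_arg_nrm.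
have hx : star x = x.
  rewrite /x starB star1 root_lim_star ?root_arg_nrm //.
  by rewrite starB star1 starZ ha.
apply: posZ; first exact: sqrtr_ge0.
exists (root_of 1 x); rewrite root_of_sqr ?root_of_star ?scale1r ?ltr01 //.
Qed.

(** This criterion stands in for the spectrum: with it, the sum of two positive elements is positive
    by the triangle inequality. *)
Lemma posP a : pos a <-> star a = a /\ exists2 t, 0 <= t & nrm (t%:A - a) <= t.
Proof.
split=> [pa|[ha [t t0 h]]].
  split; first exact: pos_sa.
  by exists (nrm a); [exact: nrm_ge0 | exact: pos_dist].
(* The given t may be 0, whereas [root_of] divides by its parameter. *)
have h1 : nrm ((t + 1)%:A - a) <= t + 1.
  have -> : (t + 1)%:A - a = (t%:A - a) + 1%:A by ncring.
  by apply: le_trans (nrmD _ _) _; apply: lerD => //; rewrite (le_trans (nrm_scal_le _)) ?normr1.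
exists (root_of (t + 1) a); rewrite root_of_sqr ?root_of_star ?ltr_wpDl //.
Qed.

Definition sqrtp a := root_of (nrm a + 1) a.

Section Sqrtp.
Variables (a : T) (pa : pos a).

Let t0 : 0 < nrm a + 1. Proof. by rewrite ltr_wpDl // nrm_ge0. Qed.
Let ha : nrm ((nrm a + 1)%:A - a) <= nrm a + 1.
Proof. by apply: pos_dist; rewrite ?lerDl. Qed.

Lemma sqrtp_pos : pos (sqrtp a).
Proof. by apply: pos_root => //; exact: pos_sa. Qed.

Lemma sqrtp_star : star (sqrtp a) = sqrtp a.
Proof. exact/pos_sa/sqrtp_pos. Qed.

Lemma sqrtp_sqr : sqrtp a * sqrtp a = a.
Proof. exact: root_of_sqr. Qed.

Lemma sqrtp_closed (J : T -> Prop) : closed_subalg J -> J a -> J (sqrtp a).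
Proof. by move=> cJ; apply: root_of_closed. Qed.

Lemma sqrtp_comm z : a * z = z * a -> sqrtp a * z = z * sqrtp a.
Proof. exact: sqrtp_closed (commutant_closed z). Qed.

End Sqrtp.

Lemma pos_conj_comm a b : pos a -> star b = b -> a * b = b * a -> pos (b * a * b).
Proof.
move=> pa hb ab; have rb := sqrtp_comm pa ab.
exists (sqrtp a * b); rewrite starM hb sqrtp_star //; split=> //.
by rewrite -{1}(sqrtp_sqr pa) !mulrA rb -!mulrA rb.
Qed.

Lemma posM_comm a b : pos a -> pos b -> a * b = b * a -> pos (a * b).
Proof.
move=> pa pb ab; have rb : sqrtp b * a = a * sqrtp b by apply: sqrtp_comm.
have := pos_conj_comm pa (sqrtp_star pb) (esym rb).
by rewrite rb -mulrA sqrtp_sqr.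
Qed.

Lemma posD a b : pos a -> pos b -> pos (a + b).
Proof.
move=> /posP[ha [s s0 hs]] /posP[hb [t t0 ht]]; apply/posP.
rewrite starD ha hb; split=> //; exists (s + t); first exact: addr_ge0.
have -> : (s + t)%:A - (a + b) = (s%:A - a) + (t%:A - b) by ncring.
by apply: le_trans (nrmD _ _) _; apply: lerD.
Qed.

Lemma pos_sum (I : Type) (r : seq I) (P : pred I) (F : I -> T) :
  (forall i, P i -> pos (F i)) -> pos (\sum_(i <- r | P i) F i).
Proof. by move=> h; elim/big_rec: _ => [|i x Pi]; [exact: pos0 | exact/posD/h]. Qed.

Lemma pos_trans a b c : pos (b - a) -> pos (c%:A - b) -> pos (c%:A - a).
Proof. by move=> h1 h2; have := posD h2 h1; rewrite addrA subrK. Qed.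

Lemma pos_sub_scal a t : star a = a -> nrm a <= t -> pos (t%:A - a).
Proof.
move=> ha h; apply/posP; rewrite starB starZ star1 ha; split=> //.
exists t; first exact: le_trans (nrm_ge0 _) h.
by rewrite subKr.
Qed.

(* If a = s^2 and t - a = r^2 then s + i r has square norm t. *)
Lemma pos_nrm a t : 0 <= t -> pos a -> pos (t%:A - a) -> nrm a <= t.
Proof.
move=> t0 pa pb.
suff pos_lt e : 0 < e -> t <= e -> nrm a <= e.
  apply/ler_addgt0Pl => e e0; apply: pos_lt; lra.
move=> e0 te; have {t0 te}pb : pos (e%:A - a).
  have -> : e%:A - a = t%:A - a + (e - t)%:A by ncring.
  by apply: posD => //; apply: pos_scal; rewrite subr_ge0.
set s := sqrtp a; set r := sqrtp (e%:A - a).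
have hs : star s = s by apply/pos_sa/sqrtp_pos.
have hr : star r = r by apply/pos_sa/sqrtp_pos.
have ss : s * s = a by exact: sqrtp_sqr.
have rr : r * r = e%:A - a by exact: sqrtp_sqr.
have rs : s * r = r * s.
  apply: sqrtp_comm => //; symmetry; apply: sqrtp_comm => //.
  by rewrite mulrBl mulrBr mulr_algl mulr_algr.
set u := s + ii * r.
have hu : star u = s - ii * r by rewrite /u starD starM hs hr star_ii mulrN -iiC.
have uu : star u * u = e%:A.
  rewrite hu; have -> : (s - ii * r) * (s + ii * r)
    = s * s + (s * ii * r - ii * (r * s)) - ii * (r * ii) * r by ncring.
  rewrite -rs -iiC -iiC !mulrA ii2 subrr addr0 mulN1r mulNr opprK rr ss; ncring.
have su : s = 2^-1 *: (u + star u).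
  have -> : u + star u = 2 *: s by rewrite hu /u; ncring.
  by rewrite scalerA mulVf ?pnatr_eq0 // scale1r.
have nu : nrm u ^+ 2 <= e.
  by rewrite -nrm_starM uu; apply: le_trans (nrm_scal_le _) _; rewrite ger0_norm // ltW.
have ns : nrm s <= nrm u.
  rewrite {1}su nrmZ ger0_norm ?invr_ge0 // ler_pdivrMl //.
  by apply: le_trans (nrmD _ _) _; rewrite nrm_star; lra.
rewrite -ss; apply: le_trans (nrmM _ _) _.
have := nrm_ge0 s; have := nrm_ge0 u; nra.
Qed.

Lemma pos_anti a : pos a -> pos (- a) -> a = 0.
Proof.
move=> pa pb; apply: nrm0_eq0; apply/le_anti; rewrite nrm_ge0 andbT.
by apply: pos_nrm => //; rewrite scale0r sub0r.
Qed.

(** With d = s - r one has d s d + d r d = (s^2 - r^2) d = 0. Both terms are positive, so both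
    vanish; their difference is d^3, and d^3 = 0 forces the self-adjoint d to be 0. *)
Lemma pos_root_uniq s r : pos s -> pos r -> s * r = r * s -> s * s = r * r -> s = r.
Proof.
move=> [p [hp sE]] [q [hq rE]] sr ss.
set d := s - r; have hd : star d = d by rewrite /d sE rE starB !starM hp hq.
have cd x : x * s = s * x -> x * r = r * x -> x * d = d * x.
  by rewrite /d mulrBl mulrBr => -> ->.
have psd : pos (d * s * d) by apply: pos_conj_comm => //; [exists p | exact: cd].
have prd : pos (d * r * d) by apply: pos_conj_comm => //; [exists q | exact: cd].
have sum0 : d * s * d + d * r * d = 0.
  have -> : d * s * d + d * r * d = (s * s - r * r + (s * r - r * s)) * d.
    by rewrite /d; ncring.
  by rewrite ss sr !subrr addr0 mul0r.
have ds : d * s * d = 0.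
  apply: pos_anti => //; suff -> : - (d * s * d) = d * r * d by [].
  by apply/eqP; rewrite eq_sym -addr_eq0 addrC sum0.
have dr : d * r * d = 0 by move: sum0; rewrite ds add0r.
have d3 : d * d * d = 0 by rewrite -[RHS](subrr 0) -{1}ds -dr -mulrBl -mulrBr.
apply/eqP; rewrite -subr_eq0 -/d; apply/eqP/starM_eq0; rewrite hd.
by apply: starM_eq0; rewrite starM hd mulrA d3 mul0r.
Qed.

Lemma sqrtp_uniq s : pos s -> sqrtp (s * s) = s.
Proof.
move=> ps; have pss : pos (s * s) by apply/pos_sqr/pos_sa.
apply: pos_root_uniq => //; first exact: sqrtp_pos.
  by apply: sqrtp_comm => //; rewrite mulrA.
by rewrite sqrtp_sqr.
Qed.

(** Both roots are computed with one parameter t, so that the same iteration is applied on either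
    side of y; uniqueness identifies the results with [a] and [b]. *)
Lemma pos_intertwine a b y : pos a -> pos b ->
  a * a * y = y * (b * b) -> a * y = y * b.
Proof.
move=> pa pb h.
have paa : pos (a * a) by apply/pos_sqr/pos_sa.
have pbb : pos (b * b) by apply/pos_sqr/pos_sa.
set t := nrm (a * a) + nrm (b * b) + 1.
have na := nrm_ge0 (a * a); have nb := nrm_ge0 (b * b).
have t0 : 0 < t by rewrite /t; lra.
have ta : nrm (t%:A - a * a) <= t by apply: pos_dist => //; rewrite /t; lra.
have tb : nrm (t%:A - b * b) <= t by apply: pos_dist => //; rewrite /t; lra.
have rootE z : pos z -> nrm (t%:A - z * z) <= t -> root_of t (z * z) = z.
  move=> pz tz; have pzz : pos (z * z) by apply/pos_sqr/pos_sa.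
  apply: pos_root_uniq => //; first by apply: pos_root => //; exact: pos_sa.
    apply: root_of_closed (commutant_closed z) _ _ _ => //.
    by rewrite mulrA.
  by rewrite root_of_sqr.
by rewrite -{1}(rootE a) // -{1}(rootE b) //; apply: root_of_intertwine.
Qed.

Definition jpos a := 2^-1 *: (sqrtp (a * a) + a).
Definition jneg a := 2^-1 *: (sqrtp (a * a) - a).

Lemma jposE a : a = jpos a - jneg a.
Proof.
rewrite /jpos /jneg -scalerBr.
have -> : sqrtp (a * a) + a - (sqrtp (a * a) - a) = 2 *: a by ncring.
by rewrite scalerA mulVf ?pnatr_eq0 // scale1r.
Qed.

Section Jordan.
Variables (a : T) (ha : star a = a).

Let paa : pos (a * a). Proof. by exists a. Qed.
Let m := sqrtp (a * a).
Let hm : star m = m. Proof. exact: sqrtp_star. Qed.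
Let am : m * a = a * m. Proof. by apply: sqrtp_comm => //; rewrite mulrA. Qed.
Let mm : m * m = a * a. Proof. exact: sqrtp_sqr. Qed.

Lemma jpos_jneg : jpos a * jneg a = 0.
Proof.
rewrite /jpos /jneg -/m.
have -> : 2^-1 *: (m + a) * (2^-1 *: (m - a)) =
  (2^-1 * 2^-1) *: (m * m - a * a + (a * m - m * a)) by ncring.
by rewrite mm am !subrr addr0 scaler0.
Qed.

Lemma jneg_jpos : jneg a * jpos a = 0.
Proof.
rewrite /jpos /jneg -/m.
have -> : 2^-1 *: (m - a) * (2^-1 *: (m + a)) =
  (2^-1 * 2^-1) *: (m * m - a * a + (m * a - a * m)) by ncring.
by rewrite mm am !subrr addr0 scaler0.
Qed.

Let hp : star (jpos a) = jpos a.
Proof. by rewrite /jpos starZ starD ha hm. Qed.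
Let hn : star (jneg a) = jneg a.
Proof. by rewrite /jneg starZ starB ha hm. Qed.

Let jposD : jpos a + jneg a = m.
Proof.
rewrite /jpos /jneg -scalerDr -/m.
have -> : m + a + (m - a) = 2 *: m by ncring.
by rewrite scalerA mulVf ?pnatr_eq0 // scale1r.
Qed.

(* The positive roots P, M of p^2, m^2 satisfy (P + M)^2 = a^2, hence
   P + M = |a| = p + m; multiplying by p gives pP = p^2, whence p = P. *)
Lemma jpos_pos : pos (jpos a).
Proof.
set p := jpos a; set n := jneg a.
have sp : star p = p := hp; have sn : star n = n := hn.
have pn : p * n = 0 := jpos_jneg; have np : n * p = 0 := jneg_jpos.
have pp : pos (p * p) by apply: pos_sqr.
have pnn : pos (n * n) by apply: pos_sqr.
set P := sqrtp (p * p); set N := sqrtp (n * n).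
have PP : P * P = p * p by exact: sqrtp_sqr.
have NN : N * N = n * n by exact: sqrtp_sqr.
have pP : pos P by exact: sqrtp_pos.
have pN : pos N by exact: sqrtp_pos.
have kill x y : pos x -> x * x * y = 0 -> x * y = 0.
  by move=> px h; rewrite (pos_intertwine px pos0) ?mulr0.
have Pn : P * n = 0 by apply: kill => //; rewrite PP -mulrA pn mulr0.
have nP : n * P = 0.
  by rewrite -sn -(pos_sa pP) -starM Pn star0.
have NP : N * P = 0 by apply: kill => //; rewrite NN -mulrA nP mulr0.
have PN : P * N = 0 by rewrite -(pos_sa pP) -(pos_sa pN) -starM NP star0.
have Np : N * p = 0 by apply: kill => //; rewrite NN -mulrA np mulr0.
have pN0 : p * N = 0 by rewrite -sp -(pos_sa pN) -starM Np star0.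
have PNm : P + N = m.
  rewrite -(sqrtp_uniq (posD pP pN)) /m; congr sqrtp.
  rewrite mulrDl !mulrDr PN NP PP NN addr0 add0r.
  by rewrite [in RHS](jposE a) -/p -/n mulrBl !mulrBr pn np subr0 sub0r opprK.
have pPE : p * P = p * p.
  have : p * (P + N) = p * (p + n) by rewrite PNm jposD.
  by rewrite !mulrDr pN0 pn !addr0.
have PpE : P * p = p * p by rewrite -{1}sp -(pos_sa pP) -starM pPE starM sp.
suff -> : p = P by [].
apply/eqP; rewrite -subr_eq0; apply/eqP/starM_eq0.
rewrite starB sp (pos_sa pP).
by rewrite mulrBl !mulrBr pPE PpE PP !subrr.
Qed.

End Jordan.

Lemma jneg_opp a : jneg a = jpos (- a).
Proof. by rewrite /jneg /jpos mulrNN. Qed.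

Lemma jneg_pos a : star a = a -> pos (jneg a).
Proof. by move=> ha; rewrite jneg_opp; apply: jpos_pos; rewrite starN ha. Qed.

Lemma jpos_closed (J : T -> Prop) a : closed_subalg J -> star a = a -> J a -> J (jpos a).
Proof.
move=> cJ ha Ja; apply: (csubZ cJ); apply: (csubD cJ) => //.
by apply: sqrtp_closed => //; [exists a | exact: csubM].
Qed.

Lemma jneg_closed (J : T -> Prop) a : closed_subalg J -> star a = a -> J a -> J (jneg a).
Proof.
move=> cJ ha Ja; rewrite jneg_opp; apply: jpos_closed => //; first by rewrite starN ha.
by rewrite -scaleN1r; apply: csubZ.
Qed.

(* Kaplansky: with m the negative part of x* x and y = x m, c = m^3, one has
   y* y = -c and d := y y* >= 0; then d y = -y c while d^2 y = y c^2 gives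
   d y = y c, so that y c = 0. *)
Lemma pos_starM x : pos (star x * x).
Proof.
set a := star x * x; have ha : star a = a by rewrite /a starM starK.
set m := jneg a; set p := jpos a.
have pm : pos m := jneg_pos ha; have hm := pos_sa pm.
have aE : a = p - m := jposE a.
have pm0 : p * m = 0 := jpos_jneg ha.
set y := x * m; set c := m * m * m.
have yy : star y * y = - c.
  rewrite /y starM hm; have -> : m * star x * (x * m) = m * (a * m) by rewrite /a !mulrA.
  by rewrite aE mulrBl pm0 sub0r mulrN mulrA.
have pc : pos c by apply: pos_conj_comm.
set d := y * star y.
(* y* y + y y* is twice the sum of the squares of the real and imaginary parts *)
have pd : pos d.
  set u := 2^-1 *: (y + star y); set v := 2^-1 *: (ii * (y - star y)).
  have hu : star u = u by rewrite /u starZ starD starK addrC.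
  have hv : star v = v.
    rewrite /v starZ starM starB starK star_ii mulrN -iiC; congr (_ *: _).
    by rewrite -mulrN opprB.
  have ps : pos ((2 : R) *: (u * u + v * v)) by apply: posZ => //; apply: posD; apply: pos_sqr.
  have -> : d = (2 : R) *: (u * u + v * v) + c.
    have -> : c = - (star y * y) by rewrite yy opprK.
    have uE : u * u = (2^-1 * 2^-1) *: ((y + star y) * (y + star y)) by rewrite /u; ncring.
    have vE : v * v = - ((2^-1 * 2^-1) *: ((y - star y) * (y - star y))).
      rewrite /v -scalerAl -scalerAr scalerA -scalerN; congr (_ *: _).
      by rewrite mulrA -[ii * _ * ii]mulrA -iiC mulrA ii2 mulN1r mulNr.
    rewrite uE vE -scalerBr scalerA.
    have -> : (y + star y) * (y + star y) - (y - star y) * (y - star y)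
       = (2 : R) *: (y * star y + star y * y) by ncring.
    rewrite scalerA (_ : 2 * (2^-1 * 2^-1) * 2 = 1) ?scale1r; last by field.
    by rewrite addrK.
  exact: posD.
have dy : d * y = - (y * c) by rewrite -[d * y]mulrA yy mulrN.
have ddy : d * d * y = y * (c * c).
  by rewrite -mulrA dy mulrN [d * (y * c)]mulrA dy mulNr opprK -mulrA.
have yc : y * c = 0.
  have h := pos_intertwine pd pc ddy; move: dy; rewrite h => e.
  have : (2 : R) *: (y * c) = 0 by rewrite scaler_nat mulr2n {1}e addNr.
  by move/(congr1 (fun z => 2^-1 *: z)); rewrite scalerA mulVf ?pnatr_eq0 // scale1r scaler0.
have c0 : c = 0.
  apply: starM_eq0; rewrite (pos_sa pc).
  have -> : c * c = - (star y * (y * c)) by rewrite [star y * _]mulrA yy mulNr opprK.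
  by rewrite yc mulr0 oppr0.
suff m0 : m = 0 by rewrite aE m0 subr0; exact: jpos_pos.
apply: starM_eq0; rewrite hm; apply: starM_eq0; rewrite starM hm mulrA.
by rewrite -/c c0 mul0r.
Qed.

Lemma pos_conj a x : pos a -> pos (star x * a * x).
Proof.
move=> pa; have -> : star x * a * x = star (sqrtp a * x) * (sqrtp a * x).
  by rewrite starM sqrtp_star // -{1}(sqrtp_sqr pa) !mulrA.
exact: pos_starM.
Qed.

Lemma pos_conj_sa a x : star x = x -> pos a -> pos (x * a * x).
Proof. by move=> hx /(pos_conj x); rewrite hx. Qed.

Lemma pos_nrm_scal a t : pos a -> nrm a <= t -> pos (t%:A - a).
Proof. by move=> /pos_sa; exact: pos_sub_scal. Qed.

Lemma nrm_mono a b : pos a -> pos (b - a) -> nrm a <= nrm b.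
Proof.
move=> pa ab; have pb : pos b by rewrite -(subrK a b); exact: posD.
apply: pos_nrm => //; first exact: nrm_ge0.
exact: pos_trans ab (pos_nrm_scal pb (lexx _)).
Qed.

End Root.

(** * Approximate polar decomposition *)

Section Polar.
Context {R : realType} {T : ucstarType R}.
Implicit Types (x y z a b f q r s v w : T) (c e t : R).

Lemma commX x y n : x * y = y * x -> x * y ^+ n = y ^+ n * x.
Proof. exact: commrX. Qed.

Lemma posX a n : pos a -> pos (a ^+ n).
Proof.
move=> pa; elim: n => [|n IH]; first by rewrite expr0; exact: pos1.
by rewrite exprS; apply: posM_comm => //; rewrite -exprS -exprSr.
Qed.

Lemma comm_geom x y n : x * y = y * x ->
  x * (\sum_(i < n) y ^+ i) = (\sum_(i < n) y ^+ i) * x.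
Proof.
by move=> h; rewrite mulr_sumr mulr_suml; apply: eq_bigr => i _; exact: commX.
Qed.

Lemma geomE r n : (1 - r) * (\sum_(i < n) r ^+ i) = 1 - r ^+ n.
Proof. by rewrite -[LHS]opprK -mulNr opprB -subrX1 opprB. Qed.

Lemma comm_1B x : (1 - x) * x = x * (1 - x).
Proof. by rewrite mulrBl mulrBr mul1r mulr1. Qed.

Section Decay.
Variables (r : T) (ps1 : pos r) (ps : pos (1 - r)).

Lemma pos_geom n : pos (\sum_(i < n) r ^+ i).
Proof. by apply: pos_sum => i _; exact: posX. Qed.

Lemma pos_1BX n : pos (1 - r ^+ n).
Proof.
by rewrite -geomE; apply: posM_comm => //; [exact: pos_geom | exact/comm_geom/comm_1B].
Qed.

(** The sum of (1 - r) r^i over i <= n is 1 - r^(n+1) <= 1, and each of its n + 1 terms dominates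
    the last one. This replaces the maximum of (1 - x) x^n on [0, 1]. *)
Lemma nrm_decay n : nrm ((1 - r) * r ^+ n) <= n.+1%:R^-1.
Proof.
have [s sE] : {s | s = 1 - r} by exists (1 - r).
have sr : s * r = r * s by rewrite sE comm_1B.
rewrite -sE; have psr : pos s by rewrite sE.
apply: pos_nrm; first by rewrite invr_ge0.
  by apply: posM_comm => //; [exact: posX | exact: commX].
suff h : pos (1 - n.+1%:R *: (s * r ^+ n)).
  have -> : (n.+1%:R^-1)%:A - s * r ^+ n = n.+1%:R^-1 *: (1 - n.+1%:R *: (s * r ^+ n)).
    by rewrite scalerBr scalerA mulVf ?pnatr_eq0 // scale1r.
  by apply: posZ => //; rewrite invr_ge0.
have -> : 1 - n.+1%:R *: (s * r ^+ n) =
  r ^+ n.+1 + \sum_(i < n.+1) s * (r ^+ i - r ^+ n).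
  have -> : \sum_(i < n.+1) s * (r ^+ i - r ^+ n) =
    s * (\sum_(i < n.+1) r ^+ i) - n.+1%:R *: (s * r ^+ n).
    rewrite mulr_sumr scaler_nat -[in X in _ - X](card_ord n.+1) -sumr_const -sumrB.
    by apply: eq_bigr => i _; rewrite mulrBr.
  have -> : s * (\sum_(i < n.+1) r ^+ i) = 1 - r ^+ n.+1 by rewrite sE geomE.
  by rewrite addrA [r ^+ n.+1 + _]addrC subrK.
apply: posD; first exact: posX.
apply: pos_sum => i _; have in_ : (i <= n)%N by rewrite -ltnS.
have -> : r ^+ i - r ^+ n = r ^+ i * (1 - r ^+ (n - i)).
  by rewrite mulrBr mulr1 -exprD subnKC.
have ci : r ^+ i * (1 - r ^+ (n - i)) = (1 - r ^+ (n - i)) * r ^+ i.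
  by rewrite mulrBr mulrBl mulr1 mul1r -!exprD addnC.
apply: posM_comm => //; first by apply: posM_comm => //; [exact: posX | exact: pos_1BX].
rewrite mulrA (commX _ sr) -!mulrA; congr (_ * _).
by rewrite mulrBr mulrBl mulr1 mul1r (commX _ sr).
Qed.

End Decay.

Lemma pos_nrm1 a : pos a -> nrm a <= 1 -> pos (1 - a).
Proof. by move=> pa a1; rewrite -(scale1r 1); apply: pos_nrm_scal. Qed.

(** Telescoping, from 1 / k^2 <= 2 (1 / k - 1 / (k + 1)) for k >= 1. It makes the increments of the
    sequence [V] below summable. *)
Lemma sum_inv_sqr m n : (m <= n)%N ->
  \sum_(m <= k < n) (k.+1%:R ^+ 2)^-1 <= 2 * (m.+1%:R^-1 - n.+1%:R^-1) :> R.
Proof.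
move=> /subnK <-; elim: (n - m)%N => [|k IH].
  by rewrite add0n big_geq // subrr mulr0.
rewrite addSn big_nat_recr ?leq_addl //=.
apply: le_trans (lerD IH (lexx _)) _.
set j := (k + m)%N; rewrite -[j.+2]addn1 natrD.
have j0 : 0 < j.+1%:R :> R by rewrite ltr0n.
have j1 : 1 <= j.+1%:R :> R by rewrite ler1n.
move: (j.+1%:R : R) j0 j1 => x x0 x1.
have -> : 2 * (m.+1%:R^-1 - (x + 1)^-1) =
  2 * (m.+1%:R^-1 - x^-1) + 2 * (x * (x + 1))^-1 :> R.
  by field; rewrite ?pnatr_eq0 ?gt_eqF //; lra.
rewrite lerD2l ler_pdivlMr; last by nra.
rewrite mulrC -ler_pdivlMr ?invr_gt0; last by nra.
by rewrite invrK; nra.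
Qed.

(* w = f q s^-1 q where s = |f q|. The inverse is replaced by the partial sums
   S_n of its Neumann series, and b >= q^2 / c^2 makes q S_n q converge. *)
Lemma polar q f c : pos q -> nrm q <= 1 -> star f = f -> nrm f <= 1 -> 0 <= c ->
  pos (c ^+ 2 *: (q * (f * f) * q) - q * q) ->
  exists w', let w := f * w' in star w * w = q * q /\
    nrm (w - f * q) <= nrm (q - sqrtp (q * (f * f) * q)).
Proof.
move=> pq q1 hf f1 c0 hc; have hq := pos_sa pq.
set b := q * (f * f) * q in hc *.
have pb : pos b by apply: pos_conj_sa => //; exact: pos_sqr.
set s := sqrtp b; have ps : pos s := sqrtp_pos pb.
have hs := pos_sa ps; have ss : s * s = b := sqrtp_sqr pb.
have s1 : nrm s <= 1.
  have : nrm s ^+ 2 <= 1.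
    rewrite -nrm_starM hs ss -[1]mulr1 -[X in _ <= X * _]mulr1.
    by rewrite /b; apply: nrmM_le => //; apply: nrmM_le => //; rewrite -[1]mulr1 nrmM_le.
  by rewrite expr_le1 // nrm_ge0.
have ps1 : pos (1 - s) by apply: pos_nrm1.
have [r rE] : {r | r = 1 - s} by exists (1 - s).
rewrite -rE in ps1; have hr := pos_sa ps1.
have sE : s = 1 - r by rewrite rE subKr.
have sr : s * r = r * s by rewrite sE comm_1B.
have p1r : pos (1 - r) by rewrite -sE.
have hX n : star (r ^+ n) = r ^+ n by rewrite starX hr.
(* Conjugating q^2 <= c^2 s^2 by r^n reduces the bound to the decay of s r^n = (1 - r) r^n. *)
have qr n : nrm (q * r ^+ n) <= c * n.+1%:R^-1.
  rewrite -(ler_pXn2r (n := 2)) ?nnegrE ?nrm_ge0 ?mulr_ge0 ?invr_ge0 //.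
  rewrite -nrm_starM starM hX hq.
  apply: le_trans (nrm_mono (b := c ^+ 2 *: (star (s * r ^+ n) * (s * r ^+ n))) _ _) _.
  - have -> : r ^+ n * q * (q * r ^+ n) = star (q * r ^+ n) * (q * r ^+ n).
      by rewrite starM hX hq.
    exact: pos_starM.
  - have -> : c ^+ 2 *: (star (s * r ^+ n) * (s * r ^+ n)) - r ^+ n * q * (q * r ^+ n)
      = r ^+ n * (c ^+ 2 *: (s * s) - q * q) * r ^+ n.
      by rewrite starM hX hs; ncring.
    by rewrite ss; apply: pos_conj_sa.
  - rewrite nrmZ nrm_starM ger0_norm ?sqr_ge0 // exprMn ler_wpM2l ?sqr_ge0 //.
    by rewrite ler_pXn2r ?nnegrE ?nrm_ge0 ?invr_ge0 // sE; exact: nrm_decay.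
(* This is the sum of r^i over i < 2n. Adding terms in pairs makes the increment r^n (1 + r) r^n
   symmetric, so between two copies of q it is bounded by two factors q r^n, hence by 2 c^2 / (n +
   1)^2. *)
set S := fun n => (1 + r) * \sum_(i < n) (r * r) ^+ i.
have rrX n : (r * r) ^+ n = r ^+ n * r ^+ n by rewrite exprMn_comm.
have rS n : r * S n = S n * r.
  rewrite /S -[RHS]mulrA -comm_geom ?mulrA //; congr (_ * _).
  by rewrite mulrDl mulrDr mul1r mulr1.
have Ss n : S n * s = 1 - r ^+ n * r ^+ n.
  rewrite sE mulrBr mulr1 -rS -{1}[S n]mul1r -mulrBl /S mulrA.
  have -> : (1 - r) * (1 + r) = 1 - r * r by ncring.
  by rewrite geomE rrX.
have sS n : s * S n = S n * s.
  by rewrite sE mulrBl mulrBr mul1r mulr1 rS.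
have hS n : star (S n) = S n.
  rewrite /S starM star_sum starD star1 hr.
  under eq_bigr do rewrite starX starM hr.
  by rewrite -comm_geom // mulrDl mulrDr mul1r mulr1 mulrA.
set V := fun n => q * S n * q.
have Vstep n : nrm (V n.+1 - V n) <= 2 * c ^+ 2 * (n.+1%:R ^+ 2)^-1.
  have -> : V n.+1 - V n = star (q * r ^+ n) * 0 + (q * r ^+ n) * (1 + r) * (star (q * r ^+ n)).
    rewrite /V /S big_ord_recr /= mulrDr rrX mulr0 add0r starM hX hq.
    have -> : (1 + r) * (r ^+ n * r ^+ n) = r ^+ n * (1 + r) * r ^+ n.
      by rewrite mulrA; congr (_ * _); rewrite mulrDl mulrDr mul1r mulr1 -exprS -exprSr.
    set x := r ^+ n; set z := \sum_(i < n) _; ncring.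
  rewrite mulr0 add0r; apply: le_trans (nrmM _ _) _; rewrite nrm_star.
  apply: le_trans (ler_wpM2r (nrm_ge0 _) (nrmM _ _)) _.
  have r2 : nrm (1 + r) <= 2.
    apply: le_trans (nrmD _ _) _; rewrite -[2]/(1 + 1); apply: lerD; first exact: nrm1_le.
    by apply: pos_nrm => //; rewrite scale1r rE subKr.
  have := qr n; rewrite -exprVn; have := nrm_ge0 (q * r ^+ n); have := nrm_ge0 (1 + r).
  set k := n.+1%:R^-1; set x := nrm (q * _); set y := nrm _ => y0 x0 xk.
  have : x * x <= (c * k) * (c * k) by apply: ler_pM.
  have : x * x * y <= x * x * 2 by apply: ler_wpM2l; rewrite ?mulr_ge0.
  nra.
have Vdist m n : (m <= n)%N -> nrm (V n - V m) <= 4 * c ^+ 2 / m.+1%:R.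
  move=> mn; have -> : V n - V m = \sum_(m <= k < n) (V k.+1 - V k).
    by rewrite telescope_sumr.
  apply: le_trans (nrm_sum _ _ _) _.
  apply: le_trans (ler_sum _ (fun k _ => Vstep k)) _.
  rewrite -mulr_sumr; apply: le_trans (ler_wpM2l _ (sum_inv_sqr mn)) _.
    by rewrite mulr_ge0 // sqr_ge0.
  have : 0 <= n.+1%:R^-1 :> R by rewrite invr_ge0.
  have := sqr_ge0 c; move: (c ^+ 2) (n.+1%:R^-1) (m.+1%:R^-1) => C x y; nra.
have [w' Vw] : exists w', tends V w'.
  apply: nrm_complete => e e0; have [N hN] := inv_small (4 * c ^+ 2) e0; exists N.
  move=> m n Nm Nn; have [mn|/ltnW nm] := leqP m n.
    by rewrite nrmBC; apply: le_trans (Vdist _ _ mn) _; exact: hN.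
  by apply: le_trans (Vdist _ _ nm) _; exact: hN.
have qr0 : tends (fun n => q * r ^+ n * r ^+ n) 0.
  apply: (@tends_null _ _ _ (fun n => c / n.+1%:R)); last by move=> e; exact: inv_small.
  move=> n; rewrite subr0 -mulrA -exprD; apply: le_trans (qr _) _.
  by apply: ler_wpM2l => //; rewrite lef_pV2 ?posrE ?ltr0n // ler_nat ltnS leq_addr.
exists w' => w.
have fV : tends (fun n => f * V n) w by apply: tendsMl.
have SbS n : S n * b * S n = (1 - r ^+ n * r ^+ n) * (1 - r ^+ n * r ^+ n).
  by rewrite -Ss -{2}sS -ss !mulrA.
split.
  (* The product of the adjoint of f V_n with f V_n is q S_n b S_n q = (q - q r^(2n)) (q - r^(2n)
     q), and q r^(2n) tends to 0. *)
  apply: (tends_uniq (tendsM (tends_star fV) fV)).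
  have -> : q * q = (q - 0) * (q - star 0) by rewrite star0 !subr0.
  apply: tends_ext (tendsM (tendsB (tends_cst q) qr0) (tendsB (tends_cst q) (tends_star qr0))) => n.
  have E : star (q * r ^+ n * r ^+ n) = r ^+ n * (r ^+ n * q) by rewrite 2!starM !hX hq.
  rewrite /= [star (f * V n)]starM hf E.
  have -> : star (V n) = V n by rewrite /V 2!starM hq hS mulrA.
  have -> : V n * f * (f * V n) = q * (S n * b * S n) * q.
    by rewrite /V /b; ncring.
  by rewrite SbS; ncring.
(* Since S_n s = 1 - r^(2n), the elements f q S_n (q - s) tend to w - f q. The factor f q S_n is a
   contraction because its square norm is that of S_n b S_n = (1 - r^(2n))^2. *)
apply: (@tends_nrm_le _ _ (fun n => f * q * S n * (q - s))).
  have -> : w - f * q = w - f * q + f * 0 by rewrite mulr0 addr0.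
  apply: tends_ext (tendsD (tendsB fV (tends_cst (f * q))) (tendsMl f qr0)) => n.
  rewrite mulrBr -[f * q * S n * s]mulrA Ss /V; ncring.
move=> n; rewrite -[X in _ <= X]mul1r; apply: nrmM_le => //.
have : nrm (f * q * S n) ^+ 2 <= 1.
  rewrite -nrm_starM 2!starM hS hq hf.
  have -> : S n * (q * f) * (f * q * S n) = S n * b * S n by rewrite /b; ncring.
  rewrite SbS; have h : nrm (1 - r ^+ n * r ^+ n) <= 1.
    rewrite -exprD; apply: pos_nrm => //; first exact: pos_1BX.
    by rewrite scale1r subKr; exact: posX.
  by apply: le_trans (nrmM_le h h) _; rewrite mulr1.
by rewrite expr_le1 // nrm_ge0.
Qed.

Lemma root_iter_lip x y n : nrm x <= 1 -> nrm y <= 1 ->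
  nrm (root_iter x n - root_iter y n) <= n%:R * nrm (x - y).
Proof.
move=> x1 y1; elim: n => [|n IH]; first by rewrite /= subrr nrm0 mul0r.
have le1 z : nrm z <= 1 -> nrm (root_iter z n) <= 1.
  by move=> z1; apply: le_trans (root_iter_nrm n z1) _; have /andP[] := @root_maj_bounds R n.
rewrite /= -scalerBr nrmZ ger0_norm ?invr_ge0 // ler_pdivrMl //.
set u := root_iter x n in IH *; set v := root_iter y n in IH *.
have -> : x + u * u - (y + v * v) = (x - y) + (u * (u - v) + (u - v) * v) by ncring.
apply: le_trans (nrmD _ _) _.
have h1 : nrm (u * (u - v)) <= 1 * nrm (u - v) by apply: nrmM_le => //; exact: le1.
have h2 : nrm ((u - v) * v) <= nrm (u - v) * 1 by apply: nrmM_le => //; exact: le1.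
have := nrmD (u * (u - v)) ((u - v) * v); rewrite -[n.+1]addn1 natrD.
have := nrm_ge0 (x - y); lra.
Qed.

(** A fixed iterate approximates the root equally well on all positive contractions, and it is
    Lipschitz in its argument. *)
Lemma sqrtp_unif t : 0 < t -> exists2 c, 0 < c & forall a b, pos a -> pos b ->
  nrm a <= 1 -> nrm b <= 1 -> nrm (a - b) <= c -> nrm (sqrtp a - sqrtp b) <= t.
Proof.
move=> t0; have t4 : 0 < t / 4 by rewrite divr_gt0.
have [N /(_ N (leqnn N)) hN] := inv_small 2 t4.
(* The iterate of index N costs t / 4 at each of the two roots; its Lipschitz constant N is left
   with t / 2. *)
exists (t / 2 / N.+1%:R) => [|a b pa pb a1 b1]; first by rewrite !divr_gt0.
rewrite ler_pdivlMr ?ltr0n // => h.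
have arg z : pos z -> nrm z <= 1 -> nrm ((1 : R)%:A - z) <= 1 by exact: pos_dist.
have arg1 z : pos z -> nrm z <= 1 -> nrm (1 - z) <= 1.
  by move=> pz z1; have := arg z pz z1; rewrite scale1r.
(* [sqrtp] uses the parameter [nrm z + 1], which varies with z; uniqueness of the positive root
   allows the parameter 1 throughout. *)
have rE z : pos z -> nrm z <= 1 -> sqrtp z = 1 - root_lim (1 - z).
  move=> pz z1; have -> : 1 - root_lim (1 - z) = root_of 1 z.
    by rewrite /root_of sqrtr1 invr1 !scale1r.
  have pr : pos (root_of 1 z) by apply: pos_root => //; [exact: pos_sa | exact: arg].
  by rewrite -{1}(root_of_sqr ltr01 (arg z pz z1)) sqrtp_uniq.
have approx z : pos z -> nrm z <= 1 ->
  nrm (root_lim (1 - z) - root_iter (1 - z) N) <= t / 4.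
  move=> pz z1; apply: le_trans hN; apply: le_trans (@root_maj_dist R N).
  rewrite nrmBC; have hz := root_limP (arg1 z pz z1).
  apply: (@tends_nrm_le _ _ (fun n => root_iter (1 - z) N - root_iter (1 - z) (n + N))).
    apply: tendsB; first exact: tends_cst.
    move=> e /hz[M hM]; exists M => n Mn; apply: hM; exact: leq_trans Mn (leq_addr _ _).
  move=> n; rewrite nrmBC; apply: le_trans (root_iter_dist (arg1 z pz z1) (leq_addl n N)) _.
  by have /andP[_] := @root_maj_bounds R (n + N); lra.
rewrite !rE //; have -> : 1 - root_lim (1 - a) - (1 - root_lim (1 - b)) =
  (root_lim (1 - b) - root_iter (1 - b) N) + (root_iter (1 - b) N - root_iter (1 - a) N)
  - (root_lim (1 - a) - root_iter (1 - a) N) by ncring.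
apply: le_trans (nrmB _ _) _; have := approx a pa a1.
have := nrmD (root_lim (1 - b) - root_iter (1 - b) N) (root_iter (1 - b) N - root_iter (1 - a) N).
have := approx b pb b1; have := root_iter_lip N (arg1 b pb b1) (arg1 a pa a1).
have -> : 1 - b - (1 - a) = a - b by ncring.
have : N%:R * nrm (a - b) <= N.+1%:R * nrm (a - b).
  by rewrite ler_wpM2r ?nrm_ge0 // ler_nat.
rewrite [_%:R * _ in X in X -> _]mulrC => *; lra.
Qed.

End Polar.

(** * Cut-off functions and the polar part of f q *)

Section PolarUnit.
Context {R : realType} {T : ucstarType R}.
Implicit Types (x y z a b f q r s v w : T) (c e t : R).

(** The C*-identity gives |x|^4 = |x^4| <= |x^3| |x| for self-adjoint x. *)
Lemma nrm_sa_le_cube x c : star x = x -> 0 <= c ->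
  nrm (x * x * x) <= c * nrm x ^+ 2 -> nrm x <= c.
Proof.
move=> hx c0 h; have x0 := nrm_ge0 x.
have sq y : star y = y -> nrm (y * y) = nrm y ^+ 2 by move=> hy; rewrite -nrm_starM hy.
have x4 : nrm x ^+ 2 ^+ 2 <= c * nrm x ^+ 2 * nrm x.
  have -> : nrm x ^+ 2 ^+ 2 = nrm (x * x * x * x).
    by rewrite -[nrm x ^+ 2]sq // -sq ?starM ?hx // !mulrA.
  exact: nrmM_le.
have [->//|xn] := eqVneq (nrm x) 0.
have xp : 0 < nrm x by rewrite lt_def xn.
have x3 : 0 < nrm x ^+ 3 by rewrite exprn_gt0.
by rewrite -(ler_pM2r x3); move: x4; rewrite -exprM -mulrA -exprSr -exprS.
Qed.

(* The negative part m of a - e satisfies m^3 = e m^2 - m a m <= e m^2. *)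
Lemma jneg_shift_le a e : pos a -> 0 <= e -> nrm (jneg (a - e%:A)) <= e.
Proof.
move=> pa e0; set c := a - e%:A; set m := jneg c.
have hc : star c = c by rewrite starB (pos_sa pa) starZ star1.
have pm : pos m := jneg_pos hc; have hm := pos_sa pm.
have pm0 : jpos c * m = 0 := jpos_jneg hc.
apply: nrm_sa_le_cube => //; rewrite -(ger0_norm e0) -nrm_starM hm -nrmZ.
apply: nrm_mono; first exact: pos_conj_sa.
have -> : e *: (m * m) - m * m * m = m * a * m.
  have -> : m * m * m = - (m * c * m).
    have -> : m * c * m = m * (c * m) by rewrite mulrA.
    have -> : c * m = - (m * m) by rewrite {1}(jposE c) mulrBl pm0 sub0r.
    by rewrite mulrN opprK mulrA.
  by rewrite /c; ncring.
exact: pos_conj_sa.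
Qed.

(* q is a function of a vanishing near 0 and close to 1 away from 0: with
   v = (a - e)_+ and y = a v it is 1 - (1 - y)^N. *)
Lemma cutoff a e N : pos a -> nrm a <= 1 -> 0 < e -> exists q m,
  [/\ pos q, nrm q <= 1, q = a * m, star m = m & nrm m <= e^-1] /\
  [/\ pos (q * q - e ^+ 2 *: (m * m)),
      nrm ((1 - q) * a) ^+ 2 <= 2 * e ^+ 2 + 2 / (N + N).+1%:R &
      forall z, a * z = z * a -> q * z = z * q].
Proof.
move=> pa a1 e0; have ha := pos_sa pa.
set c := a - e%:A; have hc : star c = c by rewrite starB ha starZ star1.
set v := jpos c; set n := jneg c.
have pv : pos v := jpos_pos hc; have hv := pos_sa pv.
have pn : pos n := jneg_pos hc.
have ne : nrm n <= e by apply: jneg_shift_le => //; exact: ltW.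
have nv0 : n * v = 0 := jneg_jpos hc.
have avE : a - v = e%:A - n.
  have : c = v - n := jposE c.
  by rewrite /c => /eqP; rewrite subr_eq => /eqP ->; ncring.
have pav : pos (a - v) by rewrite avE; apply: pos_nrm_scal.
have nav : nrm (a - v) <= e.
  by apply: pos_nrm => //; [exact: ltW | rewrite avE subKr].
have va z : a * z = z * a -> v * z = z * v.
  move=> h; apply: (@jpos_closed _ _ (fun x => x * z = z * x)) => //.
    exact: commutant_closed.
  by rewrite /c mulrBl mulrBr h mulr_algl mulr_algr.
clearbody v n.
have vaC : v * a = a * v by exact: va.
(* Because (a - e) v = v^2: the negative part of a - e annihilates v. In particular y = a v
   dominates both v^2 and e v. *)
have avv : a * v = v * v + e *: v.
  have -> : a * v = (a - v) * v + v * v by rewrite mulrBl subrK.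
  by rewrite avE mulrBl nv0 subr0 mulr_algl addrC.
have v1 : nrm v <= 1 by apply: le_trans a1; exact: nrm_mono.
have [y yE] : {y | y = a * v} by exists (a * v).
have py : pos y by rewrite yE; apply: posM_comm.
have hy := pos_sa py.
have y1 : nrm y <= 1 by rewrite yE -[1]mulr1 nrmM_le.
have p1y : pos (1 - y) by exact: pos_nrm1.
have [r rE] : {r | r = 1 - y} by exists (1 - y).
rewrite -rE in p1y; have hr := pos_sa p1y.
have yr : 1 - r = y by rewrite rE subKr.
have p1r : pos (1 - r) by rewrite yr.
have ya z : a * z = z * a -> y * z = z * y.
  by move=> h; rewrite yE -mulrA va // !mulrA h.
have ra z : a * z = z * a -> r * z = z * r.
  by move=> h; rewrite rE mulrBl mulrBr mul1r mulr1 ya.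
(* P is a truncated inverse of y: y P = 1 - (1 - y)^N. As y = a v, the element q = y P factors as a
   m with m = v P. *)
have [P PE] : {P | P = \sum_(i < N) r ^+ i} by exists (\sum_(i < N) r ^+ i).
have pP : pos P by rewrite PE; exact: pos_geom.
have hP := pos_sa pP.
have Pa z : a * z = z * a -> P * z = z * P.
  by move=> h; rewrite PE; symmetry; apply: comm_geom; rewrite ra.
have PvC : P * v = v * P by apply: Pa; rewrite vaC.
have yP : y * P = 1 - r ^+ N by rewrite PE -yr geomE.
have qa z : a * z = z * a -> y * P * z = z * (y * P).
  by move=> h; rewrite -mulrA Pa // !mulrA ya.
have pq : pos (y * P) by rewrite yP; exact: pos_1BX.
have hm : star (v * P) = v * P by rewrite starM hP hv PvC.
have q1 : nrm (y * P) <= 1.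
  apply: pos_nrm => //; rewrite scale1r yP subKr; exact: posX.
have [m mE] : {m | m = v * P} by exists (v * P).
rewrite -mE in hm; have qm : y * P = v * m + e *: m.
  by rewrite mE yE avv mulrDl -scalerAl mulrA.
have mq : y * P = m * v + e *: m.
  by rewrite -(pos_sa pq) qm starD starM starZ hm hv.
(* From q = (v + e) m, the difference is m (v^2 + 2 e v) m. *)
have hle : pos (y * P * (y * P) - e ^+ 2 *: (m * m)).
  have -> : y * P * (y * P) - e ^+ 2 *: (m * m) = m * (v * v + (2 * e) *: v) * m.
    by rewrite {1}mq qm; ncring.
  apply: pos_conj_sa => //; apply: posD; first exact: pos_sqr.
  by apply: posZ => //; rewrite mulr_ge0 // ltW.
have nm : nrm m <= e^-1.
  have : nrm (e ^+ 2 *: (m * m)) <= 1.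
    apply: le_trans (nrm_mono _ hle) _; first by apply: posZ; [exact: sqr_ge0 | exact: pos_sqr].
    by rewrite -[1]mulr1 nrmM_le.
  rewrite nrmZ ger0_norm ?sqr_ge0 // -{1}hm nrm_starM -exprMn.
  have e0' := ltW e0; rewrite expr_le1 ?mulr_ge0 ?nrm_ge0 // => h.
  by rewrite -[e^-1]mulr1 ler_pdivlMl.
exists (y * P), m; split; split => //; first by rewrite yE mE mulrA.
(* The first summand has norm at most e because |a - v| <= e. For the second, r^N v^2 r^N <= r^N y
   r^N = (1 - r) r^(2N), to which [nrm_decay] applies. *)
have -> : (1 - y * P) * a = r ^+ N * (a - v) + r ^+ N * v.
  by rewrite yP subKr -mulrDr subrK.
have rN : nrm (r ^+ N) <= 1.
  apply: nrmX_le; apply: pos_nrm => //; by rewrite scale1r rE subKr.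
have h1 : nrm (r ^+ N * (a - v)) <= 1 * e by exact: nrmM_le.
have h2 : nrm (r ^+ N * v) ^+ 2 <= ((N + N).+1%:R)^-1.
  have hrN : star (r ^+ N) = r ^+ N by rewrite starX hr.
  rewrite -nrm_Mstar starM hrN hv.
  have -> : r ^+ N * v * (v * r ^+ N) = r ^+ N * (v * v) * r ^+ N by rewrite !mulrA.
  apply: le_trans (nrm_mono (b := r ^+ N * y * r ^+ N) _ _) _.
  - by apply: pos_conj_sa => //; exact: pos_sqr.
  - rewrite -mulrBl -mulrBr; apply: pos_conj_sa => //.
    by rewrite yE avv addrAC subrr add0r; apply: posZ => //; exact: ltW.
  - have -> : r ^+ N * y * r ^+ N = (1 - r) * r ^+ (N + N).
      rewrite yr exprD mulrA; congr (_ * _); symmetry; apply: commX.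
      by rewrite -yr comm_1B.
    exact: nrm_decay.
have h3 := nrmD (r ^+ N * (a - v)) (r ^+ N * v).
have := nrm_ge0 (r ^+ N * (a - v) + r ^+ N * v).
move: h1 h2 h3; rewrite mul1r; have := nrm_ge0 (r ^+ N * v); have := nrm_ge0 (r ^+ N * (a - v)).
move: (nrm (r ^+ N * (a - v))) (nrm (r ^+ N * v)) (nrm (_ + _)) ((N + N).+1%:R^-1) => x z w k.
move=> x0 z0 xe zk w3 w0.
have w2 : w ^+ 2 <= (x + z) ^+ 2 by rewrite ler_pXn2r ?nnegrE ?addr_ge0.
have x2 : x ^+ 2 <= e ^+ 2 by rewrite ler_pXn2r ?nnegrE // ltW.
have := sqr_ge0 (x - z); rewrite sqrrB sqrrD in w2 *; lra.
Qed.

(** The bound g depends on t alone. As q = a m with |m| <= 1 / e, smallness of (1 - f) a makes (1 -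
    f) q small; so q f^2 q is close to q^2 and dominates a quarter of it, and [polar] applies with c
    = 2. Then w* w = q^2 inherits the commutation property of q. *)
Lemma polar_unit t : 0 < t -> exists2 g : R, 0 < g &
  forall a f, pos a -> nrm a <= 1 -> star f = f -> nrm f <= 1 ->
    nrm ((1 - f) * a) <= g ->
  exists w', let w := f * w' in
    [/\ nrm w <= 1, nrm ((1 - w) * a) <= t &
        forall z, a * z = z * a -> star w * w * z = z * (star w * w)].
Proof.
move=> t0; have [g1 g10 hg1] := @sqrtp_unif R T (t / 4) (divr_gt0 t0 (ltr0n _ 4)).
(* With N below, the bound of [cutoff] becomes 2 e^2 + 2 / (2N + 1) <= t^2 / 32 + t^2 / 32 = (t /
   4)^2. *)
pose e := Num.min (t / 8) 1; have e0 : 0 < e by rewrite lt_min divr_gt0 ?ltr01.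
have [N hN] : exists N, 2 / (N + N).+1%:R <= t ^+ 2 / 32 :> R.
  have t2 : 0 < t ^+ 2 / 32 by rewrite divr_gt0 // exprn_gt0.
  by have [N hN] := inv_small 2 t2; exists N; apply: hN; rewrite leq_addr.
(* The first bound gives 4 |(1 - f) a|^2 <= e^2, used for q^2 <= 4 q f^2 q. The second bounds |(1 -
   f) q| <= g / e by t / 4 and by g1 / 2. *)
pose g := Num.min (e / 2) (e * Num.min (t / 4) (g1 / 2)).
have g0 : 0 < g.
  by rewrite lt_min divr_gt0 //= mulr_gt0 // lt_min !divr_gt0.
exists g => // a f pa a1 hf f1 hfa.
have [q [m [[pq q1 qE hm nm] [hqm hqa qC]]]] := cutoff N pa a1 e0.
have hq := pos_sa pq.
set z := (1 - f) * q; have nz : nrm z <= g / e.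
  by rewrite /z qE mulrA; apply: nrmM_le.
have zs : star z * z = m * (star ((1 - f) * a) * ((1 - f) * a)) * m.
  have -> : z = (1 - f) * a * m by rewrite /z qE mulrA.
  by rewrite [star (_ * m)]starM hm !mulrA.
have pb : pos (2 ^+ 2 *: (q * (f * f) * q) - q * q).
  have p1 : pos (e ^+ 2 *: (m * m) - 4 *: (star z * z)).
    have -> : e ^+ 2 *: (m * m) - 4 *: (star z * z) =
      m * ((e ^+ 2)%:A - 4 *: (star ((1 - f) * a) * ((1 - f) * a))) * m.
      by rewrite zs; set x := star _ * _; ncring.
    apply: pos_conj_sa => //.
    apply: pos_nrm_scal; first by apply: posZ => //; exact: pos_starM.
    rewrite nrmZ nrm_starM ger0_norm //.
    have : g <= e / 2 by rewrite ge_min lexx.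
    have := nrm_ge0 ((1 - f) * a); move: (nrm _) hfa => x; nra.
  have p2 := posD hqm p1; rewrite addrA subrK in p2.
  (* The parallelogram law for f q and z, whose sum is q. *)
  have -> : 2 ^+ 2 *: (q * (f * f) * q) - q * q =
     (q * q - 4 *: (star z * z)) + 2 *: (star (f * q - z) * (f * q - z)).
    have E : (1 - f) * q = q - f * q by rewrite mulrBl mul1r.
    rewrite /z E !starB !starM hf hq; ncring.
  apply: posD => //; apply: posZ => //; exact: pos_starM.
have [w' [ww wfq]] := polar pq q1 hf f1 (ler0n _ 2) pb.
exists w' => w.
have w1 : nrm w <= 1.
  have : nrm w ^+ 2 <= 1 by rewrite -nrm_starM ww -[1]mulr1 nrmM_le.
  by rewrite expr_le1 // nrm_ge0.
split=> //; last by move=> x xa; rewrite ww -mulrA (qC x xa) mulrA (qC x xa) mulrA.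
have h1 : nrm ((1 - q) * a) <= t / 4.
  have := nrm_ge0 ((1 - q) * a); move: (nrm _) hqa => x hqa x0.
  have et : e <= t / 8 by rewrite ge_min lexx.
  have t40 : 0 <= t / 4 by lra.
  rewrite -(ler_pXn2r (n := 2)) ?nnegrE //.
  have e2 : e ^+ 2 <= t ^+ 2 / 64.
    have -> : t ^+ 2 / 64 = (t / 8) ^+ 2 by field.
    by rewrite ler_pXn2r ?nnegrE //; [exact: ltW | lra].
  apply: le_trans hqa _; have -> : (t / 4) ^+ 2 = t ^+ 2 / 16 by field.
  by move: e2 hN; move: (t ^+ 2) (e ^+ 2) (2 / _) => x2 x3 x4; lra.
have ze : g / e <= Num.min (t / 4) (g1 / 2).
  by rewrite ler_pdivrMr // mulrC ge_min lexx orbT.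
have h2 : nrm (z * a) <= t / 4.
  rewrite -[t / 4]mulr1; apply: nrmM_le => //; apply: le_trans nz _.
  by apply: le_trans ze _; rewrite ge_min lexx.
have h3 : nrm (w - f * q) <= t / 4.
  (* The element q is itself the root of q^2, so the distance to be estimated is one between two
     roots, and q^2 - q f^2 q = q (1 + f) z has norm at most 2 |z| <= g1. *)
  apply: le_trans wfq _; rewrite -{1}(sqrtp_uniq pq).
  have nff : nrm (f * f) <= 1 by rewrite -[1]mulr1 nrmM_le.
  apply: hg1.
  - exact: pos_sqr.
  - by apply: pos_conj_sa => //; exact: pos_sqr.
  - by rewrite -[1]mulr1 nrmM_le.
  - by apply: le_trans (nrmM_le (nrmM_le q1 nff) q1) _; rewrite !mulr1.
  have -> : q * q - q * (f * f) * q = q * (1 + f) * z by rewrite /z; ncring.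
  apply: le_trans (nrmM_le (c := 1 * 2) (nrmM_le q1 _) nz) _.
    by apply: le_trans (nrmD _ _) _; rewrite -[2]/(1 + 1); apply: lerD => //; exact: nrm1_le.
  have := le_trans ze (_ : _ <= g1 / 2); rewrite ge_min lexx orbT => /(_ isT); lra.
have -> : (1 - w) * a = (1 - q) * a + z * a - (w - f * q) * a by rewrite /z; ncring.
apply: le_trans (nrmB _ _) _; have := nrmD ((1 - q) * a) (z * a).
have : nrm ((w - f * q) * a) <= t / 4 * 1 by exact: nrmM_le.
lra.
Qed.

End PolarUnit.

(** * Operator norms *)

Section OpNorm.
Context {R : realType} {E : Type} (vn : E -> R) (vn_ge0 : forall v, 0 <= vn v).

(** [E] is a bare type: the unitization will act on the disjoint sum of A and the scalars, which is
    not a vector space. *)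
Definition opnorm (g : E -> E) : R :=
  inf [set c : R | 0 <= c /\ forall v, vn (g v) <= c * vn v]%classic.

Definition bounded_op (g : E -> E) : Prop :=
  exists c, 0 <= c /\ forall v, vn (g v) <= c * vn v.

Lemma opnorm_min g c : 0 <= c -> (forall v, vn (g v) <= c * vn v) -> opnorm g <= c.
Proof. by move=> c0 gc; apply: ge_inf => //; exists 0 => d []. Qed.

Lemma opnorm_ge0 g : bounded_op g -> 0 <= opnorm g.
Proof. by move=> gb; apply: lb_le_inf => // d []. Qed.

Lemma opnorm_le g v : bounded_op g -> vn (g v) <= opnorm g * vn v.
Proof.
move=> gb; have [v0|v0] := eqVneq (vn v) 0.
  by case: gb => c [_ /(_ v)]; rewrite v0 !mulr0.
have vp : 0 < vn v by rewrite lt_def v0 vn_ge0.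
rewrite -ler_pdivrMr //; apply: lb_le_inf => // d [_ /(_ v)].
by rewrite -ler_pdivrMr.
Qed.

End OpNorm.

Section OperatorAlgebra.
Context {R : realType} {T : algType R} (st : T -> T) {E : Type} (vn : E -> R).
Variable act : T -> E -> E.
Hypothesis vn_ge0 : forall v, 0 <= vn v.
Hypothesis act_bounded : forall x, bounded_op vn (act x).
Hypothesis actD : forall x y v, vn (act (x + y) v) <= vn (act x v) + vn (act y v).
Hypothesis actZ : forall (c : R) x v, vn (act (c *: x) v) = `|c| * vn (act x v).
Hypothesis actM : forall x y v, act (x * y) v = act x (act y v).
Hypothesis stK : involutive st.
(* Cauchy-Schwarz for <x v, x v> = <v, x* x v>; it yields the C*-identity. *)
Hypothesis act_CS : forall x v, vn (act x v) ^+ 2 <= vn v * vn (act (st x * x) v).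

Let N x := opnorm vn (act x).
Let N_le x v : vn (act x v) <= N x * vn v. Proof. exact: opnorm_le. Qed.
Let N_ge0 x : 0 <= N x. Proof. exact: opnorm_ge0. Qed.

Lemma opnormD x y : N (x + y) <= N x + N y.
Proof.
apply: opnorm_min => [|v]; first exact: addr_ge0.
by apply: le_trans (actD _ _ _) _; rewrite mulrDl lerD.
Qed.

Lemma opnormZ (c : R) x : N (c *: x) = `|c| * N x.
Proof.
have le d y : N (d *: y) <= `|d| * N y.
  apply: opnorm_min => [|v]; first exact: mulr_ge0.
  by rewrite actZ -mulrA ler_wpM2l.
apply/le_anti; rewrite le /=; have [->|c0] := eqVneq c 0.
  by rewrite normr0 mul0r.
rewrite -ler_pdivlMl ?normr_gt0 // -normfV.
by have := le c^-1 (c *: x); rewrite scalerA mulVf // scale1r.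
Qed.

Lemma opnormM x y : N (x * y) <= N x * N y.
Proof.
apply: opnorm_min => [|v]; first exact: mulr_ge0.
rewrite actM; apply: le_trans (N_le _ _) _; rewrite -mulrA.
exact: ler_wpM2l.
Qed.

Lemma opnorm_starM x : N (st x * x) = N x ^+ 2.
Proof.
have sq y : N y ^+ 2 <= N (st y * y).
  rewrite -(sqr_sqrtr (N_ge0 (st y * y))) ler_pXn2r ?nnegrE ?sqrtr_ge0 //.
  apply: opnorm_min => [|v]; first exact: sqrtr_ge0.
  rewrite -(ler_pXn2r (n := 2)) ?nnegrE ?mulr_ge0 ?sqrtr_ge0 //.
  rewrite exprMn sqr_sqrtr //; apply: le_trans (act_CS _ _) _.
  by rewrite expr2 mulrA [X in _ <= X]mulrC; apply: ler_wpM2l.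
have le_st y : N y <= N (st y).
  have [->//|y0] := eqVneq (N y) 0.
  have yp : 0 < N y by rewrite lt_def y0 N_ge0.
  rewrite -(ler_pM2r yp) -expr2; apply: le_trans (sq y) _; exact: opnormM.
apply/le_anti; rewrite sq andbT; apply: le_trans (opnormM _ _) _.
by rewrite expr2 ler_wpM2r // -{2}(stK x) le_st.
Qed.

End OperatorAlgebra.

(** * The real-valued norm and sequential completeness *)

Section RealNorm.
Context {R : realType}.

Definition rnorm {V : normedZmodType R[i]} (v : V) : R := complex.Re `|v|.

Lemma rnormE (V : normedZmodType R[i]) (v : V) : `|v| = (rnorm v)%:C%C.
Proof. by rewrite /rnorm RRe_real // ger0_real. Qed.

Lemma rnorm_ge0 (V : normedZmodType R[i]) (v : V) : 0 <= rnorm v.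
Proof. by rewrite -ler0c -rnormE. Qed.

Lemma rnormD (V : normedZmodType R[i]) (v w : V) : rnorm (v + w) <= rnorm v + rnorm w.
Proof. by rewrite -lecR rmorphD /= -!rnormE ler_normD. Qed.

Lemma rnormN (V : normedZmodType R[i]) (v : V) : rnorm (- v) = rnorm v.
Proof. by rewrite /rnorm normrN. Qed.

Lemma rnormB (V : normedZmodType R[i]) (v w : V) : rnorm (v - w) <= rnorm v + rnorm w.
Proof. by rewrite -(rnormN w) rnormD. Qed.

Lemma rnorm_eq0 (V : normedZmodType R[i]) (v : V) : rnorm v = 0 -> v = 0.
Proof. by move=> h; apply: normr0_eq0; rewrite rnormE h. Qed.

Lemma rnorm0 (V : normedZmodType R[i]) : rnorm (0 : V) = 0.
Proof. by rewrite /rnorm normr0. Qed.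

Lemma rnormZ (V : normedModType R[i]) (c : R[i]) (v : V) :
  rnorm (c *: v) = rnorm c * rnorm v.
Proof. by apply: complexI; rewrite rmorphM /= -!rnormE normrZ. Qed.

Lemma rnormCM (c d : R[i]) : rnorm (c * d) = rnorm c * rnorm d.
Proof. by apply: complexI; rewrite rmorphM /= -!rnormE normrM. Qed.

Lemma rnormR (r : R) : rnorm r%:C%C = `|r|.
Proof. by rewrite /rnorm normc_def /= expr0n addr0 sqrtr_sqr. Qed.

Lemma rnormJ (c : R[i]) : rnorm c^* = rnorm c.
Proof. by rewrite /rnorm norm_conjC. Qed.

Lemma rnorm_Re (c : R[i]) : `|complex.Re c| <= rnorm c.
Proof. by rewrite -lecR -rnormE normc_ge_Re. Qed.

Lemma rnorm_Im (c : R[i]) : `|complex.Im c| <= rnorm c.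
Proof.
case: c => a b; rewrite /rnorm normc_def /=.
by rewrite -sqrtr_sqr ler_sqrt ?addr_ge0 ?sqr_ge0 // lerDr sqr_ge0.
Qed.

Lemma rnorm_le_ReIm (c : R[i]) : rnorm c <= `|complex.Re c| + `|complex.Im c|.
Proof.
case: c => a b; rewrite /rnorm normc_def /=.
rewrite -[leRHS]ger0_norm ?addr_ge0 // -sqrtr_sqr ler_sqrt ?sqr_ge0 //.
by rewrite sqrrD !real_normK ?num_real // addrAC lerDl mulrn_wge0 ?mulr_ge0.
Qed.

Lemma rnormM (A : cstarAlgType R) (x y : A) : rnorm (cmul x y) <= rnorm x * rnorm y.
Proof. by rewrite -lecR rmorphM /= -!rnormE cnormM. Qed.

Lemma rnorm_cstarM (A : cstarAlgType R) (x : A) : rnorm (cmul (cstar x) x) = rnorm x ^+ 2.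
Proof. by apply: complexI; rewrite rmorphXn /= -!rnormE cnorm_cstar. Qed.

Lemma seq_complete (K : numFieldType) (V : completeNormedModType K) (u : nat -> V) :
  (forall e : K, 0 < e -> exists N, forall m n, (N <= m)%N -> (N <= n)%N ->
      `|u m - u n| <= e) ->
  exists l, forall e : K, 0 < e -> exists N, forall n, (N <= n)%N -> `|u n - l| <= e.
Proof.
move=> uC; have : cauchy (u @ \oo)%classic.
  apply: cauchy_exP => e e0; have [N hN] := uC (e / 2) (divr_gt0 e0 (ltr0n _ 2)).
  exists (u N); exists N => // n /= Nn; rewrite -ball_normE /=.
  apply: le_lt_trans (hN _ _ (leqnn N) Nn) _.
  by rewrite ltr_pdivrMr // ltr_pMr // ltr1n.
move=> /cauchy_cvgP/cvg_ex[l ul]; exists l => e e0.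
move/cvgrPdist_le: ul => /(_ e e0)[N _ hN]; exists N => n Nn.
by rewrite distrC; apply: hN.
Qed.

Lemma seq_complete_cstar (A : cstarAlgType R) (u : nat -> A) :
  (forall e, 0 < e -> exists N, forall m n, (N <= m)%N -> (N <= n)%N ->
      rnorm (u m - u n) <= e) ->
  exists l, forall e, 0 < e -> exists N, forall n, (N <= n)%N -> rnorm (u n - l) <= e.
Proof.
move=> uC; have [e e0|l hl] := @seq_complete R[i] A u.
  have eR : (complex.Re e)%:C%C = e by rewrite RRe_real // gtr0_real.
  have [|N hN] := uC (complex.Re e); first by rewrite -ltcR eR.
  by exists N => m n Nm Nn; rewrite rnormE -eR lecR hN.
exists l => e e0; have [|N hN] := hl e%:C%C; first by rewrite ltcR.
by exists N => n Nn; rewrite -lecR -rnormE hN.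
Qed.

Lemma seq_complete_complex (u : nat -> R[i]) :
  (forall e, 0 < e -> exists N, forall m n, (N <= m)%N -> (N <= n)%N ->
      rnorm (u m - u n) <= e) ->
  exists l, forall e, 0 < e -> exists N, forall n, (N <= n)%N -> rnorm (u n - l) <= e.
Proof.
move=> uC.
have ReB (x y : R[i]) : complex.Re (x - y) = complex.Re x - complex.Re y.
  by case: x y => ? ? [].
have ImB (x y : R[i]) : complex.Im (x - y) = complex.Im x - complex.Im y.
  by case: x y => ? ? [].
have [e e0|a ha] := @seq_complete R R (fun n => complex.Re (u n)).
  have [N hN] := uC e e0; exists N => m n Nm Nn; apply: le_trans (hN m n Nm Nn).
  by apply: le_trans (rnorm_Re _); rewrite ReB.
have [e e0|b hb] := @seq_complete R R (fun n => complex.Im (u n)).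
  have [N hN] := uC e e0; exists N => m n Nm Nn; apply: le_trans (hN m n Nm Nn).
  by apply: le_trans (rnorm_Im _); rewrite ImB.
exists (a +i* b)%C => e e0; have e2 : 0 < e / 2 by rewrite divr_gt0.
have [N hN] := ha _ e2; have [M hM] := hb _ e2.
exists (maxn N M) => n; rewrite geq_max => /andP[Nn Mn].
apply: le_trans (rnorm_le_ReIm _) _; rewrite ReB ImB /=.
have := hN n Nn; have := hM n Mn; rewrite /=; lra.
Qed.

End RealNorm.

(** * Unitization *)

Section Unitization.
Context {R : realType}.
Variable A : cstarAlgType R.

Definition unitz : Type := (A * R[i])%type.

HB.instance Definition _ := GRing.Zmodule.copy unitz (A * R[i])%type.

Implicit Types (x y z : unitz) (a b : A) (c d : R[i]) (r s : R).

Definition uone : unitz := (0, 1).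
Definition umul x y : unitz :=
  (cmul x.1 y.1 + (x.2 *: y.1 + y.2 *: x.1), x.2 * y.2).
Definition uscale r x : unitz := (r%:C%C *: x.1, r%:C%C * x.2).
Definition ustar x : unitz := (cstar x.1, x.2^*).
Definition uii : unitz := (0, 'i).

Lemma cmul0l a : cmul 0 a = 0.
Proof. by rewrite -(scale0r (0 : A)) cmulZl !scale0r. Qed.

Lemma cmul0r a : cmul a 0 = 0.
Proof. by rewrite -(scale0r (0 : A)) cmulZr !scale0r. Qed.

Lemma cstar0 : cstar (0 : A) = 0.
Proof. by rewrite -(scale0r (0 : A)) cstarZ conjC0 !scale0r. Qed.

Lemma umulA : associative umul.
Proof.
move=> [x c] [y d] [z e]; congr (_, _); rewrite /= ?mulrA //.
rewrite !(cmulDl, cmulDr, cmulZl, cmulZr, scalerDr, scalerDl, scalerA, cmulA).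
rewrite -!addrA; congr (_ + _).
rewrite [e * c]mulrC [e * d]mulrC.
rewrite [RHS]addrCA; congr (_ + _).
rewrite [LHS]addrCA; congr (_ + _).
exact: addrCA.
Qed.

Lemma umul1l : left_id uone umul.
Proof. by case=> x c; rewrite /umul /= cmul0l scale1r scaler0 addr0 add0r mul1r. Qed.

Lemma umul1r : right_id uone umul.
Proof. by case=> x c; rewrite /umul /= cmul0r scale1r scaler0 !add0r mulr1. Qed.

Lemma umulDl : left_distributive umul +%R.
Proof.
move=> [x c] [y d] [z e]; congr (_, _); rewrite /= ?mulrDl //.
rewrite cmulDl scalerDl scalerDr [RHS]addrACA; congr (_ + _).
exact: addrACA.
Qed.

Lemma umulDr : right_distributive umul +%R.
Proof.
move=> [x c] [y d] [z e]; congr (_, _); rewrite /= ?mulrDr //.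
rewrite cmulDr scalerDl scalerDr [RHS]addrACA; congr (_ + _).
exact: addrACA.
Qed.

Lemma uone_neq0 : uone != 0 :> unitz.
Proof. by apply/eqP => -[]; apply/eqP; rewrite oner_eq0. Qed.

HB.instance Definition _ := GRing.Zmodule_isNzRing.Build unitz
  umulA umul1l umul1r umulDl umulDr uone_neq0.

Lemma uscaleA r s x : uscale r (uscale s x) = uscale (r * s) x.
Proof. by congr (_, _); rewrite /= rmorphM /= ?scalerA ?mulrA. Qed.

Lemma uscale1 : left_id 1 uscale.
Proof. by case=> x c; rewrite /uscale /= scale1r mul1r. Qed.

Lemma uscaleDr : right_distributive uscale +%R.
Proof. by move=> r x y; congr (_, _); rewrite /= ?scalerDr ?mulrDr. Qed.

Lemma uscaleDl x : {morph uscale^~ x : r s / r + s}.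
Proof. by move=> r s; congr (_, _); rewrite /= rmorphD /= ?scalerDl ?mulrDl. Qed.

HB.instance Definition _ := GRing.Zmodule_isLmodule.Build R unitz
  uscaleA uscale1 uscaleDr uscaleDl.

Lemma uscaleAl r x y : r *: (x * y) = (r *: x) * y.
Proof.
congr (_, _); rewrite /= ?mulrA // !scalerDr cmulZl !scalerA.
by rewrite [y.2 * _]mulrC.
Qed.

Lemma uscaleAr r x y : r *: (x * y) = x * (r *: y).
Proof.
congr (_, _); rewrite /=; last exact: mulrCA.
by rewrite !scalerDr cmulZr !scalerA [x.2 * _]mulrC.
Qed.

HB.instance Definition _ := GRing.Lmodule_isLalgebra.Build R unitz uscaleAl.
HB.instance Definition _ := GRing.Lalgebra_isAlgebra.Build R unitz uscaleAr.

(* The unitization acts on A and on the scalars, whence the maximum of the two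
   norms: the action on A alone is not faithful when A has a unit. *)
Definition uact x (v : A + R[i]) : A + R[i] :=
  match v with inl a => inl (cmul x.1 a + x.2 *: a) | inr c => inr (x.2 * c) end.
Definition uvn (v : A + R[i]) : R :=
  match v with inl a => rnorm a | inr c => rnorm c end.
Definition unrm x : R := opnorm uvn (uact x).

Lemma uvn_ge0 v : 0 <= uvn v.
Proof. by case: v => v; exact: rnorm_ge0. Qed.

Lemma uact_le x v : uvn (uact x v) <= (rnorm x.1 + rnorm x.2) * uvn v.
Proof.
case: v => [a|c] /=; rewrite mulrDl.
  apply: le_trans (rnormD _ _) _; apply: lerD; first exact: rnormM.
  by rewrite rnormZ.
by rewrite rnormCM lerDr mulr_ge0 ?rnorm_ge0.
Qed.

Lemma uact_bounded x : bounded_op uvn (uact x).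
Proof.
exists (rnorm x.1 + rnorm x.2); split; last exact: uact_le.
by rewrite addr_ge0 ?rnorm_ge0.
Qed.

Lemma uactD x y v : uvn (uact (x + y) v) <= uvn (uact x v) + uvn (uact y v).
Proof.
case: v => [a|c] /=; last by rewrite mulrDl rnormD.
by rewrite cmulDl scalerDl addrACA rnormD.
Qed.

Lemma uactZ r x v : uvn (uact (r *: x) v) = `|r| * uvn (uact x v).
Proof.
case: v => [a|c] /=; rewrite -rnormR; last by rewrite -mulrA rnormCM.
by rewrite cmulZl -scalerA -scalerDr rnormZ.
Qed.

Lemma uactM x y v : uact (x * y) v = uact x (uact y v).
Proof.
case: v => [a|c] /=; last by rewrite mulrA.
congr inl; rewrite !(cmulDl, cmulDr, scalerDr, cmulZl, cmulZr, scalerA, cmulA).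
by rewrite -!addrA; congr (_ + _); exact: addrCA.
Qed.

Lemma ustarK : involutive ustar.
Proof. by case=> x c; rewrite /ustar /= cstarK conjCK. Qed.

Lemma ustarD : {morph ustar : x y / x + y}.
Proof. by move=> x y; congr (_, _); rewrite /= ?cstarD ?rmorphD. Qed.

Lemma conj_real_complex r : (r%:C%C : R[i])^* = r%:C%C.
Proof. exact: conjc_real. Qed.

Lemma ustarZ r x : ustar (r *: x) = r *: ustar x.
Proof. by congr (_, _); rewrite /= ?cstarZ ?rmorphM /= conj_real_complex. Qed.

Lemma ustarM x y : ustar (x * y) = ustar y * ustar x.
Proof.
congr (_, _); rewrite /= ?rmorphM 1?mulrC //.
by rewrite !(cstarD, cstarM, cstarZ) [X in _ + X]addrC.
Qed.

Lemma uact_CS x v : uvn (uact x v) ^+ 2 <= uvn v * uvn (uact (ustar x * x) v).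
Proof.
case: v => [a|c] /=; last first.
  by rewrite !rnormCM rnormJ le_eqVlt; apply/orP; left; apply/eqP; ring.
rewrite -rnorm_cstarM.
have := uactM (ustar x) x (inl a) => /= -[] ->.
have [b bE] : {b | b = cmul x.1 a + x.2 *: a} by eexists.
rewrite -bE.
have -> : cmul (cstar b) b = cmul (cstar a) (cmul (cstar x.1) b + x.2^* *: b).
  rewrite {1}bE cstarD cstarM cstarZ cmulDl cmulZl cmulDr cmulZr.
  by rewrite cmulA.
apply: le_trans (rnormM _ _) _; rewrite ler_wpM2r ?rnorm_ge0 //.
have [->|a0] := eqVneq (rnorm (cstar a)) 0; first exact: rnorm_ge0.
have ap : 0 < rnorm (cstar a) by rewrite lt_def a0 rnorm_ge0.
rewrite -(ler_pM2r ap) -expr2 -rnorm_cstarM cstarK; exact: rnormM.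
Qed.

(** The action on the scalar 1 detects the scalar part; once this is 0, the action on the adjoint of
    [a] gives a a* = 0. *)
Lemma unrm_faithful x : unrm x = 0 -> x = 0.
Proof.
move=> x0; have act0 v : uvn (uact x v) = 0.
  apply/le_anti; rewrite uvn_ge0 andbT.
  by have := opnorm_le uvn_ge0 v (uact_bounded x); rewrite -/(unrm x) x0 mul0r.
case: x {x0} act0 => a c act0.
have c0 : c = 0 by have := act0 (inr 1) => /=; rewrite mulr1 => /rnorm_eq0.
have := act0 (inl (cstar a)); rewrite /= c0 scale0r addr0 => /rnorm_eq0 a0.
suff -> : a = 0 by [].
apply: rnorm_eq0; have : rnorm (cstar a) ^+ 2 = 0 by rewrite -rnorm_cstarM cstarK a0 rnorm0.
move/eqP; rewrite sqrf_eq0 => /eqP/rnorm_eq0 s0.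
by rewrite -(cstarK a) s0 cstar0 rnorm0.
Qed.

Lemma rnorm_star a : rnorm (cstar a) = rnorm a.
Proof.
suff le b : rnorm b <= rnorm (cstar b) by apply/le_anti; rewrite -{2}(cstarK a) !le.
have [->|b0] := eqVneq (rnorm b) 0; first exact: rnorm_ge0.
have bp : 0 < rnorm b by rewrite lt_def b0 rnorm_ge0.
by rewrite -(ler_pM2r bp) -expr2 -rnorm_cstarM rnormM.
Qed.

Lemma unrm_scal_le x : rnorm x.2 <= unrm x.
Proof.
have := opnorm_le uvn_ge0 (inr 1) (uact_bounded x).
by rewrite /= mulr1 (rnormR 1) normr1 mulr1.
Qed.

Lemma unrm_inj a : unrm (a, 0) = rnorm a.
Proof.
apply/le_anti/andP; split.
  apply: opnorm_min => [|v]; first exact: rnorm_ge0.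
  by apply: le_trans (uact_le _ _) _; rewrite /= rnorm0 addr0.
have [->|a0] := eqVneq (rnorm a) 0; first exact/opnorm_ge0/uact_bounded.
have ap : 0 < rnorm a by rewrite lt_def a0 rnorm_ge0.
have := opnorm_le uvn_ge0 (inl (cstar a)) (uact_bounded (a, 0)).
have E : rnorm (cmul a (cstar a)) = rnorm a ^+ 2.
  by rewrite -{1}(cstarK a) rnorm_cstarM rnorm_star.
by rewrite /= scale0r addr0 E rnorm_star expr2 ler_pM2r.
Qed.

Lemma unrmD x y : unrm (x + y) <= unrm x + unrm y.
Proof. exact: (opnormD uvn_ge0 uact_bounded uactD). Qed.

Lemma unrm_split x : unrm x <= rnorm x.1 + rnorm x.2.
Proof.
by apply: opnorm_min => [|v]; [rewrite addr_ge0 ?rnorm_ge0 | exact: uact_le].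
Qed.

(** Makes both components of a Cauchy sequence Cauchy, so that completeness of the unitization
    reduces to that of A and of the scalars. *)
Lemma unrm_fst_le x : rnorm x.1 <= 2 * unrm x.
Proof.
rewrite -unrm_inj; have -> : (x.1, 0) = x + (0, - x.2) :> unitz.
  by congr (_, _); rewrite /= ?addr0 ?subrr.
apply: le_trans (unrmD _ _) _.
have := unrm_split (0, - x.2); have := unrm_scal_le x.
rewrite /= rnorm0; have -> : rnorm (- x.2) = rnorm x.2 by rewrite /rnorm normrN.
lra.
Qed.

Lemma unrm_complete (u : nat -> unitz) :
  (forall e, 0 < e -> exists N, forall m n, (N <= m)%N -> (N <= n)%N ->
      unrm (u m - u n) <= e) ->
  exists l, forall e, 0 < e -> exists N, forall n, (N <= n)%N -> unrm (u n - l) <= e.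
Proof.
move=> uC; have [e e0|a ha] := @seq_complete_cstar _ A (fun n => (u n).1).
  have [|N hN] := uC (e / 2); first by rewrite divr_gt0.
  exists N => m n Nm Nn; have := hN m n Nm Nn; have := unrm_fst_le (u m - u n).
  rewrite /=; lra.
have [e e0|c hc] := @seq_complete_complex R (fun n => (u n).2).
  have [N hN] := uC e e0; exists N => m n Nm Nn; apply: le_trans (hN m n Nm Nn).
  exact: (unrm_scal_le (u m - u n)).
exists (a, c) => e e0; have e2 : 0 < e / 2 by rewrite divr_gt0.
have [N hN] := ha _ e2; have [M hM] := hc _ e2.
exists (maxn N M) => n; rewrite geq_max => /andP[Nn Mn].
apply: le_trans (unrm_split _) _; have := hN n Nn; have := hM n Mn.
rewrite /=; lra.
Qed.

Lemma uiiC x : uii * x = x * uii.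
Proof.
case: x => x c; congr (_, _); rewrite /= 1?mulrC //.
by rewrite cmul0l cmul0r !scaler0 !addr0 !add0r.
Qed.

Lemma uii2 : uii * uii = -1.
Proof.
by congr (_, _); rewrite /= -?expr2 ?sqrCi // cmul0l !scaler0 !addr0 oppr0.
Qed.

Lemma ustar_ii : ustar uii = - uii.
Proof. by congr (_, _); rewrite /= ?conjCi // cstar0 oppr0. Qed.

HB.instance Definition _ := Algebra_isUCStar.Build R unitz
  uiiC uii2 ustar_ii ustarK ustarD ustarZ ustarM
  unrmD (opnormZ uvn_ge0 uact_bounded uactZ)
  (opnormM uvn_ge0 uact_bounded uactM)
  (opnorm_starM uvn_ge0 uact_bounded uactM ustarK uact_CS)
  unrm_faithful unrm_complete.

Definition uinj a : unitz := (a, 0).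

Lemma uinj_injective : injective uinj. Proof. by move=> a b []. Qed.

Lemma uinjD a b : uinj (a + b) = uinj a + uinj b.
Proof. by congr (_, _); rewrite /= addr0. Qed.

Lemma uinjN a : uinj (- a) = - uinj a.
Proof. by congr (_, _); rewrite /= oppr0. Qed.

Lemma uinjB a b : uinj (a - b) = uinj a - uinj b.
Proof. by rewrite uinjD uinjN. Qed.

Lemma uinj0 : uinj 0 = 0. Proof. by []. Qed.

Lemma uinjM a b : uinj (cmul a b) = uinj a * uinj b.
Proof. by congr (_, _); rewrite /= ?mul0r // !scale0r !addr0. Qed.

Lemma uinj_star a : uinj (cstar a) = star (uinj a).
Proof. by congr (_, _); rewrite /= conjC0. Qed.

Lemma uinjZ r a : uinj (r%:C%C *: a) = r *: uinj a.
Proof. by congr (_, _); rewrite /= mulr0. Qed.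

Lemma uinj_nrm a : nrm (uinj a) = rnorm a.
Proof. exact: unrm_inj. Qed.

Lemma uinj_sum (I : Type) (s : seq I) (P : pred I) (F : I -> A) :
  uinj (\sum_(i <- s | P i) F i) = \sum_(i <- s | P i) uinj (F i).
Proof. exact: (big_morph _ uinjD uinj0). Qed.

Lemma uinj_ideal a x : exists b, uinj a * x = uinj b.
Proof.
by exists (cmul a x.1 + x.2 *: a); congr (_, _); rewrite /= ?mul0r // scale0r add0r.
Qed.

Lemma uinj_ideal_r a x : exists b, x * uinj a = uinj b.
Proof.
by exists (cmul x.1 a + x.2 *: a); congr (_, _); rewrite /= ?mulr0 // scale0r addr0.
Qed.

End Unitization.

(** * Matrices over a C*-algebra *)

Section InnerProduct.
Context {R : realType} {T : ucstarType R} {n : nat}.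
Implicit Types (u v w : 'I_n -> T) (x : T) (c : R).

Definition ip u v : T := \sum_i star (u i) * v i.
Definition vnorm u : R := Num.sqrt (nrm (ip u u)).

Lemma ip_star u v : star (ip u v) = ip v u.
Proof. by rewrite /ip star_sum; apply: eq_bigr => i _; rewrite starM starK. Qed.

Lemma ipDr u v w : ip u (fun i => v i + w i) = ip u v + ip u w.
Proof. by rewrite /ip -big_split; apply: eq_bigr => i _ /=; rewrite mulrDr. Qed.

Lemma ipDl u v w : ip (fun i => v i + w i) u = ip v u + ip w u.
Proof. by rewrite -ip_star ipDr starD !ip_star. Qed.

Lemma ipMr u v x : ip u (fun i => v i * x) = ip u v * x.
Proof. by rewrite /ip mulr_suml; apply: eq_bigr => i _; rewrite mulrA. Qed.

Lemma ipMl u v x : ip (fun i => v i * x) u = star x * ip v u.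
Proof. by rewrite -ip_star ipMr starM ip_star. Qed.

Lemma ip_pos u : pos (ip u u).
Proof. by apply: pos_sum => i _; exact: pos_starM. Qed.

Lemma ip_entry u i : nrm (u i) ^+ 2 <= nrm (ip u u).
Proof.
rewrite -nrm_starM; apply: nrm_mono; first exact: pos_starM.
rewrite /ip (bigD1 i) //= addrAC subrr add0r; apply: pos_sum => j _; exact: pos_starM.
Qed.

(** Cauchy-Schwarz for Hilbert modules. With b = |<u,u>| and x = <u,v>, positivity of <z,z> for z =
    b v - u x together with <u,u> <= b gives b x* x <= b^2 <v,v>. When b = 0 the vector u is 0. *)
Lemma nrm_ip u v : nrm (ip u v) <= vnorm u * vnorm v.
Proof.
rewrite -(ler_pXn2r (n := 2)) ?nnegrE ?mulr_ge0 ?sqrtr_ge0 ?nrm_ge0 //.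
rewrite exprMn !sqr_sqrtr ?nrm_ge0 //.
set b := nrm (ip u u); have b0 : 0 <= b by exact: nrm_ge0.
have [bz|bn] := eqVneq b 0.
  have u0 i : u i = 0.
    apply: nrm0_eq0; apply/eqP; rewrite -sqrf_eq0 eq_le sqr_ge0 andbT -bz.
    exact: ip_entry.
  by rewrite /ip big1 ?nrm0 ?expr0n /= ?mulr_ge0 ?nrm_ge0 // => i _; rewrite u0 star0 mul0r.
have bp : 0 < b by rewrite lt_def bn.
set x := ip u v.
have h : pos ((b ^+ 2) *: ip v v - b *: (star x * x)).
  have hw := ip_pos (fun i => v i * b%:A + u i * (- x)).
  have hb : pos (star x * (b%:A - ip u u) * x).
    by apply: pos_conj; apply: pos_nrm_scal => //; exact: ip_pos.
  have := posD hw hb; congr pos.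
  rewrite ipDr !ipDl !ipMr !ipMl -(ip_star u v) -/x starZ star1 starN.
  ncring.
rewrite -nrm_starM -(ler_pM2l bp) mulrA -expr2.
rewrite -[b * _](_ : nrm (b *: (star x * x)) = _); last by rewrite nrmZ ger0_norm.
rewrite -[b ^+ 2 * _](_ : nrm (b ^+ 2 *: ip v v) = _); last first.
  by rewrite nrmZ ger0_norm // sqr_ge0.
by apply: nrm_mono => //; apply: posZ => //; exact: pos_starM.
Qed.

Lemma vnorm_ge0 u : 0 <= vnorm u. Proof. exact: sqrtr_ge0. Qed.

Lemma sqr_vnorm u : vnorm u ^+ 2 = nrm (ip u u).
Proof. by rewrite sqr_sqrtr // nrm_ge0. Qed.

Lemma vnorm_entry u i : nrm (u i) <= vnorm u.
Proof.
by rewrite -(ler_pXn2r (n := 2)) ?nnegrE ?nrm_ge0 ?vnorm_ge0 // sqr_vnorm ip_entry.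
Qed.

Lemma vnormD u v : vnorm (fun i => u i + v i) <= vnorm u + vnorm v.
Proof.
rewrite -(ler_pXn2r (n := 2)) ?nnegrE ?addr_ge0 ?vnorm_ge0 // sqr_vnorm ipDr !ipDl.
apply: le_trans (nrmD _ _) _; rewrite sqrrD !sqr_vnorm.
have := nrmD (ip u u) (ip v u); have := nrmD (ip u v) (ip v v).
by have := nrm_ip u v; have := nrm_ip v u; rewrite [vnorm v * _]mulrC; lra.
Qed.

Lemma vnormZ c u : vnorm (fun i => c *: u i) = `|c| * vnorm u.
Proof.
rewrite /vnorm; have -> : ip (fun i => c *: u i) (fun i => c *: u i) = c ^+ 2 *: ip u u.
  by rewrite /ip scaler_sumr; apply: eq_bigr => i _; rewrite starZ; ncring.
rewrite nrmZ sqrtrM ?normr_ge0 //.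
by rewrite ger0_norm ?sqr_ge0 // sqrtr_sqr.
Qed.

Lemma vnorm_le_sum u : vnorm u <= \sum_i nrm (u i).
Proof.
have s0 (I : Type) (s : seq I) (F : I -> T) : 0 <= \sum_(i <- s) nrm (F i).
  by apply: sumr_ge0 => i _; exact: nrm_ge0.
rewrite -(ler_pXn2r (n := 2)) ?nnegrE ?vnorm_ge0 ?s0 // sqr_vnorm /ip.
apply: le_trans (nrm_sum _ _ _) _.
elim: (index_enum _) => [|i s IH]; first by rewrite !big_nil.
rewrite !big_cons nrm_starM sqrrD -addrA lerD2l.
apply: le_trans IH _; rewrite lerDr mulrn_wge0 // mulr_ge0 ?nrm_ge0 ?s0 //.
Qed.

End InnerProduct.

Section MatrixAlgebra.
Context {R : realType}.
Variables (T : ucstarType R) (k : nat).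

(* A copy of the matrices, free to carry an algebra structure over R rather than
   over T. *)
Definition cmx : Type := 'M[T]_k.+1.

HB.instance Definition _ := GRing.NzRing.copy cmx 'M[T]_k.+1.

Implicit Types (x y z : cmx) (c d : R).

Definition mxs c x : cmx := map_mx (fun a : T => c *: a) x.

Lemma mxsA c d x : mxs c (mxs d x) = mxs (c * d) x.
Proof. by apply/matrixP => i j; rewrite !mxE scalerA. Qed.
Lemma mxs1 : left_id 1 mxs.
Proof. by move=> x; apply/matrixP => i j; rewrite !mxE scale1r. Qed.
Lemma mxsDr : right_distributive mxs +%R.
Proof. by move=> c x y; apply/matrixP => i j; rewrite !mxE scalerDr. Qed.
Lemma mxsDl x : {morph mxs^~ x : c d / c + d}.
Proof. by move=> c d; apply/matrixP => i j; rewrite !mxE scalerDl. Qed.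

HB.instance Definition _ := GRing.Zmodule_isLmodule.Build R cmx mxsA mxs1 mxsDr mxsDl.

Lemma mxsAl c x y : c *: (x * y) = (c *: x) * y.
Proof.
apply/matrixP => i j; rewrite !mxE scaler_sumr; apply: eq_bigr => l _.
by rewrite mxE scalerAl.
Qed.
Lemma mxsAr c x y : c *: (x * y) = x * (c *: y).
Proof.
apply/matrixP => i j; rewrite !mxE scaler_sumr; apply: eq_bigr => l _.
by rewrite mxE scalerAr.
Qed.

HB.instance Definition _ := GRing.Lmodule_isLalgebra.Build R cmx mxsAl.
HB.instance Definition _ := GRing.Lalgebra_isAlgebra.Build R cmx mxsAr.

Definition mxstar x : cmx := \matrix_(i, j) star (x j i).
Definition mxii : cmx := (ii : T)%:M.
Definition mxact x (v : 'I_k.+1 -> T) : 'I_k.+1 -> T := fun i => \sum_j x i j * v j.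
Definition mxnrm x : R := opnorm vnorm (mxact x).

Lemma mxstarK : involutive mxstar.
Proof. by move=> x; apply/matrixP => i j; rewrite !mxE starK. Qed.
Lemma mxstarD : {morph mxstar : x y / x + y}.
Proof. by move=> x y; apply/matrixP => i j; rewrite !mxE starD. Qed.
Lemma mxstarZ c x : mxstar (c *: x) = c *: mxstar x.
Proof. by apply/matrixP => i j; rewrite !mxE starZ. Qed.
Lemma mxstarM x y : mxstar (x * y) = mxstar y * mxstar x.
Proof.
apply/matrixP => i j; rewrite !mxE star_sum; apply: eq_bigr => l _.
by rewrite !mxE starM.
Qed.

Lemma mxiiC x : mxii * x = x * mxii.
Proof.
apply/matrixP => i j; rewrite !mxE (bigD1 i) //= big1 => [|l li]; last first.
  by rewrite mxE eq_sym (negbTE li) mul0r.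
rewrite (bigD1 j) //= big1 => [|l lj]; last by rewrite mxE (negbTE lj) mulr0.
by rewrite !mxE !eqxx !mulr1n !addr0 iiC.
Qed.

Lemma mxii2 : mxii * mxii = -1.
Proof. by rewrite -[LHS]scalar_mxM ii2 raddfN. Qed.

Lemma mxstar_ii : mxstar mxii = - mxii.
Proof.
apply/matrixP => i j; rewrite !mxE eq_sym.
by case: eqP => _; rewrite ?mulr1n ?mulr0n ?star_ii // star0 oppr0.
Qed.

Lemma mxactD x y v i : mxact (x + y) v i = mxact x v i + mxact y v i.
Proof.
by rewrite /mxact -big_split; apply: eq_bigr => j _; rewrite !mxE mulrDl.
Qed.

Lemma mxactM x y v : mxact (x * y) v = mxact x (mxact y v).
Proof.
apply/funext => i; rewrite /mxact.
under eq_bigr do rewrite mxE mulr_suml.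
rewrite exchange_big; apply: eq_bigr => j _; rewrite mulr_sumr.
by apply: eq_bigr => l _; rewrite mulrA.
Qed.

Lemma mxact_adj x u v : ip (mxact x u) v = ip u (mxact (mxstar x) v).
Proof.
rewrite /ip /mxact.
under eq_bigr do rewrite star_sum mulr_suml.
rewrite exchange_big; apply: eq_bigr => j _; rewrite mulr_sumr.
by apply: eq_bigr => l _; rewrite mxE starM mulrA.
Qed.

Definition entry_sum x : R := \sum_i \sum_j nrm (x i j).

Lemma entry_sum_ge0 x : 0 <= entry_sum x.
Proof. by apply: sumr_ge0 => i _; apply: sumr_ge0 => j _; exact: nrm_ge0. Qed.

Lemma mxact_le x v : vnorm (mxact x v) <= entry_sum x * vnorm v.
Proof.
apply: le_trans (vnorm_le_sum _) _; rewrite mulr_suml; apply: ler_sum => i _.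
apply: le_trans (nrm_sum _ _ _) _; rewrite mulr_suml; apply: ler_sum => j _.
apply: le_trans (nrmM _ _) _; apply: ler_wpM2l; first exact: nrm_ge0.
exact: vnorm_entry.
Qed.

Lemma mxact_bounded x : bounded_op vnorm (mxact x).
Proof. by exists (entry_sum x); split; [exact: entry_sum_ge0 | exact: mxact_le]. Qed.

Lemma vnorm_mxactD x y v : vnorm (mxact (x + y) v) <= vnorm (mxact x v) + vnorm (mxact y v).
Proof. by rewrite (funext (mxactD x y v)) vnormD. Qed.

Lemma vnorm_mxactZ c x v : vnorm (mxact (c *: x) v) = `|c| * vnorm (mxact x v).
Proof.
rewrite -vnormZ; congr vnorm; apply/funext => i; rewrite /mxact scaler_sumr.
by apply: eq_bigr => j _; rewrite mxE scalerAl.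
Qed.

Lemma mxact_CS x v : vnorm (mxact x v) ^+ 2 <= vnorm v * vnorm (mxact (mxstar x * x) v).
Proof. by rewrite sqr_vnorm mxact_adj -mxactM nrm_ip. Qed.

Lemma mxnrm_le_entries x : mxnrm x <= entry_sum x.
Proof. by apply: opnorm_min; [exact: entry_sum_ge0 | exact: mxact_le]. Qed.

Lemma mxnrm_entry x i j : nrm (x i j) <= mxnrm x.
Proof.
pose v := fun l : 'I_k.+1 => (l == j)%:R : T.
have v1 : vnorm v <= 1.
  rewrite -(ler_pXn2r (n := 2)) ?nnegrE ?vnorm_ge0 // sqr_vnorm expr1n.
  rewrite /ip (bigD1 j) //= big1 => [|l lj]; rewrite /v.
    by rewrite eqxx star1 mulr1 addr0 nrm1_le.
  by rewrite (negbTE lj) mulr0.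
have h := opnorm_le vnorm_ge0 v (mxact_bounded x).
have n0 : 0 <= mxnrm x by apply/opnorm_ge0/mxact_bounded.
have -> : x i j = mxact x v i.
  rewrite /mxact (bigD1 j) //= big1 => [|l lj]; rewrite /v ?eqxx ?mulr1 ?addr0 //.
  by rewrite (negbTE lj) mulr0.
apply: le_trans (vnorm_entry _ _) _; apply: le_trans h _.
by rewrite -[leRHS]mulr1; apply: ler_wpM2l.
Qed.

Lemma mxnrm_faithful x : mxnrm x = 0 -> x = 0.
Proof.
move=> x0; apply/matrixP => i j; rewrite mxE; apply: nrm0_eq0; apply/le_anti.
by rewrite nrm_ge0 -x0 mxnrm_entry.
Qed.

Lemma null_sum (I : Type) (s : seq I) (f : I -> nat -> R) :
  (forall i e, 0 < e -> exists N, forall n, (N <= n)%N -> f i n <= e) ->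
  forall e, 0 < e -> exists N, forall n, (N <= n)%N -> \sum_(i <- s) f i n <= e.
Proof.
move=> fi; elim: s => [|i s IH] e e0; first by exists 0 => n _; rewrite big_nil ltW.
have e2 : 0 < e / 2 by rewrite divr_gt0.
have [N hN] := fi i _ e2; have [M hM] := IH _ e2.
exists (maxn N M) => n; rewrite geq_max big_cons => /andP[Nn Mn].
by have := hN n Nn; have := hM n Mn; lra.
Qed.

Lemma mxnrm_complete (u : nat -> cmx) :
  (forall e, 0 < e -> exists N, forall m n, (N <= m)%N -> (N <= n)%N ->
      mxnrm (u m - u n) <= e) ->
  exists l, forall e, 0 < e -> exists N, forall n, (N <= n)%N -> mxnrm (u n - l) <= e.
Proof.
move=> uC.
have lim_ij i j : exists l, tends (fun n => u n i j) l.
  apply: nrm_complete => e e0; have [N hN] := uC e e0; exists N => m n Nm Nn.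
  apply: le_trans (hN m n Nm Nn).
  by have := mxnrm_entry (u m - u n) i j; rewrite !mxE.
have [L hL] : {L : 'I_k.+1 -> 'I_k.+1 -> T | forall i j, tends (fun n => u n i j) (L i j)}.
  exists (fun i j => projT1 (cid (lim_ij i j))) => i j.
  exact: projT2 (cid (lim_ij i j)).
exists (\matrix_(i, j) L i j).
have null_ij : forall e, 0 < e -> exists N, forall n, (N <= n)%N ->
    \sum_i \sum_j nrm (u n i j - L i j) <= e.
  by do 2!(apply: null_sum => ?); exact: hL.
move=> e /null_ij[N hN]; exists N => n /hN.
apply: le_trans; apply: le_trans (mxnrm_le_entries _) _.
by apply: ler_sum => i _; apply: ler_sum => j _; rewrite !mxE.
Qed.

HB.instance Definition _ := Algebra_isUCStar.Build R cmx
  mxiiC mxii2 mxstar_ii mxstarK mxstarD mxstarZ mxstarM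
  (opnormD vnorm_ge0 mxact_bounded vnorm_mxactD)
  (opnormZ vnorm_ge0 mxact_bounded vnorm_mxactZ)
  (opnormM vnorm_ge0 mxact_bounded mxactM)
  (opnorm_starM vnorm_ge0 mxact_bounded mxactM mxstarK mxact_CS)
  mxnrm_faithful mxnrm_complete.

Lemma nrm_entry x i j : nrm (x i j) <= nrm x.
Proof. exact: mxnrm_entry. Qed.

Lemma cmx_star x i j : star x i j = star (x j i).
Proof. by rewrite /star /= mxE. Qed.

Lemma cmx_mul x y i j : (x * y) i j = \sum_l x i l * y l j.
Proof. by rewrite mxE. Qed.

End MatrixAlgebra.

(** * Positivity in subalgebras and matrix positivity *)

Section SubalgebraPositivity.
Context {R : realType} {A : cstarAlgType R}.
Implicit Types (a b : A) (B : cstarSubalg A).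

(* [scalerA] for scalars and vectors whose structures are inferred differently. *)
Lemma cscaleA (c d : R[i]) a : c *: (d *: a) = (c * d) *: a.
Proof. exact: scalerA. Qed.

Lemma subalgB B a b : subalg_set B a -> subalg_set B b -> subalg_set B (a - b).
Proof.
by move=> Ba Bb; apply: subalgD => //; rewrite -scaleN1r; apply: subalgZ.
Qed.

Lemma subalg_seq_lim B (u : nat -> A) a : (forall n, subalg_set B (u n)) ->
  (forall e, 0 < e -> exists N, forall n, (N <= n)%N -> rnorm (u n - a) <= e) ->
  subalg_set B a.
Proof.
move=> uB ua; apply: (@closed_cvg _ _ \oo%classic eventually_filter u (subalg_set B)).
- exact: Defs.subalg_closed.
- exact: nearW.
apply/cvgrPdist_le => e e0.
have eR : (complex.Re e)%:C%C = e by rewrite RRe_real // gtr0_real.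
have [|N hN] := ua (complex.Re e); first by rewrite -ltcR eR.
by exists N => // n /= Nn; rewrite distrC rnormE -eR lecR hN.
Qed.

Definition usub B (x : unitz A) : Prop := exists2 b, subalg_set B b & x = uinj b.

Lemma usub_closed B : closed_subalg (usub B).
Proof.
split=> [_ _ [a Ba ->] [b Bb ->]|c _ [a Ba ->]|_ _ [a Ba ->] [b Bb ->]|u x uB ux].
- by exists (a + b); [exact: subalgD | rewrite uinjD].
- by exists (c%:C%C *: a); [exact: subalgZ | rewrite uinjZ].
- by exists (cmul a b); [exact: subalgM | rewrite uinjM].
have u2 n : (u n).2 = 0 by have [b _ ->] := uB n.
have x2 : x.2 = 0.
  apply: rnorm_eq0; apply/le_anti; rewrite rnorm_ge0 andbT.
  apply/ler_addgt0Pl => e e0; rewrite addr0.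
  have [N /(_ N (leqnn N)) hN] := ux e e0; apply: le_trans hN.
  apply: le_trans (unrm_scal_le (u N - x)) => /=.
  by rewrite u2 sub0r /rnorm normrN.
have xE : x = uinj x.1 by move: x2; case: (x) => a c /= ->.
exists x.1 => //; apply: (@subalg_seq_lim B (fun n => (u n).1)) => [n|e e0].
  by have [b Bb ->] := uB n.
have [N hN] := ux e e0; exists N => n /hN; apply: le_trans.
rewrite -uinj_nrm uinjB -xE; suff -> : uinj (u n).1 = u n by [].
by have [b _ ->] := uB n.
Qed.

(** Lets the statements on roots inside a subalgebra be applied to A itself. *)
Definition full_subalg : cstarSubalg A :=
  @CStarSubalg R A setT closedT I (fun _ _ _ _ => I) (fun _ _ _ => I)
    (fun _ _ _ _ => I) (fun _ _ => I).

Lemma pos_uinj_root B b : subalg_set B b -> pos (uinj b) ->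
  exists2 s, subalg_set B s & cstar s = s /\ b = cmul s s.
Proof.
move=> Bb pb; have [s Bs sE] : usub B (sqrtp (uinj b)).
  by apply: sqrtp_closed => //; [exact: usub_closed | exists b].
exists s => //; split; apply: uinj_injective.
  by rewrite uinj_star -sE sqrtp_star.
by rewrite uinjM -sE sqrtp_sqr.
Qed.

Lemma positiveP a : positive a <-> pos (uinj a).
Proof.
split=> [[x ->]|pa]; first by rewrite uinjM uinj_star; exact: pos_starM.
by have [s _ [hs ->]] := pos_uinj_root (B := full_subalg) I pa; exists s; rewrite hs.
Qed.

Lemma subalg_jordan B b : subalg_set B b -> cstar b = b ->
  exists p q, [/\ subalg_set B p, subalg_set B q, pos (uinj p), pos (uinj q) & b = p - q].
Proof.
move=> Bb hb; have ub : usub B (uinj b) by exists b.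
have hu : star (uinj b) = uinj b by rewrite -uinj_star hb.
have [p Bp pE] := jpos_closed (usub_closed B) hu ub.
have [q Bq qE] := jneg_closed (usub_closed B) hu ub.
exists p, q; split=> //.
- by rewrite -pE; exact: jpos_pos.
- by rewrite -qE; exact: jneg_pos.
by apply: uinj_injective; rewrite uinjB -pE -qE -jposE.
Qed.

Lemma subalg_four_pos B b : subalg_set B b ->
  exists p q r s, [/\ subalg_set B p, subalg_set B q, subalg_set B r & subalg_set B s] /\
    [/\ pos (uinj p), pos (uinj q), pos (uinj r) & pos (uinj s)] /\
    b = p - q + ('i : R[i]) *: (r - s).
Proof.
move=> Bb; have Bs := subalg_star Bb.
have half : (2^-1 : R[i])^* = 2^-1 by rewrite conj_Creal // realV realn.
have hN x : cstar (- x) = - cstar x :> A.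
  by rewrite -scaleN1r cstarZ rmorphN rmorph1 scaleN1r.
have [||p [q [Bp Bq pp pq e1]]] := @subalg_jordan B (2^-1 *: (b + cstar b)).
- by apply: subalgZ; apply: subalgD.
- by rewrite cstarZ half cstarD cstarK addrC.
have [||r [s [Br Bs' pr ps e2]]] := @subalg_jordan B ((2^-1 * - 'i) *: (b - cstar b)).
- by apply: subalgZ; apply: subalgB.
- rewrite cstarZ rmorphM rmorphN /= half conjCi opprK cstarD hN // cstarK.
  by rewrite -[in RHS]opprB mulrN scaleNr scalerN opprK.
exists p, q, r, s; do 2!split => //; rewrite -e1 -e2 cscaleA.
have -> : 'i * (2^-1 * - 'i) = 2^-1 :> R[i].
  by rewrite mulrCA mulrN -expr2 sqrCi opprK mulr1.
rewrite -scalerDr addrACA subrr addr0.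
have -> : b + b = (2 : R[i]) *: b by rewrite scaler_nat mulr2n.
by rewrite cscaleA mulVf ?pnatr_eq0 // scale1r.
Qed.

End SubalgebraPositivity.

Section MatrixPositivity.
Context {R : realType}.

Definition umx {A : cstarAlgType R} {k} (M : 'M[A]_k.+1) : cmx (unitz A) k :=
  map_mx (@uinj R A) M.

Section OneAlgebra.
Variables (A : cstarAlgType R) (k : nat).
Implicit Types (M : 'M[A]_k.+1) (B : cstarSubalg A).

Lemma umx_inj M N : umx M = umx N -> M = N.
Proof. by move=> /matrixP h; apply/matrixP => i j; have := h i j; rewrite !mxE => /uinj_injective. Qed.

Lemma umxD M N : umx (M + N) = umx M + umx N.
Proof. by apply/matrixP => i j; rewrite !mxE uinjD. Qed.

Lemma pos_rank1 (r : 'I_k.+1 -> A) :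
  pos (umx (\matrix_(i, j) cmul (cstar (r i)) (r j))).
Proof.
(* The row r is padded with zero rows to a square matrix, so that the Gram matrix is star Y * Y
   inside one algebra. *)
pose Y : cmx (unitz A) k := \matrix_(l, j) (if l == 0 then uinj (r j) else 0).
have -> : umx (\matrix_(i, j) cmul (cstar (r i)) (r j)) = star Y * Y.
  apply/matrixP => i j; rewrite cmx_mul (bigD1 0) //= big1 => [|l l0]; last first.
    by rewrite cmx_star !mxE (negbTE l0) mulr0.
  by rewrite cmx_star !mxE eqxx addr0 uinjM uinj_star.
exact: pos_starM.
Qed.

Lemma pos_gram m (X : 'M[A]_(m, k.+1)) :
  pos (umx (\matrix_(i, j) \sum_l cmul (cstar (X l i)) (X l j))).
Proof.
have -> : umx (\matrix_(i, j) \sum_l cmul (cstar (X l i)) (X l j)) =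
    \sum_l umx (\matrix_(i, j) cmul (cstar (X l i)) (X l j)).
  apply/matrixP => i j; rewrite [LHS]mxE mxE uinj_sum summxE.
  by apply: eq_bigr => l _; rewrite !mxE.
by apply: pos_sum => l _; exact: (pos_rank1 (X l)).
Qed.

Definition msub B (x : cmx (unitz A) k) : Prop :=
  exists2 M : 'M[A]_k.+1, (forall i j, subalg_set B (M i j)) & x = umx M.

Lemma msubP B x : msub B x <-> forall i j, usub B (x i j).
Proof.
split=> [[M BM ->] i j|h]; first by exists (M i j); rewrite ?mxE.
exists (\matrix_(i, j) (x i j).1) => [i j|].
  by rewrite mxE; have [b Bb ->] := h i j.
by apply/matrixP => i j; rewrite !mxE; have [b Bb ->] := h i j.
Qed.

Lemma msub_closed B : closed_subalg (msub B).
Proof.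
have cB := usub_closed B.
have B0 : usub B 0 by exists 0; [exact: subalg0 | rewrite uinj0].
split=> [x y /msubP hx /msubP hy|c x /msubP hx|x y /msubP hx /msubP hy|u x hu ux];
  apply/msubP => i j.
- by rewrite mxE; apply: csubD.
- by rewrite mxE; apply: csubZ.
- rewrite cmx_mul; elim/big_rec: _ => [//|l z _ hz].
  by apply: csubD => //; apply: csubM.
apply: (csub_lim cB (u := fun n => u n i j)) => [n|e /ux[N hN]].
  by have /msubP := hu n.
exists N => n /hN; apply: le_trans.
by have := nrm_entry (u n - x) i j; rewrite !mxE.
Qed.

(** The root of a matrix over B has entries in B, so positivity of such a matrix does not depend on
    whether it is tested over B or over A. *)
Lemma pos_umx_root B M : (forall i j, subalg_set B (M i j)) -> pos (umx M) ->
  exists2 X : 'M[A]_k.+1, (forall i j, subalg_set B (X i j)) &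
    M = \matrix_(i, j) \sum_l cmul (cstar (X l i)) (X l j).
Proof.
move=> BM pM; have [X BX XE] : msub B (sqrtp (umx M)).
  by apply: sqrtp_closed => //; [exact: msub_closed | exists M].
exists X => //; apply: umx_inj; rewrite -{1}(sqrtp_sqr pM) -{1}(sqrtp_star pM) XE.
apply/matrixP => i j; rewrite cmx_mul [RHS]mxE mxE uinj_sum.
by apply: eq_bigr => l _; rewrite cmx_star !mxE uinjM uinj_star.
Qed.

Lemma positive_mxP M : positive_mx M <-> pos (umx M).
Proof.
split=> [[X ->]|pM]; first exact: pos_gram.
by have [X _ ->] := pos_umx_root (B := full_subalg) (fun _ _ => I) pM; exists X.
Qed.

End OneAlgebra.

(** The algebras [cmx] have size k + 1, since a unital ring has 1 != 0; the empty matrix has to be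
    treated apart. *)
Lemma positive_mx0 (A : cstarAlgType R) (M : 'M[A]_0) : positive_mx M.
Proof. by exists M; apply/matrixP => -[]. Qed.

Lemma positive_mxD (A : cstarAlgType R) k (M N : 'M[A]_k) :
  positive_mx M -> positive_mx N -> positive_mx (M + N).
Proof.
case: k M N => [|k] M N; first by move=> _ _; exact: positive_mx0.
by move=> /positive_mxP pM /positive_mxP pN; apply/positive_mxP; rewrite umxD; exact: posD.
Qed.

Lemma positive_mxZ (A : cstarAlgType R) k (c : R) (M : 'M[A]_k) :
  0 <= c -> positive_mx M -> positive_mx (map_mx (fun a => c%:C%C *: a) M).
Proof.
case: k M => [|k] M c0; first by move=> _; exact: positive_mx0.
move=> /positive_mxP pM; apply/positive_mxP.
rewrite (_ : umx _ = c *: umx M); first exact: posZ.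
by apply/matrixP => i j; rewrite !mxE uinjZ.
Qed.

Lemma positive_mx_sub (A : cstarAlgType R) (B : cstarSubalg A) k
    (M : 'M[subalg_type B]_k) :
  positive_mx (map_mx val M) -> positive_mx M.
Proof.
case: k M => [|k] M; first by move=> _; exact: positive_mx0.
move=> /positive_mxP pM; have [|X BX XE] := pos_umx_root (B := B) _ pM.
  by move=> i j; rewrite mxE; exact: subalgP.
exists (\matrix_(i, j) SubalgType (introT (subalg_predP _ _) (BX i j))).
apply/matrixP => i j; apply: val_inj.
have /matrixP/(_ i j) := XE; rewrite !mxE => ->.
by rewrite raddf_sum; apply: eq_bigr => l _; rewrite !mxE.
Qed.

Lemma positive_mx_val (A : cstarAlgType R) (B : cstarSubalg A) k
    (M : 'M[subalg_type B]_k) :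
  positive_mx M -> positive_mx (map_mx val M).
Proof.
case=> X ->; exists (map_mx val X); apply/matrixP => i j; rewrite !mxE raddf_sum.
by apply: eq_bigr => l _; rewrite !mxE.
Qed.

End MatrixPositivity.

(** * Completely positive maps *)

Section CompletelyPositive.
Context {R : realType} {F A : cstarAlgType R} (phi : {linear F -> A}).
Hypothesis phi_cp : completely_positive phi.
Implicit Types (x y e : F) (c : A).

Lemma cp_positive x : pos (uinj x) -> pos (uinj (phi x)).
Proof.
move=> /positiveP[z ->]; apply/positiveP.
have [|Y YE] := phi_cp (M := \matrix_(i < 1, j < 1) cmul (cstar z) z).
  by exists (const_mx z); apply/matrixP => i j; rewrite !mxE big_ord1 !mxE.
exists (Y ord0 ord0); have /matrixP/(_ ord0 ord0) := YE.
by rewrite !mxE big_ord1.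
Qed.

(** Positivity of the image of the Gram matrix of (x, y), a substitute for the Stinespring
    representation: the values of phi become inner products of Y0 and Y1. *)
Lemma cp_gram2 x y : exists Y0 Y1 : 'I_2 -> A,
  [/\ phi (cmul (cstar x) x) = \sum_l cmul (cstar (Y0 l)) (Y0 l),
      phi (cmul (cstar x) y) = \sum_l cmul (cstar (Y0 l)) (Y1 l),
      phi (cmul (cstar y) x) = \sum_l cmul (cstar (Y1 l)) (Y0 l) &
      phi (cmul (cstar y) y) = \sum_l cmul (cstar (Y1 l)) (Y1 l)].
Proof.
pose v (i : 'I_2) := if i == 0 then x else y.
have [|Y YE] := phi_cp (M := \matrix_(i < 2, j < 2) cmul (cstar (v i)) (v j)).
  exists (\matrix_(l, j) if l == 0 then v j else 0); apply/matrixP => i j.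
  by rewrite !mxE big_ord_recl big_ord1 !mxE /= cmul0r addr0.
have E i j : phi (cmul (cstar (v i)) (v j)) = \sum_l cmul (cstar (Y l i)) (Y l j).
  by have /matrixP/(_ i j) := YE; rewrite !mxE.
exists (Y^~ 0), (Y^~ 1); split.
- exact: (E 0 0).
- exact: (E 0 1).
- exact: (E 1 0).
- exact: (E 1 1).
Qed.

(** Write phi(x* x) as the sum of the Y0* Y0. Then the positive elements (Y0 c)* (Y0 c) sum to 0, so
    every Y0 c is 0, while phi(y x) c is a sum of terms ending in Y0 c. *)
Lemma cp_kill x y c : cmul (phi (cmul (cstar x) x)) c = 0 -> cmul (phi (cmul y x)) c = 0.
Proof.
have [Y0 [Y1 [e00 _ e10 _]]] := cp_gram2 x (cstar y).
rewrite cstarK in e10; rewrite e00 e10 => h.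
have Y0c l : cmul (Y0 l) c = 0.
  apply: (@uinj_injective R A); rewrite uinj0 uinjM; apply: starM_eq0.
  have pl k : pos (star (uinj (Y0 k) * uinj c) * (uinj (Y0 k) * uinj c)) by exact: pos_starM.
  have sum0 : \sum_k star (uinj (Y0 k) * uinj c) * (uinj (Y0 k) * uinj c) = 0.
    have -> : \sum_k star (uinj (Y0 k) * uinj c) * (uinj (Y0 k) * uinj c)
      = star (uinj c) * uinj (cmul (\sum_l cmul (cstar (Y0 l)) (Y0 l)) c).
      rewrite uinjM uinj_sum mulr_suml mulr_sumr; apply: eq_bigr => k _.
      by rewrite starM uinjM uinj_star !mulrA.
    by rewrite h uinj0 mulr0.
  apply: pos_anti => //; rewrite -sub0r -sum0 (bigD1 l) //= addrAC subrr add0r.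
  exact: pos_sum.
apply: (@uinj_injective R A); rewrite uinj0 uinjM uinj_sum mulr_suml big1 // => l _.
by rewrite uinjM -mulrA -uinjM Y0c uinj0 mulr0.
Qed.

Section Unital.
Variables (e : F) (eL : forall x, cmul e x = x) (eR : forall x, cmul x e = x).
Hypothesis e_star : cstar e = e.

Lemma cp_star x : phi (cstar x) = cstar (phi x).
Proof.
have [Y0 [Y1 [_ e01 e10 _]]] := cp_gram2 x e.
rewrite eR in e01; rewrite e_star eL in e10; rewrite e01 e10.
apply: (@uinj_injective R A); rewrite uinj_star !uinj_sum star_sum.
by apply: eq_bigr => l _; rewrite !uinjM starM !uinj_star starK.
Qed.

(** Cauchy-Schwarz gives |phi(x)|^2 <= |phi(e)| |phi(x* x)|, and x* x <= |x|^2 e. Contractivity is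
    thereby tested on the unit only. *)
Lemma cp_nrm x : rnorm (phi x) <= rnorm (phi e) * rnorm x.
Proof.
have [Y0 [Y1 [e00 e01 _ e11]]] := cp_gram2 e x.
rewrite e_star eL in e00; rewrite e_star eL in e01.
have ipE (Y Z : 'I_2 -> A) : uinj (\sum_l cmul (cstar (Y l)) (Z l)) =
    ip (fun l => uinj (Y l)) (fun l => uinj (Z l)).
  by rewrite uinj_sum; apply: eq_bigr => l _; rewrite uinjM uinj_star.
have hCS := nrm_ip (fun l => uinj (Y0 l)) (fun l => uinj (Y1 l)).
have xx : pos (uinj ((rnorm x ^+ 2)%:C%C *: e - cmul (cstar x) x)).
  have h : pos ((rnorm x ^+ 2)%:A - uinj (cmul (cstar x) x)).
    apply: pos_nrm_scal; first by apply/positiveP; exists x.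
    by rewrite uinj_nrm rnorm_cstarM.
  have he : star (uinj e) = uinj e by rewrite -uinj_star e_star.
  have := pos_conj_sa he h; congr pos.
  rewrite mulrBr mulrBl -scalerAr mulr1 -scalerAl -!uinjM eL eL eR.
  by rewrite uinjB uinjZ.
have le1 : nrm (uinj (phi (cmul (cstar x) x))) <= rnorm x ^+ 2 * rnorm (phi e).
  apply: le_trans (nrm_mono (b := uinj (phi ((rnorm x ^+ 2)%:C%C *: e))) _ _) _.
  - by apply: cp_positive; apply/positiveP; exists x.
  - by rewrite -uinjB -linearB; exact: cp_positive.
  by rewrite linearZ /= uinjZ nrmZ uinj_nrm ger0_norm ?sqr_ge0.
rewrite -(ler_pXn2r (n := 2)) ?nnegrE ?mulr_ge0 ?rnorm_ge0 //.
have h2 : rnorm (phi x) ^+ 2 <= nrm (uinj (phi e)) * nrm (uinj (phi (cmul (cstar x) x))).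
  rewrite e00 e11 !ipE -!sqr_vnorm -exprMn -uinj_nrm e01 ipE.
  by rewrite ler_pXn2r ?nnegrE ?nrm_ge0 ?mulr_ge0 ?vnorm_ge0.
apply: le_trans h2 _; rewrite uinj_nrm exprMn [rnorm (phi e) ^+ 2]expr2 -mulrA.
by apply: ler_wpM2l; rewrite ?rnorm_ge0 // mulrC.
Qed.

End Unital.

End CompletelyPositive.

(** * Finite-dimensional algebras *)

HB.lock Definition adjm (C : numClosedFieldType) (m n : nat) (M : 'M[C]_(m, n)) :
  'M[C]_(n, m) := map_mx Num.conj M^T.
Arguments adjm {C m n} M.

Section HermitianMatrices.
Context {C : numClosedFieldType}.

Lemma adjmE m n (M : 'M[C]_(m, n)) : adjm M = map_mx Num.conj M^T.
Proof. by rewrite adjm.unlock. Qed.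

Lemma adjm0 m n : adjm (0 : 'M[C]_(m, n)) = 0.
Proof. by rewrite adjmE trmx0 map_mx0. Qed.

Lemma adjm1 n : adjm (1%:M : 'M[C]_n) = 1%:M.
Proof. by rewrite adjmE trmx1 map_mx1. Qed.

Lemma adjmK m n (M : 'M[C]_(m, n)) : adjm (adjm M) = M.
Proof. by rewrite !adjmE; apply/matrixP => i j; rewrite !mxE conjCK. Qed.

Lemma adjmM m n p (M : 'M[C]_(m, n)) (N : 'M[C]_(n, p)) :
  adjm (M *m N) = adjm N *m adjm M.
Proof. by rewrite !adjmE trmx_mul map_mxM. Qed.

Lemma adjmD m n (M N : 'M[C]_(m, n)) : adjm (M + N) = adjm M + adjm N.
Proof. by rewrite !adjmE; apply/matrixP => i j; rewrite !mxE rmorphD. Qed.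

Lemma adjmZ m n c (M : 'M[C]_(m, n)) : adjm (c *: M) = c^* *: adjm M.
Proof. by rewrite !adjmE; apply/matrixP => i j; rewrite !mxE rmorphM. Qed.

Lemma adjm_delta n (k : 'I_n) : adjm (delta_mx k k) = delta_mx k k :> 'M[C]_n.
Proof. by rewrite adjmE; apply/matrixP => i j; rewrite !mxE andbC rmorph_nat. Qed.

Lemma hermitian_spectral n (H : 'M[C]_n) : adjm H = H ->
  exists (U : 'M[C]_n) (D : 'rV[C]_n), [/\ U *m adjm U = 1%:M, adjm U *m U = 1%:M &
                  H = adjm U *m diag_mx D *m U].
Proof.
move=> hH; exists (spectralmx H), (spectral_diag H).
have UU : spectralmx H *m adjm (spectralmx H) = 1%:M.
  by rewrite adjmE; exact/unitarymxP/spectral_unitarymx.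
split=> //; first exact: mulmx1C.
have nH : H \is normalmx by apply/normalmxP; rewrite -adjmE hH.
have /orthomx_spectralP := nH.
by rewrite invmx_unitary ?spectral_unitarymx // -adjmE.
Qed.

Lemma delta_compress n (k : 'I_n) (M : 'M[C]_n) :
  delta_mx k k *m M *m delta_mx k k = M k k *: delta_mx k k.
Proof.
have E : delta_mx k k = delta_mx k (0 : 'I_1) *m delta_mx (0 : 'I_1) k :> 'M[C]_n.
  by rewrite mul_delta_mx.
rewrite {1 2}E -!mulmxA [delta_mx 0 k *m (M *m _)]mulmxA [_ *m M *m _]mulmxA.
have -> : delta_mx (0 : 'I_1) k *m M *m delta_mx k (0 : 'I_1) = (M k k)%:M.
  by apply/matrixP => i j; rewrite !ord1 -rowE -colE !mxE eqxx.
by rewrite mul_scalar_mx -scalemxAr -E.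
Qed.

Lemma diag_mx_sum_delta n (D : 'rV[C]_n) : diag_mx D = \sum_k D 0 k *: delta_mx k k.
Proof.
apply/matrixP => i j; rewrite summxE (bigD1 i) //= big1 => [|k ki]; last first.
  by rewrite !mxE eq_sym (negbTE ki) mulr0.
rewrite !mxE eqxx addr0 /= eq_sym.
by case: eqP => _; rewrite ?mulr1 ?mulr0.
Qed.

End HermitianMatrices.

Section CmulSums.
Context {R : realType} {A : cstarAlgType R}.

Lemma cmul_suml (I : Type) (t : seq I) (P : pred I) (G : I -> A) x :
  cmul (\sum_(l <- t | P l) G l) x = \sum_(l <- t | P l) cmul (G l) x.
Proof. by elim/big_rec2: _ => [|l u v _ <-]; rewrite ?cmul0l // cmulDl. Qed.

Lemma cmul_sumr (I : Type) (t : seq I) (P : pred I) (G : I -> A) x :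
  cmul x (\sum_(l <- t | P l) G l) = \sum_(l <- t | P l) cmul x (G l).
Proof. by elim/big_rec2: _ => [|l u v _ <-]; rewrite ?cmul0r // cmulDr. Qed.

End CmulSums.

Section MatrixDecomposition.
Context {R : realType} {F : cstarAlgType R} {s : nat} {r : 'I_s -> nat}.
Context { pi : F -> forall i : 'I_s, 'M[R[i]]_(r i)}.
Hypothesis dec : matrix_decomposition pi.
Implicit Types (x y z w : F) (f g : forall i : 'I_s, 'M[R[i]]_(r i)).

Lemma dec_inverse : {q : (forall i : 'I_s, 'M[R[i]]_(r i)) -> F |
  cancel pi q /\ cancel q pi}.
Proof. by apply: cid; case: (mxdec_bij dec) => q; exists q. Qed.

Definition mxpack : (forall i : 'I_s, 'M[R[i]]_(r i)) -> F := projT1 dec_inverse.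

Lemma mxpackE f i : pi (mxpack f) i = f i.
Proof. by have [_ ->] := projT2 dec_inverse. Qed.

Lemma pi_inj x y : (forall i, pi x i = pi y i) -> x = y.
Proof.
move=> h; have [piK _] := projT2 dec_inverse.
by rewrite -(piK x) -(piK y); congr (_ _); apply: functional_extensionality_dep.
Qed.

Lemma pi0 i : pi 0 i = 0.
Proof. by have := mxdecZ dec 0 0 i; rewrite !scale0r. Qed.

Lemma piN x i : pi (- x) i = - pi x i.
Proof. by rewrite -scaleN1r (mxdecZ dec) scaleN1r. Qed.

Lemma piB x y i : pi (x - y) i = pi x i - pi y i.
Proof. by rewrite (mxdecD dec) piN. Qed.

Lemma pi_sum (I : Type) (t : seq I) (P : pred I) (G : I -> F) i :
  pi (\sum_(k <- t | P k) G k) i = \sum_(k <- t | P k) pi (G k) i.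
Proof.
elim: t => [|k t IH]; first by rewrite !big_nil pi0.
by rewrite !big_cons; case: (P k) => //; rewrite (mxdecD dec) IH.
Qed.

Definition blk (i : 'I_s) (M : 'M[R[i]]_(r i)) (k : 'I_s) : 'M[R[i]]_(r k) :=
  match i =P k with
  | ReflectT e => eq_rect i (fun k => 'M[R[i]]_(r k)) M k e
  | _ => 0
  end.

Lemma blkE i (M : 'M[R[i]]_(r i)) : blk M i = M.
Proof. by rewrite /blk; case: eqP => // e; rewrite (eq_axiomK e). Qed.

Lemma blk_ne i (M : 'M[R[i]]_(r i)) k : k != i -> blk M k = 0.
Proof. by rewrite /blk eq_sym; case: eqP. Qed.

Definition eblk i (M : 'M[R[i]]_(r i)) : F := mxpack (blk M).

Lemma eblkE i (M : 'M[R[i]]_(r i)) : pi (eblk M) i = M.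
Proof. by rewrite mxpackE blkE. Qed.

Lemma eblk_ne i (M : 'M[R[i]]_(r i)) k : k != i -> pi (eblk M) k = 0.
Proof. by move=> ki; rewrite mxpackE blk_ne. Qed.

Lemma eblk0 i : eblk (0 : 'M[R[i]]_(r i)) = 0.
Proof.
apply: pi_inj => j; rewrite [RHS]pi0.
by have [->|ji] := eqVneq j i; rewrite ?eblkE ?eblk_ne.
Qed.

Lemma eblkD i (M N : 'M[R[i]]_(r i)) : eblk (M + N) = eblk M + eblk N.
Proof.
apply: pi_inj => j; rewrite [RHS](mxdecD dec).
by have [->|ji] := eqVneq j i; rewrite ?eblkE ?eblk_ne ?addr0.
Qed.

Lemma eblkZ i (c : R[i]) (M : 'M[R[i]]_(r i)) : eblk (c *: M) = c *: eblk M.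
Proof.
apply: pi_inj => j; rewrite [RHS](mxdecZ dec).
by have [->|ji] := eqVneq j i; rewrite ?eblkE ?eblk_ne ?scaler0.
Qed.

Lemma eblkM i (M N : 'M[R[i]]_(r i)) : cmul (eblk M) (eblk N) = eblk (M *m N).
Proof.
apply: pi_inj => j; rewrite [LHS](mxdecM dec).
by have [->|ji] := eqVneq j i; rewrite ?eblkE ?eblk_ne ?mulmx0.
Qed.

Lemma eblkM_ne i i' (M : 'M[R[i]]_(r i)) (N : 'M[R[i]]_(r i')) : i != i' ->
  cmul (eblk M) (eblk N) = 0.
Proof.
move=> ii; apply: pi_inj => j; rewrite [LHS](mxdecM dec) [RHS]pi0.
have [->|ji] := eqVneq j i; last by rewrite [X in X *m _]eblk_ne // mul0mx.
by rewrite [X in _ *m X]eblk_ne // mulmx0.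
Qed.

Lemma eblk_star i (M : 'M[R[i]]_(r i)) : cstar (eblk M) = eblk (adjm M).
Proof.
apply: pi_inj => j; rewrite [LHS](mxdec_star dec) -adjmE.
by have [->|ji] := eqVneq j i; rewrite ?eblkE ?eblk_ne ?adjm0.
Qed.

Lemma eblk_sum i (I : Type) (t : seq I) (Q : pred I) (G : I -> 'M[R[i]]_(r i)) :
  eblk (\sum_(k <- t | Q k) G k) = \sum_(k <- t | Q k) eblk (G k).
Proof. exact: (big_morph _ (@eblkD i) (eblk0 i)). Qed.

Definition central (P : pred 'I_s) : F :=
  mxpack (fun i => if P i then 1%:M else 0).

Lemma central_star P : cstar (central P) = central P.
Proof.
apply: pi_inj => i; rewrite (mxdec_star dec) !mxpackE; case: (P i).
  by rewrite trmx1 map_mx1.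
by rewrite trmx0 map_mx0.
Qed.

Lemma pi_central P x i : pi (cmul (central P) x) i = if P i then pi x i else 0.
Proof. by rewrite (mxdecM dec) mxpackE; case: (P i); rewrite ?mul1mx ?mul0mx. Qed.

Lemma centralC P x : cmul (central P) x = cmul x (central P).
Proof.
apply: pi_inj => i; rewrite pi_central (mxdecM dec) mxpackE.
by case: (P i); rewrite ?mulmx1 ?mulmx0.
Qed.

Lemma central_supp (P : pred 'I_s) x : (forall i, ~~ P i -> pi x i = 0) ->
  cmul (central P) x = x.
Proof.
by move=> h; apply: pi_inj => i; rewrite pi_central; case: ifPn => // /h ->.
Qed.

Lemma central1 x : cmul (central xpredT) x = x.
Proof. by apply: central_supp. Qed.

Lemma central_idem P : cmul (central P) (central P) = central P.
Proof. by apply: central_supp => i /negbTE Pi; rewrite mxpackE Pi. Qed.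

(** * Multiplicative identities of strict order zero maps *)

Section OrderZero.
Variables (A : cstarAlgType R) (phi : {linear F -> A}) (P : pred 'I_s).
Hypothesis phi_cp : completely_positive phi.
Let S : set F := [set x | forall i, ~~ P i -> pi x i = 0].
Hypothesis phi_oz : strict_order_zero_on S phi.

Let one := central P.

Let S_one x : S x -> cmul one x = x. Proof. exact: central_supp. Qed.
Let S_oner x : S x -> cmul x one = x.
Proof. by rewrite -centralC; exact: S_one. Qed.

Definition rank1 i (U : 'M[R[i]]_(r i)) (k : 'I_(r i)) : F :=
  eblk (adjm U *m delta_mx k k *m U).

(** A subprojection q satisfies q = E q E in the block, which is a multiple l E because E has rank
    one; q^2 = q leaves l = 0 or l = 1. *)
Lemma rank1_minimal i (U : 'M[R[i]]_(r i)) k : P i -> U *m adjm U = 1%:M ->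
  minimal_projection S (rank1 U k).
Proof.
move=> Pi UU; rewrite /rank1.
have [E EE] : {E | E = adjm U *m delta_mx k k *m U} by eexists.
rewrite -EE.
have Eidem : E *m E = E.
  rewrite EE -!mulmxA [U *m (adjm U *m _)]mulmxA UU mul1mx.
  by rewrite [delta_mx k k *m (delta_mx k k *m U)]mulmxA mul_delta_mx.
have EsE : adjm E = E by rewrite EE !adjmM adjmK adjm_delta mulmxA.
have E0 : E != 0.
  apply/eqP => h; have : U *m E *m adjm U = 0 by rewrite h mulmx0 mul0mx.
  rewrite EE !mulmxA UU mul1mx -mulmxA UU mulmx1 => /matrixP/(_ k k).
  by rewrite !mxE !eqxx => /eqP; rewrite oner_eq0.
split.
- move=> j Pj; apply: eblk_ne; by apply: contraNneq Pj => ->.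
- by split; rewrite ?eblk_star ?EsE // eblkM Eidem.
- by apply: contra_neq E0 => h; rewrite -(eblkE E) h pi0.
move=> q Sq [qs qq] eq.
have qE : pi q i = E *m pi q i by rewrite -{1}eq (mxdecM dec) eblkE.
have q_ne j : j != i -> pi q j = 0.
  by move=> ji; rewrite -eq (mxdecM dec) eblk_ne // mul0mx.
have qh : adjm (pi q i) = pi q i.
  by rewrite -[RHS](congr1 (fun x => pi x i) qs) (mxdec_star dec) adjmE.
have qE' : pi q i = pi q i *m E by rewrite -{1}qh {1}qE adjmM qh EsE.
have [l qlE] : exists l, pi q i = l *: E.
  exists ((U *m pi q i *m adjm U) k k).
  rewrite EE scalemxAl scalemxAr -delta_compress {1}qE {1}qE' EE.
  by rewrite !mulmxA.
have ll : l * l = l.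
  have : l *: E *m (l *: E) = l *: E by rewrite -qlE -(mxdecM dec) qq.
  rewrite -scalemxAl -scalemxAr Eidem scalerA => /eqP.
  rewrite -subr_eq0 -scalerBl scaler_eq0 (negbTE E0) orbF subr_eq0.
  by move/eqP.
have qeq : q = l *: eblk E.
  apply: pi_inj => j; rewrite [RHS](mxdecZ dec).
  by have [->|ji] := eqVneq j i; rewrite ?eblkE // eblk_ne // scaler0 q_ne.
have /eqP : l * (l - 1) = 0 by rewrite mulrBr mulr1 ll subrr.
rewrite mulf_eq0 subr_eq0 => /orP[]/eqP l01; [left|right].
  by rewrite qeq l01 scale0r.
by rewrite qeq l01 scale1r.
Qed.

Lemma rank1_orth i (U : 'M[R[i]]_(r i)) k l : U *m adjm U = 1%:M -> k != l ->
  cmul (rank1 U k) (rank1 U l) = 0.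
Proof.
move=> UU kl; rewrite eblkM -!mulmxA [U *m (adjm U *m _)]mulmxA UU mul1mx.
rewrite [delta_mx k k *m (_ *m U)]mulmxA mul_delta_mx_0 // mul0mx mulmx0.
exact: eblk0.
Qed.

Lemma rank1_orth_block i i' (U : 'M[R[i]]_(r i)) (V : 'M[R[i]]_(r i')) k l : i != i' ->
  cmul (rank1 U k) (rank1 V l) = 0.
Proof. exact: eblkM_ne. Qed.

Lemma sum_delta n : \sum_(k < n) delta_mx k k = 1%:M :> 'M[R[i]]_n.
Proof.
rewrite -diag_const_mx diag_mx_sum_delta; apply: eq_bigr => k _.
by rewrite mxE scale1r.
Qed.

Lemma sum_rank1 i (U : 'M[R[i]]_(r i)) : adjm U *m U = 1%:M ->
  \sum_k rank1 U k = eblk (1%:M : 'M[R[i]]_(r i)).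
Proof. by move=> UU; rewrite -eblk_sum -mulmx_suml -mulmx_sumr sum_delta mulmx1 UU. Qed.

Lemma supp_split x : S x -> x = \sum_(i | P i) eblk (pi x i).
Proof.
move=> Sx; apply: pi_inj => j; rewrite pi_sum; have [Pj|nPj] := boolP (P j).
  rewrite (bigD1 j) //= eblkE big1 ?addr0 // => i /andP[_ ij].
  by rewrite eblk_ne // eq_sym.
rewrite Sx // big1 // => i Pi; rewrite eblk_ne //.
by apply: contraNneq nPj => ->.
Qed.

(** For a projection e = [rank1 U k], every other term of the sum is a minimal projection orthogonal
    to e. So 1 - e is a sum of projections to which strict order zero applies against e. *)
Lemma central_split i (U : 'M[R[i]]_(r i)) : P i -> adjm U *m U = 1%:M ->
  one = \sum_k rank1 U k
    + \sum_(i' | P i' && (i' != i)) \sum_k rank1 (1%:M : 'M[R[i]]_(r i')) k.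
Proof.
move=> Pi UU; rewrite sum_rank1 //.
under [X in _ = _ + X]eq_bigr do rewrite sum_rank1 ?adjm1 ?mulmx1 //.
have oneE j : P j -> pi one j = 1%:M by move=> Pj; rewrite mxpackE Pj.
rewrite (supp_split (x := one)) => [|j Pj]; last by rewrite mxpackE (negbTE Pj).
rewrite (bigD1 i) //= oneE //; congr (_ + _).
by apply: eq_bigr => j /andP[Pj _]; rewrite oneE.
Qed.

(** Strict order zero extends from e, e' to z e, e' y by [cp_kill], once on the left and, after
    taking adjoints, once on the right. *)
Lemma oz_kill e e' z y : minimal_projection S e -> minimal_projection S e' ->
  cmul e e' = 0 -> cmul (phi (cmul z e)) (phi (cmul e' y)) = 0.
Proof.
move=> me me' ee'; have [_ [es ee] _ _] := me; have [_ [es' ee2] _ _] := me'.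
have eL x : cmul (central xpredT) x = x := central1 x.
have eR x : cmul x (central xpredT) = x by rewrite -centralC.
have phis := cp_star phi_cp eL eR (central_star _).
have h1 : cmul (phi (cmul z e)) (phi e') = 0.
  by apply: cp_kill => //; rewrite es ee; exact: phi_oz.
have h2 : cmul (phi (cmul (cstar y) e')) (phi (cstar (cmul z e))) = 0.
  apply: cp_kill => //; rewrite es' ee2 phis.
  have e'h : cstar (phi e') = phi e' by rewrite -phis es'.
  by rewrite -e'h -cstarM h1 cstar0.
rewrite -[LHS]cstarK cstarM -!phis [cstar (cmul e' y)]cstarM es' [X in cstar X]h2.
exact: cstar0.
Qed.

(** Says that w may be moved across the product phi(z) phi(y). The condition is linear in w, so rank
    one projections are enough. *)
Let good w := forall z y, S z -> S y ->
  cmul (phi (cmul z w)) (phi y) = cmul (phi z) (phi (cmul w y)).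

(** Both sides equal phi(z e) phi(e y): the cross terms of e with 1 - e vanish by [oz_kill]. *)
Lemma good_rank1 i (U : 'M[R[i]]_(r i)) k : P i -> U *m adjm U = 1%:M ->
  adjm U *m U = 1%:M -> good (rank1 U k).
Proof.
move=> Pi UU UU' z y Sz Sy; 
have [e eE] : {e | e = rank1 U k} by exists (rank1 U k).
rewrite -eE.
have me : minimal_projection S e by rewrite eE; exact: rank1_minimal.
have ee : cmul e e = e by have [_ [_ ->]] := me.
have m1 i' l : P i' -> minimal_projection S (rank1 (1%:M : 'M[R[i]]_(r i')) l).
  move=> Pi'; apply: rank1_minimal => //.
  by rewrite adjm1 mulmx1.
have [rest rE] : {rest | rest = one - e} by exists (one - e).
have restE : rest = \sum_(l | l != k) rank1 U l
    + \sum_(i' | P i' && (i' != i)) \sum_l rank1 (1%:M : 'M[R[i]]_(r i')) l.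
  rewrite rE eE; apply/eqP; rewrite subr_eq; apply/eqP.
  by rewrite (central_split Pi UU') (bigD1 k) //= [in RHS]addrC addrA.
have k1 : cmul (phi (cmul z e)) (phi (cmul rest y)) = 0.
  rewrite restE cmulDl linearD cmulDr !cmul_suml !linear_sum !cmul_sumr.
  rewrite !big1 ?addr0 // => [i' /andP[Pi' ii']|l lk].
    rewrite cmul_suml linear_sum cmul_sumr big1 // => l _.
    apply: oz_kill; [exact: me | exact: m1 |].
    by rewrite eE; apply: rank1_orth_block; rewrite eq_sym.
  apply: oz_kill; [exact: me | exact: rank1_minimal |].
  by rewrite eE; apply: rank1_orth; [exact: UU | rewrite eq_sym].
have k2 : cmul (phi (cmul z rest)) (phi (cmul e y)) = 0.
  rewrite restE cmulDr linearD cmulDl !cmul_sumr !linear_sum !cmul_suml.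
  rewrite !big1 ?addr0 // => [i' /andP[Pi' ii']|l lk].
    rewrite cmul_sumr linear_sum cmul_suml big1 // => l _.
    apply: oz_kill; [exact: m1 | exact: me |].
    by rewrite eE; exact: rank1_orth_block.
  apply: oz_kill; [exact: rank1_minimal | exact: me |].
  by rewrite eE; exact: rank1_orth.
have yE : y = cmul e y + cmul rest y.
  by rewrite -cmulDl rE addrC subrK S_one.
have zE : z = cmul z e + cmul z rest.
  by rewrite -cmulDr rE addrC subrK S_oner.
rewrite {1}yE linearD cmulDr k1 addr0.
by rewrite [in RHS]zE linearD cmulDl k2 addr0.
Qed.

Lemma good0 : good 0.
Proof. by move=> z y _ _; rewrite cmul0r cmul0l linear0 cmul0l cmul0r. Qed.

Lemma goodD w w' : good w -> good w' -> good (w + w').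
Proof.
move=> gw gw' z y Sz Sy.
by rewrite cmulDr linearD cmulDl gw // gw' // cmulDl linearD cmulDr.
Qed.

Lemma goodZ (c : R[i]) w : good w -> good (c *: w).
Proof.
move=> gw z y Sz Sy.
by rewrite cmulZr linearZ cmulZl gw // cmulZl linearZ cmulZr.
Qed.

Lemma good_sum (I : finType) (Q : pred I) (G : I -> F) :
  (forall k, Q k -> good (G k)) -> good (\sum_(k | Q k) G k).
Proof. by move=> h; elim/big_rec: _ => [|k x /h]; [exact: good0 | exact: goodD]. Qed.

Lemma good_herm i (H : 'M[R[i]]_(r i)) : P i -> adjm H = H -> good (eblk H).
Proof.
move=> Pi /hermitian_spectral[U [D [UU UU' ->]]].
rewrite diag_mx_sum_delta mulmx_sumr mulmx_suml eblk_sum; apply: good_sum => k _.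
rewrite -scalemxAr -scalemxAl eblkZ; apply: goodZ; exact: good_rank1.
Qed.

Lemma hermitian_parts n (M : 'M[R[i]]_n) : exists H K,
  [/\ adjm H = H, adjm K = K & M = H + ('i : R[i]) *: K].
Proof.
have half : (2^-1 : R[i])^* = 2^-1 by rewrite conj_Creal // realV realn.
exists (2^-1 *: (M + adjm M)), ((2^-1 * - 'i) *: (M - adjm M)); split.
- by rewrite adjmZ half adjmD adjmK addrC.
- rewrite adjmZ rmorphM rmorphN /= half conjCi opprK adjmD -scaleN1r adjmZ adjmK.
  by rewrite rmorphN1 !scaleN1r -[in RHS]opprB mulrN scaleNr scalerN opprK.
rewrite scalerA; have -> : 'i * (2^-1 * - 'i) = 2^-1 :> R[i].
  by rewrite mulrCA mulrN -expr2 sqrCi opprK mulr1.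
rewrite -scalerDr addrACA subrr addr0.
have -> : M + M = (2 : R[i]) *: M by rewrite scaler_nat mulr2n.
by rewrite scalerA mulVf ?pnatr_eq0 // scale1r.
Qed.

Lemma good_supp w : S w -> good w.
Proof.
move=> /supp_split->; apply: good_sum => i Pi.
have [H [K [hH hK ->]]] := hermitian_parts (pi w i).
by rewrite eblkD eblkZ; apply: goodD; [|apply: goodZ]; exact: good_herm.
Qed.

Lemma order_zero_mulr x y : S x -> S y ->
  cmul (phi x) (phi y) = cmul (phi (cmul x y)) (phi one).
Proof.
move=> Sx Sy; rewrite (good_supp Sy) // ?S_oner //.
by move=> i Pi; rewrite mxpackE (negbTE Pi).
Qed.

Lemma order_zero_mull x y : S x -> S y ->
  cmul (phi x) (phi y) = cmul (phi one) (phi (cmul x y)).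
Proof.
move=> Sx Sy; rewrite -(good_supp Sx) // ?S_one //.
by move=> i Pi; rewrite mxpackE (negbTE Pi).
Qed.

End OrderZero.

End MatrixDecomposition.

(** * Spectral projections and corners *)

Definition mksub {R : realType} {A : cstarAlgType R} (B : cstarSubalg A) (a : A)
  (Ba : subalg_set B a) : subalg_type B := SubalgType (introT (subalg_predP B a) Ba).

Section Corner.
Context {R : realType} {F : cstarAlgType R} (p : F).
Hypothesis p_proj : projection p.
Implicit Types (x y : F).

Lemma rnorm_lipschitz_continuous (h : F -> F) (K : R) : 0 < K ->
  (forall x y, rnorm (h x - h y) <= K * rnorm (x - y)) -> continuous h.
Proof.
move=> K0 hK x; apply/cvgrPdist_le => e e0.
have eR : (complex.Re e)%:C%C = e by rewrite RRe_real // gtr0_real.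
have er0 : 0 < complex.Re e by rewrite -ltcR eR.
have d0 : 0 < (complex.Re e / K)%:C%C :> R[i] by rewrite ltcR divr_gt0.
near=> y.
have : `|x - y| <= (complex.Re e / K)%:C%C.
  by near: y; move/cvgrPdist_le : (@cvg_id _ (nbhs x)); apply.
rewrite !rnormE lecR ler_pdivlMr // mulrC => hxy; rewrite -eR lecR.
exact: le_trans (hK _ _) hxy.
Unshelve. all: by end_near. Qed.

Definition corner_set : set F := [set x | cmul p x = x /\ cmul x p = x]%classic.

Lemma corner_closed : closed corner_set.
Proof.
have K0 : 0 < rnorm p + 1 by rewrite ltr_wpDl ?rnorm_ge0.
have cl (h : F -> F) : (forall x y, h (x - y) = h x - h y) ->
    (forall x, rnorm (h x) <= rnorm p * rnorm x) -> closed [set x | h x = x]%classic.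
  move=> hB hN.
  have -> : [set x | h x = x]%classic = ((fun x => h x - x) @^-1` [set 0])%classic.
    apply/seteqP; split=> x /=; first by move=> ->; rewrite subrr.
    by move=> /eqP; rewrite subr_eq0 => /eqP.
  apply: preimage_closed; last exact/accessible_closed_set1/hausdorff_accessible/norm_hausdorff.
  move=> x _; apply: (@rnorm_lipschitz_continuous _ (rnorm p + 1)) => // {}x y.
  have -> : h x - x - (h y - y) = h (x - y) - (x - y).
    by rewrite hB !opprB addrACA [RHS]addrACA; congr (_ + _); exact: addrC.
  apply: le_trans (rnormD _ _) _; rewrite mulrDl mul1r.
  by apply: lerD => //; rewrite {1}/rnorm normrN.
apply: closedI; apply: cl => x.
- by move=> y; rewrite cmulDr -scaleN1r cmulZr scaleN1r.
- exact: rnormM.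
- by move=> y; rewrite cmulDl -scaleN1r cmulZl scaleN1r.
- by rewrite mulrC rnormM.
Qed.

Let pp : cmul p p = p. Proof. by case: p_proj. Qed.
Let ps : cstar p = p. Proof. by case: p_proj. Qed.

Lemma corner0 : corner_set 0.
Proof. by split; rewrite ?cmul0l ?cmul0r. Qed.
Lemma cornerD x y : corner_set x -> corner_set y -> corner_set (x + y).
Proof. by move=> [x1 x2] [y1 y2]; split; rewrite ?cmulDl ?cmulDr ?x1 ?x2 ?y1 ?y2. Qed.
Lemma cornerZ (c : R[i]) x : corner_set x -> corner_set (c *: x).
Proof. by move=> [x1 x2]; split; rewrite ?cmulZl ?cmulZr ?x1 ?x2. Qed.
Lemma cornerM x y : corner_set x -> corner_set y -> corner_set (cmul x y).
Proof. by move=> [x1 x2] [y1 y2]; split; rewrite ?cmulA ?x1 // -cmulA y2. Qed.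
Lemma corner_star x : corner_set x -> corner_set (cstar x).
Proof. by move=> [x1 x2]; split; rewrite -{1}ps -cstarM ?x1 ?x2. Qed.

Definition corner : cstarSubalg F :=
  CStarSubalg corner_closed corner0 cornerD cornerZ cornerM corner_star.

Lemma compress_corner x : corner_set (cmul p (cmul x p)).
Proof. by split; [rewrite cmulA pp | rewrite -!cmulA pp]. Qed.

Lemma corner_finite_dimensional :
  finite_dimensional F -> finite_dimensional (subalg_type corner).
Proof.
move=> [d [v vP]].
exists d, (fun i => mksub (B := corner) (compress_corner (v i))) => x.
have [c xE] := vP (val x); exists c; apply: val_inj.
rewrite raddf_sum /=; have [x1 x2] := subalgP x.
rewrite -x1 -x2 xE cmul_suml cmul_sumr; apply: eq_bigr => i _.
by rewrite cmulZl cmulZr.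
Qed.

End Corner.

Section CornerDecomposition.
Context {R : realType} {F : cstarAlgType R} {s : nat} {r : 'I_s -> nat}.
Context { pi : F -> forall i : 'I_s, 'M[R[i]]_(r i)}.
Variables (dec : matrix_decomposition pi) (p : F) (p_proj : projection p).
Variables (d : 'I_s -> nat) (V : forall i, 'M[R[i]]_(d i, r i)).
Hypothesis VV : forall i, V i *m adjm (V i) = 1%:M.
Hypothesis VpV : forall i, adjm (V i) *m V i = pi p i.

(* Blocks of rank 0 are dropped. *)
Let I := [pred i | (0 < d i)%N].
Let s' := #|I|.
Let idx (k : 'I_s') : 'I_s := enum_val k.
Let G := corner p_proj.

(** The rows of V i form an orthonormal basis of the range of p in block i, so this reads x in that
    basis and turns p F p into a sum of full matrix algebras of sizes d i. *)
Definition corner_pi (x : subalg_type G) (k : 'I_s') : 'M[R[i]]_(d (idx k)) :=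
  V (idx k) *m pi (val x) (idx k) *m adjm (V (idx k)).

Lemma corner_piE (x : subalg_type G) i : pi (val x) i =
  adjm (V i) *m (V i *m pi (val x) i *m adjm (V i)) *m V i.
Proof.
have [x1 x2] := subalgP x.
by rewrite -{1}x1 -{1}x2 !(mxdecM dec) -VpV !mulmxA.
Qed.

Lemma corner_pi_drop (x : subalg_type G) i : ~~ (0 < d i)%N -> pi (val x) i = 0.
Proof.
rewrite -eqn0Ngt => /eqP d0; rewrite corner_piE.
suff -> : V i = 0 by rewrite mulmx0.
by apply/matrixP => -[a a0]; exfalso; rewrite d0 in a0.
Qed.

Lemma corner_pack_mem (Z : forall k : 'I_s', 'M[R[i]]_(d (idx k))) :
  corner_set p (\sum_k eblk dec (adjm (V (idx k)) *m Z k *m V (idx k))).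
Proof.
have VZ k : pi p (idx k) *m (adjm (V (idx k)) *m Z k *m V (idx k)) =
    adjm (V (idx k)) *m Z k *m V (idx k).
  by rewrite -VpV -!mulmxA [V _ *m (adjm _ *m _)]mulmxA VV mul1mx.
have ZV k : adjm (V (idx k)) *m Z k *m V (idx k) *m pi p (idx k) =
    adjm (V (idx k)) *m Z k *m V (idx k).
  by rewrite -VpV -!mulmxA [V _ *m (adjm _ *m _)]mulmxA VV mul1mx.
split; rewrite ?cmul_sumr ?cmul_suml; apply: eq_bigr => k _;
  apply: (pi_inj dec) => i; rewrite [LHS](mxdecM dec).
  by have [->|ik] := eqVneq i (idx k); rewrite ?eblkE ?eblk_ne ?mulmx0 ?VZ.
by have [->|ik] := eqVneq i (idx k); rewrite ?eblkE ?eblk_ne ?mul0mx ?ZV.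
Qed.

Lemma corner_decomposition : matrix_decomposition corner_pi.
Proof.
split.
- by move=> k; exact: (enum_valP k).
- exists (fun Z => mksub (B := G) (corner_pack_mem Z)) => [x|Z].
    apply: val_inj => /=; rewrite (eq_bigr (fun k => eblk dec (pi (val x) (idx k)))).
      rewrite [RHS](supp_split dec (P := I)) => [|i]; last exact: corner_pi_drop.
      by rewrite -(big_enum_val (fun i => eblk dec (pi (val x) i))).
    by move=> k _; rewrite /corner_pi -corner_piE.
  apply: functional_extensionality_dep => k; rewrite /corner_pi /= (pi_sum dec).
  rewrite (bigD1 k) //= eblkE big1 ?addr0 => [|j jk].
    by rewrite !mulmxA VV mul1mx -mulmxA VV mulmx1.
  by rewrite eblk_ne // (inj_eq enum_val_inj) eq_sym.
- by move=> x y k; rewrite /corner_pi /= (mxdecD dec) mulmxDr mulmxDl.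
- by move=> c x k; rewrite /corner_pi /= (mxdecZ dec) -scalemxAr -scalemxAl.
- move=> x y k; rewrite /corner_pi [val _](_ : _ = cmul (val x) (val y)) //.
  have [y1 _] := subalgP y.
  by rewrite -{1}y1 !(mxdecM dec) -VpV !mulmxA.
move=> x k; rewrite /corner_pi [val _](_ : _ = cstar (val x)) // (mxdec_star dec) -!adjmE.
by rewrite !adjmM adjmK mulmxA.
Qed.

End CornerDecomposition.
Section SpectralProjection.
Context {R : realType} {F : cstarAlgType R} {s : nat} {r : 'I_s -> nat}.
Context { pi : F -> forall i : 'I_s, 'M[R[i]]_(r i)}.
Variable dec : matrix_decomposition pi.

Lemma positive_spectral (g : F) i : positive g ->
  exists (U : 'M[R[i]]_(r i)) (D : 'rV[R[i]]_(r i)),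
    [/\ U *m adjm U = 1%:M, adjm U *m U = 1%:M,
        pi g i = adjm U *m diag_mx D *m U & forall k, 0 <= D 0 k].
Proof.
move=> [x ->]; have piE : pi (cmul (cstar x) x) i = adjm (pi x i) *m pi x i.
  by rewrite (mxdecM dec) (mxdec_star dec) -adjmE.
have [|U [D [UU UU' HE]]] := @hermitian_spectral _ _ (pi (cmul (cstar x) x) i).
  by rewrite piE adjmM adjmK.
exists U, D; split=> // k.
pose Y := pi x i *m adjm U.
have -> : D 0 k = (adjm Y *m Y) k k.
  have -> : adjm Y *m Y = U *m pi (cmul (cstar x) x) i *m adjm U.
    by rewrite piE /Y adjmM adjmK !mulmxA.
  rewrite HE !mulmxA UU mul1mx -mulmxA UU mulmx1.
  by rewrite mxE eqxx mulr1n.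
rewrite adjmE mxE; apply: sumr_ge0 => l _; rewrite !mxE mulrC -normCK.
exact: exprn_ge0.
Qed.

Section Calculus.
Variable U : forall i, 'M[R[i]]_(r i).
Hypothesis UU : forall i, U i *m adjm (U i) = 1%:M.
Hypothesis UU' : forall i, adjm (U i) *m U i = 1%:M.
Implicit Types (f h : forall i, 'I_(r i) -> R[i]).

Definition dform i (v : 'rV[R[i]]_(r i)) : 'M[R[i]]_(r i) :=
  adjm (U i) *m diag_mx v *m U i.

Lemma dformD i v w : dform (v + w) = dform v + dform w :> 'M[R[i]]_(r i).
Proof. by rewrite /dform linearD mulmxDr mulmxDl. Qed.

Lemma dformZ i c v : dform (c *: v) = c *: dform v :> 'M[R[i]]_(r i).
Proof. by rewrite /dform linearZ -scalemxAr -scalemxAl. Qed.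

Lemma dformM i v w : dform v *m dform w = dform (\row_k (v 0 k * w 0 k)) :> 'M[R[i]]_(r i).
Proof.
rewrite /dform -!mulmxA [U i *m (adjm _ *m _)]mulmxA UU mul1mx.
by rewrite [diag_mx _ *m (diag_mx _ *m _)]mulmxA mulmx_diag.
Qed.

(** Functional calculus in a fixed eigenbasis: identities, adjoints and positivity become statements
    on the eigenvalues f. *)
Definition diagonal (x : F) f := forall i, pi x i = dform (\row_k f i k).

Lemma diagonal_ext x f h : diagonal x f -> (forall i k, f i k = h i k) -> diagonal x h.
Proof.
move=> xf fh i; rewrite xf; have -> // : (\row_k f i k) = (\row_k h i k).
by apply/rowP => k; rewrite !mxE fh.
Qed.

Lemma diagonalD x y f h : diagonal x f -> diagonal y h ->
  diagonal (x + y) (fun i k => f i k + h i k).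
Proof.
move=> xf yh i; rewrite (mxdecD dec) xf yh -dformD.
by have -> : (\row_k f i k) + (\row_k h i k) = (\row_k (f i k + h i k)) by apply/rowP => k; rewrite !mxE.
Qed.

Lemma diagonalZ c x f : diagonal x f -> diagonal (c *: x) (fun i k => c * f i k).
Proof.
move=> xf i; rewrite (mxdecZ dec) xf -dformZ.
by have -> : c *: (\row_k f i k) = (\row_k (c * f i k)) by apply/rowP => k; rewrite !mxE.
Qed.

Lemma diagonalB x y f h : diagonal x f -> diagonal y h ->
  diagonal (x - y) (fun i k => f i k - h i k).
Proof.
move=> xf /(diagonalZ (-1)) /(diagonalD xf); rewrite scaleN1r => E.
by apply: diagonal_ext E _ => i k; rewrite mulN1r.
Qed.

Lemma diagonalM x y f h : diagonal x f -> diagonal y h ->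
  diagonal (cmul x y) (fun i k => f i k * h i k).
Proof.
move=> xf yh i; rewrite (mxdecM dec) xf yh dformM.
have -> // : (\row_k ((\row_l f i l) 0 k * (\row_l h i l) 0 k)) = (\row_k (f i k * h i k)).
by apply/rowP => k; rewrite !mxE.
Qed.

Lemma diagonal_uniq x y f : diagonal x f -> diagonal y f -> x = y.
Proof. by move=> xf yf; apply: (pi_inj dec) => i; rewrite xf yf. Qed.

Lemma diagonal1 : diagonal (central dec xpredT) (fun=> fun=> 1).
Proof.
move=> i; rewrite mxpackE; have -> : (\row_k (1 : R[i])) = const_mx 1 :> 'rV_(r i).
  by apply/rowP => k; rewrite !mxE.
by rewrite /dform diag_const_mx mulmx1 UU'.
Qed.

Definition diagonal_of f : F :=
  mxpack dec (fun i => dform (\row_k f i k)).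

Lemma diagonal_ofP f : diagonal (diagonal_of f) f.
Proof. by move=> i; rewrite mxpackE. Qed.

Lemma diagonal_star x f : diagonal x f -> (forall i k, f i k \is Num.real) -> cstar x = x.
Proof.
move=> xf fr; apply: (pi_inj dec) => i.
rewrite [LHS](mxdec_star dec) -adjmE xf /dform !adjmM adjmK mulmxA.
suff -> : adjm (diag_mx (\row_k f i k)) = diag_mx (\row_k f i k) by [].
rewrite adjmE; apply/matrixP => k l; rewrite !mxE eq_sym.
by case: eqP => [->|_]; rewrite ?mulr1n ?mulr0n ?conj_Creal ?conjC0.
Qed.

Lemma diagonal_positive x f : diagonal x f -> (forall i k, 0 <= f i k) -> positive x.
Proof.
move=> xf f0; pose y := diagonal_of (fun i k => sqrtC (f i k)).
have yP : diagonal y (fun i k => sqrtC (f i k)) := diagonal_ofP _.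
exists y; rewrite (diagonal_star yP) => [|i k]; last by rewrite ger0_real // sqrtC_ge0.
apply: (diagonal_uniq xf); apply: diagonal_ext (diagonalM yP yP) _ => i k.
by rewrite -expr2 sqrtCK.
Qed.

End Calculus.

(** p belongs to the eigenvalues above eta. The first inequality, eta p <= g, will control phi(p);
    the second says that little of g is lost by cutting down to p. *)
Lemma spectral_projection (g : F) (eta : R) : positive g -> 0 < eta ->
  exists p : F, projection p /\
    [/\ positive (g - eta%:C%C *: p),
        positive (eta%:C%C *: central dec xpredT
          - cmul (central dec xpredT - p) (cmul g (central dec xpredT - p))) &
        exists (d : 'I_s -> nat) (V : forall i, 'M[R[i]]_(d i, r i)),
          (forall i, V i *m adjm (V i) = 1%:M) /\ (forall i, adjm (V i) *m V i = pi p i)].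
Proof.
move=> pg eta0; have sp i := cid (positive_spectral i pg).
pose U i := projT1 (sp i); pose spD i := cid (projT2 (sp i)); pose D i := projT1 (spD i).
have UU i : U i *m adjm (U i) = 1%:M by have [] := projT2 (spD i).
have UU' i : adjm (U i) *m U i = 1%:M by have [] := projT2 (spD i).
have gE : diagonal U g (fun i k => D i 0 k).
  move=> i; have [_ _ E _] := projT2 (spD i); rewrite [LHS]E /dform.
  by have -> : (\row_k D i 0 k) = D i by apply/rowP => k; rewrite mxE.
have D0 i k : 0 <= D i 0 k by have [] := projT2 (spD i).
clearbody U D; clear sp spD.
have DR i k : D i 0 k \is Num.real by rewrite ger0_real.
pose big i := [pred k | eta%:C%C < D i 0 k].
pose chi i k : R[i] := (big i k)%:R.
have [p pE] : exists p, diagonal U p chi by exists (diagonal_of U chi); exact: diagonal_ofP.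
have oneE := diagonal1 UU'.
have chi2 i k : chi i k * chi i k = chi i k.
  by rewrite /chi -natrM mulnb andbb.
exists p; split; [split|split].
- by apply: (diagonal_star pE) => i k; rewrite realn.
- by apply: (diagonal_uniq _ pE); apply: diagonal_ext (diagonalM UU pE pE) chi2.
- apply: (diagonal_positive UU (diagonalB gE (diagonalZ eta%:C%C pE))) => i k.
  rewrite /chi; case: (boolP (big i k)) => /= h.
    by rewrite mulr1 subr_ge0 ltW.
  by rewrite mulr0 subr0.
- have cE := diagonalB oneE pE.
  apply: (diagonal_positive UU (diagonalB (diagonalZ eta%:C%C oneE)
    (diagonalM UU cE (diagonalM UU gE cE)))) => i k; rewrite /chi; case: (boolP (big i k)) => /= h.
    by rewrite subrr !mulr0 subr0 mulr1 ler0c ltW.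
  rewrite subr0 !mulr1 mul1r subr_ge0.
  by move: h; rewrite -real_leNgt // ger0_real // ler0c ltW.
(* V i keeps the rows of U i that belong to eigenvalues above eta. *)
exists (fun i => #|big i|), (fun i => \matrix_(a, b) U i (enum_val a) b); split=> i.
  rewrite adjmE; apply/matrixP => a b; rewrite !mxE.
  have := UU i; rewrite adjmE => /matrixP/(_ (enum_val a) (enum_val b)).
  rewrite !mxE (inj_eq enum_val_inj) => <-.
  by apply: eq_bigr => l _; rewrite !mxE.
rewrite pE /dform; apply/matrixP => a b; rewrite adjmE !mxE.
rewrite (eq_bigr (fun l => (U i (enum_val l) a)^* * U i (enum_val l) b)); last first.
  by move=> l _; rewrite !mxE.
rewrite -(big_enum_val (fun l => (U i l a)^* * U i l b)) [LHS]big_mkcond /=.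
apply: eq_bigr => l _; rewrite mul_mx_diag adjmE !mxE /chi -[l \in _]/(big i l).
by case: (big i l); rewrite ?mulr1 // mulr0 mul0r.
Qed.

End SpectralProjection.

(** * Perturbing an approximation into a hereditary subalgebra *)

(** w lives in the unitization, but w a w* lies in the ideal A; the first component therefore loses
    nothing. *)
HB.lock Definition uconj (R : realType) (A : cstarAlgType R) (w : unitz A) (a : A) : A :=
  (w * uinj a * star w).1.
Arguments uconj {R A} w a.

Section Conjugation.
Context {R : realType} {A : cstarAlgType R}.
Implicit Types (a b f : A) (w x : unitz A).

Lemma linear_of_fun (U V : lmodType R[i]) (f : U -> V) : linear f ->
  {g : {linear U -> V} | g =1 f}.
Proof.
move=> fl; pose m := GRing.isLinear.Build _ _ _ _ f fl.
by exists (HB.pack_for {linear U -> V} f m).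
Qed.

Lemma uconjE w a : uinj (uconj w a) = w * uinj a * star w.
Proof.
have [b bE] := uinj_ideal_r a w; have [c cE] := uinj_ideal b (star w).
by rewrite uconj.unlock bE cE.
Qed.

Definition uscal (c : R[i]) : unitz A := (0, c).

Lemma uscalC c x : uscal c * x = x * uscal c.
Proof.
case: x => x d; congr (_, _); rewrite /= 1?mulrC //.
by rewrite cmul0l cmul0r !scaler0 !addr0 !add0r.
Qed.

Lemma uinj_scal c a : uinj (c *: a) = uscal c * uinj a.
Proof. by congr (_, _); rewrite /= ?mulr0 // cmul0l scale0r !addr0 add0r. Qed.

Lemma uconj_linear w : linear (uconj w).
Proof.
suff E c a b : uconj w (c *: a + b) = c *: uconj w a + uconj w b by move=> c a b; exact: E.
apply: uinj_injective; rewrite !uinjD !uinj_scal !uconjE !uinjD !uinj_scal.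
by rewrite mulrDr mulrDl !mulrA uscalC.
Qed.

Lemma positive_mx_uconj k w (M : 'M[A]_k) : positive_mx M ->
  positive_mx (map_mx (uconj w) M).
Proof.
move=> [X ->]; exists (map_mx (fun a => (uinj a * star w).1) X).
apply/matrixP => i j; rewrite !mxE; apply: uinj_injective.
rewrite uconjE !uinj_sum mulr_sumr mulr_suml; apply: eq_bigr => l _.
have E a : uinj (uinj a * star w).1 = uinj a * star w.
  by have [b bE] := uinj_ideal a (star w); rewrite bE.
by rewrite !mxE !uinjM !uinj_star !E starM starK !mulrA.
Qed.

Lemma positive_mx_cconj k z (M : 'M[A]_k) : positive_mx M ->
  positive_mx (map_mx (fun a => cmul (cstar z) (cmul a z)) M).
Proof.
move=> [X ->]; exists (map_mx (fun a => cmul a z) X).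
apply/matrixP => i j; rewrite !mxE cmul_suml cmul_sumr; apply: eq_bigr => l _.
by rewrite !mxE cstarM -!cmulA.
Qed.

(** For positive b, put d = w' b w'*. The conjugate is f d f, positive and at most |d| f^2, an
    element of B, so heredity applies; a general [a] is a combination of four positive elements. *)
Lemma hereditary_uconj (B : cstarSubalg A) f w' a : hereditary B ->
  subalg_set B f -> cstar f = f -> subalg_set B (uconj (uinj f * w') a).
Proof.
move=> hB Bf hf; have hu : star (uinj f) = uinj f by rewrite -uinj_star hf.
have posB b : pos (uinj b) -> subalg_set B (uconj (uinj f * w') b).
  move=> pb; set d := w' * uinj b * star w'.
  have pd : pos d by have := pos_conj (star w') pb; rewrite starK.
  have dE : uinj (uconj (uinj f * w') b) = uinj f * d * uinj f.
    by rewrite uconjE /d starM hu !mulrA.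
  apply: (hB _ ((nrm d)%:C%C *: cmul f f)).
  - by apply: subalgZ; apply: subalgM.
  - by apply/positiveP; rewrite dE; apply: pos_conj_sa.
  - apply/positiveP; rewrite uinjZ uinjM; apply: posZ; first exact: nrm_ge0.
    exact: pos_sqr.
  apply/positiveP; rewrite uinjB dE uinjZ uinjM.
  have -> : nrm d *: (uinj f * uinj f) - uinj f * d * uinj f =
    uinj f * ((nrm d)%:A - d) * uinj f by ncring.
  by apply: pos_conj_sa => //; apply: pos_nrm_scal.
have [L LE] := linear_of_fun (uconj_linear (uinj f * w')).
have [p [q [r [s [_ [[pp pq pr ps] ->]]]]]] := subalg_four_pos (B := full_subalg) (b := a) I.
rewrite -LE linearD linearZ !linearB /= !LE.
by apply: subalgD; [|apply: subalgZ]; apply: subalgB; exact: posB.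
Qed.

(** Splits off one square root of [a] from x a; the remaining factor has square norm |x a x*|. *)
Lemma nrm_mul_pos (T : ucstarType R) (a x : T) : pos a ->
  nrm (x * a) ^+ 2 <= nrm a * nrm (x * a * star x).
Proof.
move=> pa; have hs := sqrtp_star pa; have ss := sqrtp_sqr pa.
have -> : nrm (x * a * star x) = nrm (x * sqrtp a) ^+ 2.
  by rewrite -nrm_Mstar starM hs -{1}ss !mulrA.
have -> : nrm a = nrm (sqrtp a) ^+ 2 by rewrite -nrm_starM hs ss.
rewrite -exprMn ler_pXn2r ?nnegrE ?mulr_ge0 ?nrm_ge0 //.
by rewrite -{1}ss mulrA mulrC; exact: nrmM.
Qed.

(** That w is nearly a unit at [a] passes to every u <= K a, because (1 - w) u (1 - w)* <= K (1 - w)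
    a (1 - w)*. The bound t^2 / 2 on the right turns into K t for (1 - w) u, which occurs twice in u
    - w u w*. *)
Lemma nrm_conj_close (T : ucstarType R) (u a w : T) (K t : R) :
  pos u -> pos (K *: a - u) -> 0 <= K -> 0 <= t -> pos a -> nrm a <= 1 -> nrm w <= 1 ->
  nrm ((1 - w) * a) <= t ^+ 2 / 2 -> nrm (u - w * u * star w) <= K * (2 * t).
Proof.
move=> pu pua K0 t0 pa a1 w1 wa.
have uK : nrm u <= K.
  apply: le_trans (nrm_mono pu pua) _.
  by rewrite nrmZ ger0_norm // ler_piMr.
have v2 : nrm (1 - w) <= 2.
  by apply: le_trans (nrmB _ _) _; have := nrm1_le (T := T); lra.
have h1 : nrm ((1 - w) * u * star (1 - w)) <= K * t ^+ 2.
  have pv (z : T) : pos z -> pos ((1 - w) * z * star (1 - w)).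
    by move=> pz; have := pos_conj (star (1 - w)) pz; rewrite starK.
  apply: le_trans (nrm_mono (b := K *: ((1 - w) * a * star (1 - w))) (pv _ pu) _) _.
    have -> : K *: ((1 - w) * a * star (1 - w)) - (1 - w) * u * star (1 - w) =
      (1 - w) * (K *: a - u) * star (1 - w).
      by ncring.
    exact: pv.
  rewrite nrmZ ger0_norm //; apply: ler_wpM2l => //.
  have -> : t ^+ 2 = t ^+ 2 / 2 * 2 by field.
  by apply: nrmM_le => //; rewrite nrm_star.
have h2 : nrm ((1 - w) * u) <= K * t.
  rewrite -(ler_pXn2r (n := 2)) ?nnegrE ?mulr_ge0 ?nrm_ge0 //.
  apply: le_trans (nrm_mul_pos _ pu) _.
  have -> : (K * t) ^+ 2 = K * (K * t ^+ 2) by ring.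
  by apply: ler_pM => //; exact: nrm_ge0.
have -> : u - w * u * star w = (1 - w) * u + w * star ((1 - w) * u).
  by rewrite starM starB star1 (pos_sa pu); ncring.
apply: le_trans (nrmD _ _) _.
have : nrm (w * star ((1 - w) * u)) <= 1 * (K * t) by apply: nrmM_le => //; rewrite nrm_star.
lra.
Qed.

End Conjugation.

Section CmulLinear.
Context {R : realType} {A : cstarAlgType R}.
Implicit Types (a b c : A) (k : R[i]).

Lemma cmulBr a b c : cmul a (b - c) = cmul a b - cmul a c.
Proof. by rewrite cmulDr -scaleN1r cmulZr scaleN1r. Qed.

Lemma cmulZ_r k a b : cmul a (k *: b) = k *: cmul a b.
Proof. exact: cmulZr. Qed.

End CmulLinear.

Section Perturbation.
Context {R : realType} {A F : cstarAlgType R} (B : cstarSubalg A).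
Hypothesis B_hered : hereditary B.
Context {s n : nat} {r : 'I_s -> nat} { pi : F -> forall i : 'I_s, 'M[R[i]]_(r i)}.
Variables (dec : matrix_decomposition pi) (c : 'I_s -> 'I_n.+1).
Variable phi : {linear F -> A}.
Hypothesis phi_cp : completely_positive phi.
Hypothesis phi_contr : contractive phi.
Hypothesis phi_oz : forall j : 'I_n.+1,
  strict_order_zero_on [set x | forall i, c i != j -> pi x i = 0]%classic phi.
Variables (p : F) (p_proj : projection p).
Variables (d : 'I_s -> nat) (V : forall i, 'M[R[i]]_(d i, r i)).
Hypothesis VV : forall i, V i *m adjm (V i) = 1%:M.
Hypothesis VpV : forall i, adjm (V i) *m V i = pi p i.
Variables (f : A) (wp : 'I_n.+1 -> unitz A).
Hypothesis Bf : subalg_set B f.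
Hypothesis f_star : cstar f = f.

Let colour j : F := central dec (fun i => c i == j).
Let a j : A := phi (cmul (colour j) p).
Let w j : unitz A := uinj f * wp j.
Let G := corner p_proj.

Variable t : R.
Hypothesis t0 : 0 <= t.
Hypothesis w_le1 : forall j, nrm (w j) <= 1.
Hypothesis w_close : forall j, nrm ((1 - w j) * uinj (a j)) <= t ^+ 2 / 2.
Hypothesis w_comm : forall j z, uinj (a j) * z = z * uinj (a j) ->
  star (w j) * w j * z = z * (star (w j) * w j).

Let rho : R := n.+1%:R * (2 * t).
Let rho0 : 0 <= rho. Proof. by rewrite !mulr_ge0. Qed.

Let pp : cmul p p = p. Proof. by case: p_proj. Qed.
Let ps : cstar p = p. Proof. by case: p_proj. Qed.
Let cs j : cstar (colour j) = colour j. Proof. exact: central_star. Qed.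
Let cc j : cmul (colour j) (colour j) = colour j. Proof. exact: central_idem. Qed.
Let cC j x : cmul (colour j) x = cmul x (colour j). Proof. exact: centralC. Qed.

Lemma projection_norm (D : cstarAlgType R) (e : D) : projection e -> rnorm e <= 1.
Proof.
move=> [es ee]; have : rnorm e ^+ 2 = rnorm e by rewrite -rnorm_cstarM es ee.
have := rnorm_ge0 e; nra.
Qed.

Lemma projection_pos (D : cstarAlgType R) (e : D) : projection e -> pos (uinj e).
Proof. by move=> [es ee]; apply/positiveP; exists e; rewrite es ee. Qed.

Let cp_proj j : projection (cmul (colour j) p).
Proof.
split; first by rewrite cstarM ps cs -cC.
by rewrite -cmulA [cmul p _]cmulA -cC -cmulA pp cmulA cc.
Qed.

Lemma colour_sum x : x = \sum_j cmul (colour j) x.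
Proof.
apply: (pi_inj dec) => i; rewrite (pi_sum dec) (bigD1 (c i)) //= big1 ?addr0.
  by rewrite (pi_central dec) eqxx.
by move=> j jc; rewrite (pi_central dec) eq_sym (negbTE jc).
Qed.

Let phi_nrm x : rnorm (phi x) <= rnorm x.
Proof. by rewrite -lecR -!rnormE; exact: phi_contr. Qed.

Let S x : A := \sum_j uconj (w j) (phi (cmul (colour j) x)).

(** On the corner 0 <= x <= K p, so the part of x of colour j is mapped below K a_j and
    [nrm_conj_close] applies; rho adds up the errors of the n + 1 colours. *)
Lemma perturb_close x K : 0 <= K -> corner_set p x -> pos (uinj x) -> rnorm x <= K ->
  rnorm (phi x - S x) <= K * rho.
Proof.
move=> K0 [px xp] posx xK.
have -> : phi x - S x = \sum_j (phi (cmul (colour j) x) - uconj (w j) (phi (cmul (colour j) x))).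
  by rewrite {1}(colour_sum x) linear_sum -sumrB.
rewrite -uinj_nrm uinj_sum; apply: le_trans (nrm_sum _ _ _) _.
have -> : K * rho = \sum_(j < n.+1) K * (2 * t).
  by rewrite sumr_const card_ord -mulr_natl /rho; ring.
apply: ler_sum => j _; rewrite uinjB uconjE.
have hc : star (uinj (colour j)) = uinj (colour j) by rewrite -uinj_star cs.
have hp : star (uinj p) = uinj p by rewrite -uinj_star ps.
have cxE y : uinj (cmul (colour j) y) = uinj (colour j) * uinj y * uinj (colour j).
  by rewrite -!uinjM -cC cmulA cc.
apply: (@nrm_conj_close _ _ _ (uinj (a j))) => //.
- by apply: cp_positive => //; rewrite cxE; apply: pos_conj_sa.
- rewrite -uinjZ -uinjB -linearZ -linearB; apply: cp_positive => //.
  have -> : K%:C%C *: cmul (colour j) p - cmul (colour j) x =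
      cmul (colour j) (K%:C%C *: p - x) by rewrite cmulBr cmulZ_r.
  rewrite cxE; apply: pos_conj_sa => //.
  have h : pos (K%:A - uinj x) by apply: pos_nrm_scal; rewrite ?uinj_nrm.
  have := pos_conj_sa hp h; congr pos.
  rewrite uinjB uinjZ mulrBr mulrBl -scalerAr mulr1 -scalerAl -!uinjM pp px xp.
  by [].
- exact/(cp_positive phi_cp)/projection_pos.
- by rewrite uinj_nrm; apply: le_trans (phi_nrm _) (projection_norm (cp_proj j)).
Qed.

Lemma S_mem x : subalg_set B (S x).
Proof.
rewrite /S; elim/big_rec: _ => [|j y _ By]; first exact: subalg0.
by apply: subalgD => //; exact: hereditary_uconj.
Qed.

Lemma S_linear : linear S.
Proof.
move=> k x y; rewrite /S scaler_sumr -big_split /=; apply: eq_bigr => j _.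
have E : cmul (colour j) (k *: x + y) = k *: cmul (colour j) x + cmul (colour j) y.
  by rewrite cmulDr cmulZr.
by rewrite E linearD linearZ; exact: uconj_linear.
Qed.

(** S sends the unit p of the corner to an element of norm at most 1 + rho; this factor restores
    contractivity. *)
Let kappa : R := (1 + rho)^-1.
Let rho1 : 0 < 1 + rho. Proof. by rewrite ltr_wpDr. Qed.

Let psi0 (x : subalg_type G) : subalg_type B :=
  mksub (subalgZ kappa%:C%C (S_mem (val x))).

Let psi0_linear : linear psi0.
Proof.
move=> k x y; apply: val_inj; rewrite /= S_linear.
by rewrite scalerDr !scalerA [_ * k]mulrC.
Qed.

Lemma positive_mx_sum (D : cstarAlgType R) k (I : finType) (M : I -> 'M[D]_k) :
  (forall i, positive_mx (M i)) -> positive_mx (\sum_i M i).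
Proof.
move=> h; elim/big_rec: _ => [|i x _]; last exact: positive_mxD.
exists 0; apply/matrixP => i j; rewrite !mxE big1 // => l _.
by rewrite !mxE cmul0r.
Qed.

Let psi0_cp (psi : {linear subalg_type G -> subalg_type B}) : psi =1 psi0 ->
  completely_positive psi.
Proof.
move=> psiE k M /positive_mx_val pM; apply: positive_mx_sub.
have -> : map_mx val (map_mx psi M) = map_mx (fun y => kappa%:C%C *: y)
   (\sum_j map_mx (uconj (w j)) (map_mx phi
     (map_mx (fun y => cmul (cstar (colour j)) (cmul y (colour j))) (map_mx val M)))).
  apply/matrixP => i j; rewrite !mxE psiE /= summxE; congr (_ *: _).
  apply: eq_bigr => l _; rewrite !mxE cs -cC cmulA cc.
  by [].
apply: positive_mxZ; first by rewrite invr_ge0 ltW.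
apply: positive_mx_sum => j; apply: positive_mx_uconj; apply: phi_cp.
exact: positive_mx_cconj.
Qed.

Let psi0_contr (psi : {linear subalg_type G -> subalg_type B}) : psi =1 psi0 ->
  contractive psi.
Proof.
move=> psiE x; have pcp := psi0_cp psiE.
have Gp : corner_set p p by [].
pose e : subalg_type G := mksub (B := G) Gp.
have eL y : cmul e y = y by apply: val_inj; have [] := subalgP y.
have eR y : cmul y e = y by apply: val_inj; have [] := subalgP y.
have es : cstar e = e by apply: val_inj.
have h := cp_nrm pcp eL eR es x.
rewrite !rnormE lecR; apply: le_trans h _.
rewrite -[leRHS]mul1r; apply: ler_wpM2r; first exact: rnorm_ge0.
rewrite psiE.
have -> : rnorm (psi0 e) = rnorm (kappa%:C%C *: S p) by [].
rewrite rnormZ rnormR ger0_norm ?invr_ge0 ?(ltW rho1) // ler_pdivrMl // mulr1.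
have := perturb_close ler01 Gp (projection_pos p_proj) (projection_norm p_proj).
have := phi_nrm p; have := projection_norm p_proj.
by have := rnormB (phi p) (phi p - S p); rewrite subKr; lra.
Qed.

Let psi0_decomposable (psi : {linear subalg_type G -> subalg_type B}) : psi =1 psi0 ->
  n_decomposable n psi.
Proof.
move=> psiE; split; first exact: psi0_cp.
exists _, _, (corner_pi (pi := pi) (p_proj := p_proj) V), (fun k => c (enum_val k)).
split; first exact: corner_decomposition.
move=> j e e' [Se _ _ _] [Se' _ _ _] ee'; apply: val_inj; rewrite /= !psiE.
have supp (x : subalg_type G) : (forall k, c (enum_val k) != j ->
    corner_pi (pi := pi) V x k = 0) -> forall i, c i != j -> pi (val x) i = 0.
  move=> Sx i ci; have [di|di] := boolP (0 < d i)%N; last exact: corner_pi_drop di.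
  have iI : i \in [pred i | (0 < d i)%N] by [].
  rewrite (corner_piE dec VpV).
  have := Sx (enum_rank_in iI i); rewrite /corner_pi enum_rankK_in // => -> //.
  by rewrite mulmx0 mul0mx.
have SE (x : subalg_type G) : (forall i, c i != j -> pi (val x) i = 0) ->
    uinj (S (val x)) = w j * uinj (phi (val x)) * star (w j).
  move=> Sx; rewrite /S uinj_sum (bigD1 j) //= big1 ?addr0 => [|l lj].
    rewrite uconjE (central_supp dec (P := fun i => c i == j)) // => i; exact: Sx.
  have -> : cmul (colour l) (val x) = 0.
    apply: (pi_inj dec) => i; rewrite (pi_central dec) (pi0 dec).
    by case: eqP => // ci; apply: Sx; rewrite ci.
  by rewrite linear0 uconjE uinj0 mulr0 mul0r.
have He := supp _ Se; have He' := supp _ Se'.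
pose P i := c i == j.
have oz := order_zero_mull dec (P := P) phi_cp (@phi_oz j).
have ozr := order_zero_mulr dec (P := P) phi_cp (@phi_oz j).
have Hp i : ~~ P i -> pi (cmul (colour j) p) i = 0.
  by move=> /negbTE Pi; rewrite (pi_central dec) -/(P i) Pi.
have e1 : cmul (colour j) (val e) = val e by apply: central_supp => i; exact: He.
have [pe ep] := subalgP e.
(* Both products equal phi(e) phi(1_j), with 1_j the unit of the part j, since e is fixed by p and
   by the colour j on either side. Hence star (w_j) w_j commutes with phi(e). *)
have comm : uinj (a j) * uinj (phi (val e)) = uinj (phi (val e)) * uinj (a j).
  rewrite -!uinjM /a (ozr _ _ Hp He) (ozr _ _ He Hp); congr (uinj (cmul (phi _) _)).
  by rewrite -cmulA pe e1 cmulA -cC e1 ep.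
have prod0 : cmul (phi (val e)) (phi (val e')) = 0.
  have ee0 : cmul (val e) (val e') = 0 by have /(congr1 val) := ee'.
  by rewrite (oz _ _ He He') ee0 linear0 cmul0r.
apply: uinj_injective.
have -> : uinj (cmul (kappa%:C%C *: S (val e)) (kappa%:C%C *: S (val e'))) =
  (kappa * kappa) *: (uinj (S (val e)) * uinj (S (val e'))).
  by rewrite uinjM !uinjZ; ncring.
rewrite !SE //.
have -> : w j * uinj (phi (val e)) * star (w j) * (w j * uinj (phi (val e')) * star (w j)) =
  w j * (uinj (phi (val e)) * (star (w j) * w j)) * uinj (phi (val e')) * star (w j).
  by rewrite !mulrA.
rewrite -w_comm //.
have -> : w j * (star (w j) * w j * uinj (phi (val e))) * uinj (phi (val e')) * star (w j) =
  w j * (star (w j) * w j) * uinj (cmul (phi (val e)) (phi (val e'))) * star (w j).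
  by rewrite uinjM !mulrA.
by rewrite prod0 uinj0 mulr0 mul0r scaler0.
Qed.

Lemma perturbation : exists psi : {linear subalg_type G -> subalg_type B},
  [/\ cpc psi, n_decomposable n psi &
    forall x K, 0 <= K -> pos (uinj (val x)) -> rnorm (val x) <= K ->
      rnorm (val (psi x) - phi (val x)) <= 2 * K * rho].
Proof.
have [psi psiE] := linear_of_fun psi0_linear.
exists psi; split.
- by split; [exact: psi0_cp | exact: psi0_contr].
- exact: psi0_decomposable.
move=> x K K0 px xK; rewrite psiE /=.
have Gx := subalgP x.
have h := perturb_close K0 Gx px xK.
have hphi := le_trans (phi_nrm (val x)) xK.
have -> : kappa%:C%C *: S (val x) - phi (val x) =
    (kappa - 1)%:C%C *: S (val x) - (phi (val x) - S (val x)).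
  by rewrite rmorphB rmorph1 scalerBl scale1r opprB addrA subrK.
apply: le_trans (rnormB _ _) _; rewrite rnormZ rnormR.
have S1 : rnorm (S (val x)) <= K * (1 + rho).
  by have := rnormB (phi (val x)) (phi (val x) - S (val x)); rewrite subKr; lra.
have k1 : `|kappa - 1| = rho * kappa.
  rewrite distrC ger0_norm.
    by rewrite /kappa; field; rewrite gt_eqF.
  by rewrite subr_ge0 invf_le1 // lerDl.
have k0 : 0 <= rho * kappa by rewrite mulr_ge0 // invr_ge0 ltW.
(* The rescaling costs rho kappa K (1 + rho) = K rho, as much as the passage from phi to S. *)
have : `|kappa - 1| * rnorm (S (val x)) <= K * rho.
  rewrite k1; apply: le_trans (ler_wpM2l k0 S1) _.
  suff -> : rho * kappa * (K * (1 + rho)) = K * rho by [].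
  by rewrite /kappa; field; rewrite gt_eqF.
lra.
Qed.

End Perturbation.

(** * The approximation for a hereditary subalgebra *)

Lemma rnorm_tri (R : realType) (V : normedZmodType R[i]) (x y z : V) :
  rnorm (x - z) <= rnorm (x - y) + rnorm (y - z).
Proof. by apply: le_trans (rnormD _ _); rewrite addrA subrK. Qed.

Section Compression.
Context {R : realType} {F : cstarAlgType R} {s : nat} {r : 'I_s -> nat}.
Context { pi : F -> forall i : 'I_s, 'M[R[i]]_(r i)}.
Variable dec : matrix_decomposition pi.
Let one := central dec xpredT.

Lemma central1_norm : rnorm one <= 1.
Proof.
apply: projection_norm; split; [exact: central_star | exact: central_idem].
Qed.

(** With Q = 1 - p, the hypotheses give Q z Q <= C Q g Q + ... bounded by C e^2, hence |Q z| <= C e;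
    and z - p z p = Q z + p (Q z)*, with adjoint on the second factor. *)
Lemma compress_close (p g z : F) (C e : R) : projection p ->
  0 <= C -> 0 <= e -> pos (uinj z) -> rnorm z <= C -> pos (uinj (C%:C%C *: g - z)) ->
  pos (uinj ((e ^+ 2)%:C%C *: one - cmul (one - p) (cmul g (one - p)))) ->
  rnorm (z - cmul p (cmul z p)) <= 2 * (C * e).
Proof.
move=> pproj C0 e0 pz zC pgz pQ; have [ps pp] := pproj.
have oL x : uinj one * uinj x = uinj x by rewrite -uinjM central1.
have oR x : uinj x * uinj one = uinj x by rewrite -uinjM -centralC central1.
have ho : star (uinj one) = uinj one by rewrite -uinj_star central_star.
have hp : star (uinj p) = uinj p by rewrite -uinj_star ps.
have [Q QE] : {Q | Q = uinj one - uinj p} by eexists.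
have hQ : star Q = Q by rewrite QE starB ho hp.
have h1 : nrm (Q * uinj z * star Q) <= C * e ^+ 2.
  rewrite hQ.
  apply: le_trans (nrm_mono (b := (C * e ^+ 2) *: uinj one) (pos_conj_sa hQ pz) _) _.
    have -> : (C * e ^+ 2) *: uinj one - Q * uinj z * Q =
        C *: ((e ^+ 2) *: uinj one - Q * uinj g * Q) + Q * (C *: uinj g - uinj z) * Q.
      by ncring.
    apply: posD; last by apply: pos_conj_sa => //; rewrite -uinjZ -uinjB.
    apply: posZ => //; move: pQ; rewrite uinjB uinjZ !uinjM uinjB -QE.
    by rewrite !mulrA.
  rewrite nrmZ ger0_norm ?mulr_ge0 ?sqr_ge0 // ler_piMr ?mulr_ge0 ?sqr_ge0 //.
  by rewrite uinj_nrm central1_norm.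
have h2 : nrm (Q * uinj z) <= C * e.
  rewrite -(ler_pXn2r (n := 2)) ?nnegrE ?mulr_ge0 ?nrm_ge0 //.
  apply: le_trans (nrm_mul_pos _ pz) _.
  have -> : (C * e) ^+ 2 = C * (C * e ^+ 2) by ring.
  by apply: ler_pM; rewrite ?nrm_ge0 // uinj_nrm.
rewrite -uinj_nrm uinjB !uinjM.
have -> : uinj z - uinj p * (uinj z * uinj p) = Q * uinj z + uinj p * star (Q * uinj z).
  rewrite starM hQ (pos_sa pz) QE mulrBl mulrBr oL oR; ncring.
apply: le_trans (nrmD _ _) _.
have : nrm (uinj p * star (Q * uinj z)) <= 1 * (C * e).
  by apply: nrmM_le; rewrite ?nrm_star // uinj_nrm projection_norm.
lra.
Qed.

End Compression.

Section Approximation.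
Context {R : realType} {A : cstarAlgType R} (B : cstarSubalg A).
Hypothesis B_hered : hereditary B.

(** f = 1 - (1 - h)^N is a polynomial in h without constant term, so it stays in B, while (1 - f) h
    (1 - f) = h (1 - h)^(2N) is small by [nrm_decay]. *)
Lemma approx_unit (h : A) N : subalg_set B h -> pos (uinj h) -> rnorm h <= 1 ->
  exists f, [/\ subalg_set B f, cstar f = f, rnorm f <= 1 &
                1 - uinj f = (1 - uinj h) ^+ N].
Proof.
move=> Bh ph h1; set r := 1 - uinj h.
have pr : pos r by apply: pos_nrm1; rewrite ?uinj_nrm.
have p1r : pos (1 - r) by rewrite subKr.
have [f Bf fE] : usub B (1 - r ^+ N).
  elim: N => [|N IH]; first by exists 0; [exact: subalg0 | rewrite expr0 subrr uinj0].
  have uh : usub B (uinj h) by exists h.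
  have cB := usub_closed B.
  have -> : 1 - r ^+ N.+1 = (1 - r ^+ N) + uinj h - (1 - r ^+ N) * uinj h.
    by rewrite exprSr {2}/r; ncring.
  by apply: csubB => //; [exact: csubD | exact: csubM].
have pf : pos (uinj f) by rewrite -fE; exact: pos_1BX.
exists f; split=> //; last by rewrite -fE subKr.
  by apply: uinj_injective; rewrite uinj_star (pos_sa pf).
rewrite -uinj_nrm; apply: pos_nrm => //; rewrite scale1r -fE subKr; exact: posX.
Qed.

Lemma approx_step n (I : finType) (y : I -> A) (h : A) (C e : R) : dr_property A n ->
  (forall x, subalg_set B (y x)) -> (forall x, pos (uinj (y x))) ->
  subalg_set B h -> pos (uinj h) -> rnorm h <= 1 -> 0 < C ->
  (forall x, pos (uinj (C%:C%C *: h - y x))) -> 0 < e ->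
  exists (F : cstarAlgType R) (psi : {linear subalg_type B -> F})
         (phi : {linear F -> subalg_type B}),
    [/\ finite_dimensional F, cpc psi, cpc phi, n_decomposable n phi &
        forall x (b : subalg_type B), val b = y x -> rnorm (phi (psi b) - b) <= e].
Proof.
move=> drA By py Bh ph h1 C0 Chy e0.
(* The error e is shared in thirds. This t makes the perturbation error 2 C (n + 1) (2 t) equal to e
   / 3, e1 makes the compression error 2 C e1 equal to e / 3, and del bounds the error of the given
   approximation. The cut level eta is e1^2 because [compress_close] takes a square root. *)
pose t := e / (12 * C * n.+1%:R).
have n0 : 0 < n.+1%:R :> R by rewrite ltr0n.
have t0 : 0 < t by rewrite divr_gt0 // !mulr_gt0.
have tt0 : 0 < t ^+ 2 / 2 by rewrite divr_gt0 // exprn_gt0.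
have [g0 g00 polarP] := polar_unit (T := unitz A) tt0.
pose e1 := e / (6 * C); have e10 : 0 < e1 by rewrite divr_gt0 // mulr_gt0.
pose eta := e1 ^+ 2; have eta0 : 0 < eta by rewrite exprn_gt0.
have eg0 : 0 < eta * g0 ^+ 2 / 2 by rewrite divr_gt0 // mulr_gt0 // exprn_gt0.
have [N hN] : exists N, (N + N).+1%:R^-1 <= eta * g0 ^+ 2 / 2.
  have [N hN] := inv_small 1 eg0; exists N.
  by have := hN (N + N)%N (leq_addl _ _); rewrite div1r.
pose del := Num.min (e / 3) (eta * g0 ^+ 2 / 2).
have del0 : 0 < del by rewrite lt_min eg0 andbT divr_gt0.
(* h is approximated along with the y x: the estimate on a_j needs phi(psi(h)) close to h. *)
pose fam (o : option I) := if o is Some x then y x else h.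
have [F [psi [phi [[Ffin [psi_cp psi_c] [phi_cp phi_c] approx] [_ dcp]]]]] :=
  drA _ (fun k : 'I_#|{: option I}| => fam (enum_val k)) del del0.
have {}approx o : rnorm (phi (psi (fam o)) - fam o) <= del.
  have := approx (enum_rank o); rewrite enum_rankK => /ltW.
  by rewrite rnormE lecR.
have [s [r [pi [c [dec phi_oz]]]]] := dcp.
have ppsi x : pos (uinj x) -> pos (uinj (psi x)) by exact: cp_positive.
have pphi x : pos (uinj x) -> pos (uinj (phi x)) by exact: cp_positive.
have npsi x : rnorm (psi x) <= rnorm x by rewrite -lecR -!rnormE; exact: psi_c.
have nphi x : rnorm (phi x) <= rnorm x by rewrite -lecR -!rnormE; exact: phi_c.
set g := psi h; have pg : pos (uinj g) by exact: ppsi.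
have [p [p_proj [/positiveP gp /positiveP Qg [d [V [VV VpV]]]]]] :=
  spectral_projection dec (proj2 (positiveP g) pg) eta0.
have [f [Bf fs f1 fE]] := approx_unit N Bh ph h1.
have [ps pp] := p_proj.
pose colour j := central dec (fun i => c i == j).
have cpE x j : uinj (cmul (colour j) x) = uinj (colour j) * uinj x * uinj (colour j).
  by rewrite -!uinjM -centralC cmulA central_idem.
have hcol j : star (uinj (colour j)) = uinj (colour j) by rewrite -uinj_star central_star.
pose a j := phi (cmul (colour j) p).
have pa j : pos (uinj (a j)).
  by apply: pphi; rewrite cpE; apply: pos_conj_sa => //; exact: projection_pos.
have colour_le j x : pos (uinj x) -> pos (uinj (x - cmul (colour j) x)).
  move=> px; have -> : x - cmul (colour j) x =
      cmul (central dec (fun i => c i != j)) x.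
    apply: (pi_inj dec) => i; rewrite (piB dec) !(pi_central dec).
    by case: eqP; rewrite ?subrr ?subr0.
  have -> : uinj (cmul (central dec (fun i => c i != j)) x) =
    uinj (central dec (fun i => c i != j)) * uinj x * uinj (central dec (fun i => c i != j)).
    by rewrite -!uinjM -centralC cmulA central_idem.
  by apply: pos_conj_sa => //; rewrite -uinj_star central_star.
have pp0 := projection_pos p_proj.
have a1 j : nrm (uinj (a j)) <= 1.
  apply: le_trans (nrm_mono (b := uinj (phi p)) (pa j) _) _.
    by rewrite -uinjB -linearB; apply/pphi/colour_le.
  by rewrite uinj_nrm; apply: le_trans (nphi p) (projection_norm p_proj).
(* From eta a_j <= phi(g) and phi(g) close to h, the norm of eta (1 - f) a_j (1 - f) is at most 1 /
   (2N + 1) + del. Each term is at most eta g0^2 / 2 by the choice of N and del. *)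
have fa j : nrm ((1 - uinj f) * uinj (a j)) <= g0.
  have hr : star (1 - uinj f) = 1 - uinj f by rewrite starB star1 -uinj_star fs.
  have g0' := ltW g00; rewrite -(ler_pXn2r (n := 2)) ?nnegrE ?nrm_ge0 //.
  apply: le_trans (nrm_mul_pos _ (pa j)) _.
  rewrite -[leRHS]mul1r; apply: ler_pM; rewrite ?nrm_ge0 //.
  rewrite hr -(ler_pM2l eta0).
  have pga : pos (uinj (phi g) - eta *: uinj (a j)).
    rewrite -uinjZ -uinjB -linearZ -linearB; apply: pphi.
    have -> : g - eta%:C%C *: cmul (colour j) p =
        (g - eta%:C%C *: p) + eta%:C%C *: (p - cmul (colour j) p).
      by rewrite scalerBr addrA subrK.
    rewrite uinjD uinjZ; apply: posD => //; apply: posZ; first exact: ltW.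
    exact: colour_le.
  set q := 1 - uinj f in hr *.
  have le1 : eta * nrm (q * uinj (a j) * q) <= nrm (q * uinj (phi g) * q).
    have -> : eta * nrm (q * uinj (a j) * q) = nrm (eta *: (q * uinj (a j) * q)).
      by rewrite nrmZ gtr0_norm.
    apply: nrm_mono; first by apply: posZ; [exact: ltW | exact: pos_conj_sa].
    have -> : q * uinj (phi g) * q - eta *: (q * uinj (a j) * q) =
      q * (uinj (phi g) - eta *: uinj (a j)) * q by ncring.
    exact: pos_conj_sa.
  apply: le_trans le1 _.
  have pr : pos (1 - uinj h) by apply: pos_nrm1; rewrite ?uinj_nrm.
  have p1r : pos (1 - (1 - uinj h)) by rewrite subKr.
  have q1 : nrm q <= 1.
    rewrite /q fE; apply: nrmX_le; apply: pos_nrm => //.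
    by rewrite scale1r.
  have le2 : nrm (q * uinj h * q) <= (N + N).+1%:R^-1.
    have -> : q * uinj h * q = (1 - (1 - uinj h)) * (1 - uinj h) ^+ (N + N).
      rewrite /q fE subKr exprD mulrA; congr (_ * _); symmetry; apply: commX.
      by rewrite mulrBr mulrBl mulr1 mul1r.
    exact: nrm_decay.
  have le3 : nrm (q * uinj (phi g - h) * q) <= 1 * del * 1.
    by apply: nrmM_le => //; apply: nrmM_le => //; rewrite uinj_nrm; exact: (approx None).
  have -> : q * uinj (phi g) * q = q * uinj h * q + q * uinj (phi g - h) * q.
    by rewrite uinjB; ncring.
  apply: le_trans (nrmD _ _) _; rewrite mul1r mulr1 in le3.
  have hdel : del <= eta * g0 ^+ 2 / 2 by rewrite ge_min lexx orbT.
  by apply: le_trans (lerD (le_trans le2 hN) (le_trans le3 hdel)) _; rewrite -splitr.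
have huf : star (uinj f) = uinj f by rewrite -uinj_star fs.
have nuf : nrm (uinj f) <= 1 by rewrite uinj_nrm.
have pol j := cid (polarP _ (uinj f) (pa j) (a1 j) huf nuf (fa j)).
pose wp j := projT1 (pol j); have wpP j := projT2 (pol j).
have [phi' [phi'_cpc phi'_dec phi'_close]] := perturbation B_hered (dec := dec) phi_cp phi_c
  phi_oz p_proj VV VpV (wp := wp) Bf fs (ltW t0)
  (fun j => let: And3 h1 _ _ := wpP j in h1)
  (fun j => let: And3 _ h2 _ := wpP j in h2)
  (fun j => let: And3 _ _ h3 := wpP j in h3).
pose G := corner p_proj.
pose psi0 (b : subalg_type B) : subalg_type G :=
  mksub (B := G) (compress_corner p_proj (psi (val b))).
have psi0_lin : linear psi0.
  move=> k x z; apply: val_inj => /=; rewrite linearP /= cmulDl cmulDr.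
  by rewrite cmulZl cmulZr.
have [psi' psi'E] := linear_of_fun psi0_lin.
exists (subalg_type G), psi', phi'; split => //.
- exact: corner_finite_dimensional.
- split.
    move=> k M pM; apply: positive_mx_sub.
    have -> : map_mx val (map_mx psi' M) =
        map_mx (fun y => cmul (cstar p) (cmul y p)) (map_mx psi (map_mx val M)).
      by apply/matrixP => i j; rewrite !mxE psi'E /= ps.
    by apply: positive_mx_cconj; apply: psi_cp; exact: positive_mx_val.
  move=> b; rewrite psi'E !rnormE lecR.
  have -> : rnorm (psi0 b) = rnorm (cmul p (cmul (psi (val b)) p)) by [].
  have p1 := projection_norm p_proj; have p00 := rnorm_ge0 p.
  apply: le_trans (rnormM _ _) _; apply: le_trans (ler_wpM2r (rnorm_ge0 _) p1) _.
  rewrite mul1r; apply: le_trans (rnormM _ _) _.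
  apply: le_trans (ler_wpM2l (rnorm_ge0 _) p1) _; rewrite mulr1.
  exact: npsi.
move=> x b bE.
have yC : rnorm (y x) <= C.
  rewrite -uinj_nrm; apply: le_trans (nrm_mono (b := uinj (C%:C%C *: h)) (py x) _) _.
    by rewrite -uinjB.
  by rewrite uinjZ nrmZ gtr0_norm // uinj_nrm ler_piMr // ltW.
have pz := ppsi _ (py x); set z := psi (y x) in pz.
have zC : rnorm z <= C by apply: le_trans (npsi _) yC.
have hp : star (uinj p) = uinj p by rewrite -uinj_star ps.
have cl : rnorm (z - cmul p (cmul z p)) <= 2 * (C * e1).
  apply: (compress_close (dec := dec) (g := g)) => //; try exact: ltW.
  by rewrite -linearZ -linearB; exact: ppsi.
have pzp : pos (uinj (cmul p (cmul z p))).
  by rewrite !uinjM mulrA; apply: pos_conj_sa.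
have zpC : rnorm (cmul p (cmul z p)) <= C.
  rewrite -uinj_nrm !uinjM -[C]mulr1 -[C * 1]mul1r.
  by do 2!(apply: nrmM_le; rewrite ?uinj_nrm ?projection_norm //).
have main := phi'_close (psi' b) C (ltW C0).
rewrite psi'E /= bE in main; have {}main := main pzp zpC.
have last := approx (Some x); rewrite /= -/z in last.
have mid : rnorm (phi (cmul p (cmul z p)) - phi z) <= 2 * (C * e1).
  by rewrite -linearB; apply: le_trans (nphi _) _; rewrite -rnormN opprB.
have -> : rnorm (phi' (psi' b) - b) = rnorm (val (phi' (psi0 b)) - y x).
  by rewrite psi'E -bE.
have T1 := rnorm_tri (val (phi' (psi0 b))) (phi (cmul p (cmul z p))) (y x).
have T2 := rnorm_tri (phi (cmul p (cmul z p))) (phi z) (y x).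
have E1 : 2 * C * (n.+1%:R * (2 * t)) = e / 3.
  by rewrite /t; field; rewrite !gt_eqF.
have E2 : 2 * (C * e1) = e / 3 by rewrite /e1; field; rewrite gt_eqF.
have E3 : del <= e / 3 by rewrite ge_min lexx.
rewrite E1 in main; rewrite E2 in mid; apply: le_trans T1 _.
have -> : e = e / 3 + (e / 3 + e / 3) by field.
apply: lerD => //; apply: le_trans T2 _; apply: lerD => //.
exact: le_trans last E3.
Qed.

End Approximation.

Lemma dr_property_hereditary (R : realType) (A : cstarAlgType R) (B : cstarSubalg A) n :
  hereditary B -> dr_property A n -> dr_property (subalg_type B) n.
Proof.
move=> hB drA m b eps eps0.
have four i : exists Y : 'I_4 -> subalg_type B,
    (forall k, pos (uinj (val (Y k)))) /\
    b i = Y 0 - Y 1 + ('i : R[i]) *: (Y 2%:R - Y 3%:R).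
  have [p [q [r [s [[Bp Bq Br Bs] [[pp pq pr ps] e]]]]]] := subalg_four_pos (subalgP (b i)).
  exists (fun k => nth (mksub Bp) [:: mksub Bp; mksub Bq; mksub Br; mksub Bs] k); split.
    by case=> -[|[|[|[|k]]]].
  by apply: val_inj; rewrite e.
have [Y YP] := choice four.
pose y (ik : 'I_m * 'I_4) := val (Y ik.1 ik.2).
have By ik : subalg_set B (y ik) by exact: subalgP.
have py ik : pos (uinj (y ik)) by have [h _] := YP ik.1; exact: h.
(* The sum dominates each of its positive terms. Adding 1 to its norm in C keeps the rescaling
   possible when h' = 0. *)
pose h' := \sum_ik y ik.
have Bh' : subalg_set B h'.
  by rewrite /h'; elim/big_rec: _ => [|ik z _ Bz]; [exact: subalg0 | exact: subalgD].
have ph' : pos (uinj h') by rewrite /h' uinj_sum; exact: pos_sum.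
pose C := rnorm h' + 1; have C0 : 0 < C by rewrite ltr_wpDl // rnorm_ge0.
pose h := (C^-1)%:C%C *: h'.
have hC : uinj (C%:C%C *: h) = uinj h'.
  by rewrite !uinjZ scalerA mulfV ?gt_eqF // scale1r.
have Bh : subalg_set B h by exact: subalgZ.
have ph : pos (uinj h) by rewrite uinjZ; apply: posZ => //; rewrite invr_ge0 ltW.
have h1 : rnorm h <= 1.
  rewrite -uinj_nrm uinjZ nrmZ gtr0_norm ?invr_gt0 // ler_pdivrMl // mulr1 uinj_nrm.
  by rewrite lerDl.
have Chy ik : pos (uinj (C%:C%C *: h - y ik)).
  rewrite uinjB hC /h' uinj_sum (bigD1 ik) //= addrAC subrr add0r.
  exact: pos_sum.
(* Four positive pieces make up each b i, with coefficients of modulus 1; their errors add up to at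
   most eps / 2, which gives the strict inequality. *)
have e8 : 0 < eps / 8 by rewrite divr_gt0.
have [F [psi [phi [Ffin psi_cpc phi_cpc phi_dec close]]]] :=
  approx_step hB drA By py Bh ph h1 C0 Chy e8.
exists F, psi, phi; split; last by [].
split=> // i; rewrite rnormE ltcR.
have [_ bE] := YP i.
have cl k : rnorm (phi (psi (Y i k)) - Y i k) <= eps / 8 by apply: (close (i, k)).
have L_lin : linear (fun x => phi (psi x) - x).
  by move=> k x z; rewrite !linearP /= addrACA -scalerDr.
have [L LE] := linear_of_fun L_lin.
rewrite -LE bE linearD linearZ !linearB /=.
apply: le_lt_trans (rnormD _ _) _; rewrite rnormZ.
have -> : rnorm ('i : R[i]) = 1 by rewrite /rnorm normCi.
have := rnormB (L (Y i 0)) (L (Y i 1)).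
have := rnormB (L (Y i 2%:R)) (L (Y i 3%:R)).
have clL k : rnorm (L (Y i k)) <= eps / 8 by rewrite LE.
have := clL 0; have := clL 1; have := clL 2%:R; have := clL 3%:R; lra.
Qed.

Theorem proposition3p10 (R : realType) (A : cstarAlgType R)
    (B : cstarSubalg A) :
  separable A -> hereditary B -> (dr (subalg_type B) <= dr A)%E.
Proof.
move=> _ hB; rewrite /dr; case: pselect => [exB|nB]; case: pselect => [exA|nA].
- rewrite lee_fin ler_nat; case: (ex_minnP exB) => nB _ minB.
  case: (ex_minnP exA) => nA /asboolP drA _; apply: minB.
  by apply/asboolP; exact: dr_property_hereditary.
- exact: leey.
- exfalso; apply: nB; case: exA => n /asboolP drA; exists n; apply/asboolP.
  exact: dr_property_hereditary.
- exact: leey.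
Qed.
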